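(* Let $X$ and $Y$ be locally finite, locally Cohen--Macaulay simplicial complexes of dimension $n$ and let $f\colon X\to Y$ be a simplicial map that is a local homeomorphism and restricts to a simplicial isomorphism $\mathrm{st}\,\tau\to\mathrm{st}\,f(\tau)$ for every simplex $\tau$ of $X$. Then the duality isomorphisms given by cap product with the fundamental classes are natural with respect to the maps induced by $f$ in (co)homology. That is, for every $p$ and every $\phi\in H^p_c(X;h^X_n)$, $$f_*([X]\cap\phi)=[Y]\cap f_!\phi\quad\text{in } H_{n-p}(Y;\mathbb Z),$$ and, if $f$ has finite fibres, for every $\psi\in H^p_c(Y;\mathbb Z)$, $$[X]\cap f^*\psi=f^!([Y]\cap\psi)\quad\text{in } H_{n-p}(X;h_X^n).$$
   Context: Fix orientations of $X$ and $Y$: a total order on the vertices of each simplex such that face inclusions are order preserving. $X_k$ is the set of $k$-simplices; for $\sigma\in X_k$, $\sigma_{\langle j\rangle}$ is the face omitting the $j$-th vertex, $\sigma_{\leq j}$ the face spanned by vertices $0,\dots,j$, and $\sigma_{\geq j}$ the face spanned by vertices $j,\dots,k$. The star $\mathrm{st}\,\sigma$ is the smallest subcomplex containing all simplices having $\sigma$ as a face. A combinatorial sheaf $\mathcal F$ on $X$ is a covariant functor from the poset of simplices of $X$ to abelian groups; a cosheaf $\mathcal G$ is a contravariant one. $H^*_c(X;\mathcal F)$ is the cohomology of $C_c^k(X;\mathcal F)=\bigoplus_{\sigma\in X_k}\mathcal F(\sigma)$ with $(\delta\phi)_\sigma=\sum_i(-1)^i\mathcal F(\sigma_{\langle i\rangle}<\sigma)\phi_{\sigma_{\langle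 i\rangle}}$. $H_*(X;\mathcal G)$ is the homology of $C_k(X;\mathcal G)=\bigoplus_{\sigma\in X_k}\mathcal G(\sigma)$ with differential sending $a\in\mathcal G(\sigma)$ to $\sum_i(-1)^i\mathcal G(\sigma>\sigma_{\langle i\rangle})a$; $H_*^{\mathrm{lf}}$ uses $\prod$ instead of $\bigoplus$. Let $X-\mathring{\mathrm{st}}(\sigma)$ be the subcomplex of simplices not having $\sigma$ as a face. $C_k(X,X-\mathring{\mathrm{st}}(\sigma);\mathbb Z)$ is free on symbols $\sigma\triangleleft\alpha$, $\alpha\in X_k$, $\sigma\leq\alpha$, and the cochain group $C^k$ of the pair has the dual basis $\sigma\triangleleft\alpha^*$. The local homology sheaf is $h^X_k(\sigma)=H_k(X,X-\mathring{\mathrm{st}}(\sigma);\mathbb Z)$ with maps for $\sigma<\tau$ induced by $\sigma\triangleleft\alpha\mapsto\tau\triangleleft\alpha$ (zero if $\tau\not\leq\alpha$); the local cohomology cosheaf is $h_X^k(\sigma)=H^k(X,X-\mathring{\mathrm{st}}(\sigma);\mathbb Z)$ with maps induced by $\tau\triangleleft\alpha^*\mapsto\sigma\triangleleft\alpha^*$. $X$ is locally Cohen--Macaulay of dimension $n$ if $h^X_k(\sigma)=0$ for all nonempty $\sigma$ and all $k\ne n$. Cap products: for $\eta\in C^{\mathrm{lf}}_k(X;h_X^n)$, $\phi\in C^l_c(X;h^X_n)$, $\psi\in C^l_c(X;\mathbb Z)$, $$\eta\cap\phi=\sum_{\sigma\in X_k}\langle h_X^n(\sigma>\sigma_{\geq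 k-l})\eta_\sigma,\phi_{\sigma_{\geq k-l}}\rangle\sigma_{\leq k-l},\qquad \eta\cap\psi=\sum_{\sigma\in X_k}\psi(\sigma_{\geq k-l})h_X^n(\sigma>\sigma_{\leq k-l})\eta_\sigma,$$ with $\langle\cdot,\cdot\rangle$ the evaluation pairing; these descend to (co)homology. The fundamental class $[X]\in H_n^{\mathrm{lf}}(X;h^n_X)$ is the class of $\sum_{\alpha\in X_n}\alpha\triangleleft\alpha^*$; similarly for $Y$. Induced maps: let $\mathfrak o_f(\sigma)=\pm1$ be the sign of the permutation taking the vertices of $f\sigma$ ordered according to $X$ to the same vertices ordered according to $Y$. Then $f_*$ is induced by $\sigma\mapsto\mathfrak o_f(\sigma)f\sigma$ and $f^*$ by $(f^*\psi)(\sigma)=\mathfrak o_f(\sigma)\psi(f\sigma)$. The map $f_!\colon C_c^l(X;h^X_n)\to C_c^l(Y;h^Y_n)$ is given by $\sigma\triangleleft\alpha\mapsto\mathfrak o_f(\sigma)\mathfrak o_f(\alpha)\,f\sigma\triangleleft f\alpha$. The map $f^!\colon C_l(Y;h_Y^n)\to C_l(X;h_X^n)$ (for $f$ with finite fibres) is given by $\sigma\triangleleft\alpha^*\mapsto\sum_{\tau\in f^{-1}\sigma}\mathfrak o_f(\tau)\,\mathfrak o_f(\alpha_\tau)\,\tau\triangleleft\alpha_\tau^*$, where $\alpha_\tau=(f|_{\mathrm{st}\,\tau})^{-1}(\alpha)$. *)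

(* Defs.v *)
From HB Require Import structures.
From mathcomp Require Import all_boot all_order all_fingroup all_algebra.
From mathcomp Require Import generic_quotient ring_quotient finmap.
From mathcomp Require Import boolp classical_sets functions cardinality fsbigop.
From mathcomp Require Import reals topology.

Set Implicit Arguments.
Unset Strict Implicit.
Unset Printing Implicit Defensive.

Import Order.TTheory GRing.Theory Num.Theory.

Local Open Scope classical_set_scope.
Local Open Scope fset_scope.
Local Open Scope ring_scope.
Local Open Scope quotient_scope.

Section DependentFunctions.
Variables (T : Type) (G : T -> zmodType).

Definition dfun := forall t, G t.
HB.instance Definition _ := Choice.on dfun.

Let dadd (a b : dfun) : dfun := fun t => a t + b t.
Let dopp (a : dfun) : dfun := fun t => - a t.
Let dzero : dfun := fun t => 0.

Let daddA : associative dadd.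
Proof. by move=> a b c; apply: functional_extensionality_dep => t; exact: addrA. Qed.
Let daddC : commutative dadd.
Proof. by move=> a b; apply: functional_extensionality_dep => t; exact: addrC. Qed.
Let dadd0 : left_id dzero dadd.
Proof. by move=> a; apply: functional_extensionality_dep => t; exact: add0r. Qed.
Let daddN : left_inverse dzero dopp dadd.
Proof. by move=> a; apply: functional_extensionality_dep => t; exact: addNr. Qed.

HB.instance Definition _ := GRing.isZmodule.Build dfun daddA daddC dadd0 daddN.

Lemma dfunB (a b : dfun) t : (a - b) t = a t - b t. Proof. by []. Qed.
Lemma dfunD (a b : dfun) t : (a + b) t = a t + b t. Proof. by []. Qed.
Lemma dfun0 t : (0 : dfun) t = 0. Proof. by []. Qed.

End DependentFunctions.

Record subgroup (A : zmodType) := Subgroup {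
  sg_set :> A -> Prop;
  sg_set0 : sg_set 0;
  sg_setB : forall x y, sg_set x -> sg_set y -> sg_set (x - y) }.

Section Subquotient.
Variable A : zmodType.

Definition sg_pred (Z : subgroup A) : {pred A} := fun x => `[< Z x >].

Section SubgroupType.
Variable Z : subgroup A.

Fact sg_zmod_closed : zmod_closed (sg_pred Z).
Proof.
split; first by rewrite unfold_in; apply/asboolP; exact: sg_set0.
by move=> x y /asboolP xZ /asboolP yZ; apply/asboolP; exact: sg_setB.
Qed.
HB.instance Definition _ := GRing.isZmodClosed.Build A (sg_pred Z) sg_zmod_closed.

Record sg_type := SgType { sg_val : A; sg_valP : sg_val \in sg_pred Z }.
HB.instance Definition _ := [isSub for sg_val].
HB.instance Definition _ := [Choice of sg_type by <:].
HB.instance Definition _ := [SubChoice_isSubZmodule of sg_type by <:].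

Lemma sg_valB (x y : sg_type) : sg_val (x - y) = sg_val x - sg_val y.
Proof. exact: (raddfB (val : sg_type -> A)). Qed.

End SubgroupType.

Variables Z B : subgroup A.

Definition sg_restr : {pred sg_type Z} := fun x => `[< B (sg_val x) >].

Fact sg_restr_closed : zmod_closed sg_restr.
Proof.
split; first by rewrite unfold_in; apply/asboolP; exact: sg_set0.
by move=> x y /asboolP xB /asboolP yB; apply/asboolP; exact: sg_setB.
Qed.
HB.instance Definition _ := GRing.isZmodClosed.Build (sg_type Z) sg_restr sg_restr_closed.

(* The group Z / (Z ∩ B).  Since it is used with Z = cycles and B = boundaries
   it is the homology group, and no proof of d ∘ d = 0 is needed to form it. *)
Definition subquot : zmodType := Quotient.quot sg_restr.

(* [hclass x] is the class of x if x lies in Z, and 0 otherwise. *)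
Definition hclass (x : A) : subquot :=
  \pi_(Quotient.quot sg_restr) (insubd (0 : sg_type Z) x : sg_type Z).

Definition hrepr (h : subquot) : A := sg_val (repr (h : Quotient.quot sg_restr)).

Lemma hreprP h : Z (hrepr h).
Proof. by apply/asboolP; exact: (sg_valP (repr _)). Qed.

Lemma hreprK : cancel hrepr hclass.
Proof. by move=> h; rewrite /hclass /hrepr valKd reprK. Qed.

Lemma hclass_eq x y : Z x -> Z y -> (hclass x = hclass y) <-> B (x - y).
Proof.
move=> Zx Zy; rewrite /hclass.
have val_in z : Z z -> sg_val (insubd (0 : sg_type Z) z) = z.
  by move=> Zz; rewrite (insubdK (0 : sg_type Z)) // unfold_in; apply/asboolP.
have -> : B (x - y) <->
    (insubd (0 : sg_type Z) x - insubd (0 : sg_type Z) y \in sg_restr).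
  rewrite unfold_in; split => [Bxy|/asboolP].
    by apply/asboolP; rewrite sg_valB !val_in.
  by rewrite sg_valB !val_in.
by rewrite Quotient.idealrBE; split => [->//|/eqP].
Qed.

Lemma hclassB x y : Z x -> Z y -> hclass (x - y) = hclass x - hclass y.
Proof.
move=> Zx Zy; rewrite /hclass -raddfB; congr (\pi _).
apply: val_inj; rewrite [RHS]sg_valB !(insubdK (0 : sg_type Z)) //;
  rewrite unfold_in; apply/asboolP => //; exact: sg_setB.
Qed.

Lemma hclass_repr x : Z x -> B (hrepr (hclass x) - x).
Proof. by move=> Zx; apply/hclass_eq => //; [exact: hreprP|rewrite hreprK]. Qed.

End Subquotient.

(* The map induced on subquotients by a map g of ambient groups: the class of x
   goes to the class of g x.  It is computed on a chosen representative; when g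
   is additive on Z and respects both subgroups, [induced_hclass] shows that the
   choice is immaterial and [induced_zmod] that the map is a homomorphism. *)
Definition induced (A A' : zmodType) (Z B : subgroup A) (Z' B' : subgroup A')
    (g : A -> A') (h : subquot Z B) : subquot Z' B' :=
  hclass Z' B' (g (hrepr h)).
Arguments induced {A A' Z B Z' B'} g h.

Section Induced.
Variables (A A' : zmodType) (Z B : subgroup A) (Z' B' : subgroup A').
Variable g : A -> A'.
Hypothesis gB : forall x y, Z x -> Z y -> g (x - y) = g x - g y.
Hypothesis gZ : forall x, Z x -> Z' (g x).
Hypothesis gb : forall x, Z x -> B x -> B' (g x).

Lemma induced_hclass x : Z x ->
  induced g (hclass Z B x) = hclass Z' B' (g x).
Proof.
move=> Zx; have Zr := hreprP (hclass Z B x).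
apply/hclass_eq; [exact: gZ|exact: gZ|rewrite -gB//].
by apply: gb; [exact: sg_setB|exact: hclass_repr].
Qed.

Lemma induced_zmod : zmod_morphism (induced g : subquot Z B -> subquot Z' B').
Proof.
move=> h k; have [Zh Zk] := (hreprP h, hreprP k).
rewrite -[in LHS](hreprK h) -[in LHS](hreprK k) -hclassB// induced_hclass.
  by rewrite gB// hclassB//; exact: gZ.
exact: sg_setB.
Qed.
End Induced.

Section KernelImage.
Variables (A : zmodType) (C : subgroup A) (d : {additive A -> A}).

Program Definition ker_on : subgroup A :=
  @Subgroup A [set x | C x /\ d x = 0] _ _.
Next Obligation. by split; [exact: sg_set0|rewrite raddf0]. Qed.
Next Obligation.
move=> x y [Cx dx] [Cy dy]; split; first exact: sg_setB.
by rewrite raddfB dx dy subr0.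
Qed.

Program Definition im_on : subgroup A := @Subgroup A [set d x | x in sg_set C] _ _.
Next Obligation. by exists 0; [exact: sg_set0|rewrite raddf0]. Qed.
Next Obligation.
move=> _ _ [x Cx <-] [y Cy <-]; exists (x - y); first exact: sg_setB.
by rewrite raddfB.
Qed.
End KernelImage.

Record lf_complex (V : choiceType) := LfComplex {
  simplex_pred : {pred {fset V}};
  simplex_neq0 : fset0 \notin simplex_pred;
  simplex_vertex : forall v, [fset v] \in simplex_pred;
  simplex_face : forall s t : {fset V}, s \in simplex_pred ->
    t `<=` s -> t != fset0 -> t \in simplex_pred;
  simplex_locfin : forall v : V,
    finite_set [set s : {fset V} | s \in simplex_pred /\ v \in s] }.

Section Complex.
Variable V : choiceType.
Implicit Types (X : lf_complex V) (s t : {fset V}).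

Definition in_complex X (s : {fset V}) : bool := s \in simplex_pred X.
Canonical complex_predType := PredType in_complex.

(* Finite by local finiteness when t is nonempty, so that [fset_set] is then
   faithful (see [in_cofaces]). *)
Definition cofaces X t : {fset {fset V}} :=
  fset_set [set s | s \in X /\ t `<=` s].

Lemma in_cofaces X s t : t \in X -> (s \in cofaces X t) = (s \in X) && (t `<=` s).
Proof.
move=> tX; have /fset0Pn[v vt] : t != fset0.
  by apply: contraTneq tX => ->; exact: (simplex_neq0 X).
rewrite in_fset_set; last first.
  apply: sub_finite_set (simplex_locfin X v) => u [uX tu]; split => //.
  exact: (fsubsetP tu).
by apply/idP/andP => [|[? ?]]; rewrite inE.
Qed.

Record orientation X := Orientation {
  ole : {fset V} -> rel V;
  ole_total : forall s, s \in X -> {in s &, total (ole s)};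
  ole_anti : forall s, s \in X -> {in s &, antisymmetric (ole s)};
  ole_trans : forall s, s \in X -> {in s & &, transitive (ole s)};
  ole_face : forall s t, s \in X -> t \in X -> t `<=` s ->
    {in t &, ole t =2 ole s} }.

Section Faces.
Variables (X : lf_complex V) (o : orientation X).

Definition vseq s : seq V := sort (ole o s) (enum_fset s).
Definition vpos s (v : V) : nat := index v (vseq s).

Definition face s (i : nat) : {fset V} := [fset v in s | vpos s v != i].
Definition front s (i : nat) : {fset V} := [fset v in s | (vpos s v <= i)%N].
Definition back s (i : nat) : {fset V} := [fset v in s | (i <= vpos s v)%N].

(* (-1)^i if t is the face of s omitting the i-th vertex, and 0 if t is not a
   face of codimension one. *)
Definition incid s t : int := \sum_(i < #|` s| | face s i == t) (-1) ^+ i.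

End Faces.

Section Supports.
Variables (G : {fset V} -> zmodType) (P : {pred {fset V}}).

Program Definition supported : subgroup (dfun G) :=
  @Subgroup (dfun G) [set c | forall s, c s <> 0 -> s \in P] _ _.
Next Obligation. by []. Qed.
Next Obligation.
move=> x y xP yP s; rewrite dfunB => xy.
have [xs0|/eqP/xP//] := eqVneq (x s) 0.
by apply: yP => ys0; apply: xy; rewrite xs0 ys0 subrr.
Qed.

Program Definition fin_supported : subgroup (dfun G) :=
  @Subgroup (dfun G)
    [set c | supported c /\ finite_set [set s | c s <> 0]] _ _.
Next Obligation.
split; first exact: sg_set0.
by rewrite (_ : [set s | _] = set0)// -subset0 => s /=; rewrite dfun0.
Qed.
Next Obligation.
move=> x y [xP xfin] [yP yfin]; split; first exact: sg_setB.
apply: (@sub_finite_set _ _ ([set s | x s <> 0] `|` [set s | y s <> 0])%classic).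
  move=> s /=; rewrite dfunB => xy.
  have [xs0|/eqP] := eqVneq (x s) 0; last by left.
  by right => ys0; apply: xy; rewrite xs0 ys0 subrr.
by rewrite finite_setU.
Qed.
End Supports.

(* Simplices with m vertices, i.e. of dimension m - 1; none for m = 0. *)
Definition simplices X (m : nat) : {pred {fset V}} :=
  fun s => (s \in X) && (#|` s| == m).

(* Covariant and contravariant functors on the poset of simplices.  To avoid
   proof arguments in formulas the data are total: the values on vertex sets
   that are not simplices of X, and the maps between simplices not related by
   inclusion, are irrelevant and unconstrained. *)
Record sheaf X := Sheaf {
  sstalk :> {fset V} -> zmodType;
  smap : forall s t, sstalk s -> sstalk t;
  smapB : forall s t, s \in X -> t \in X -> s `<=` t -> zmod_morphism (@smap s t);
  smap_id : forall s, s \in X -> @smap s s =1 id;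
  smap_comp : forall s t u, s \in X -> t \in X -> u \in X ->
    s `<=` t -> t `<=` u -> @smap t u \o @smap s t =1 @smap s u }.

Record cosheaf X := Cosheaf {
  cstalk :> {fset V} -> zmodType;
  cmap : forall s t, cstalk s -> cstalk t;
  cmapB : forall s t, s \in X -> t \in X -> t `<=` s -> zmod_morphism (@cmap s t);
  cmap_id : forall s, s \in X -> @cmap s s =1 id;
  cmap_comp : forall s t u, s \in X -> t \in X -> u \in X ->
    u `<=` t -> t `<=` s -> @cmap t u \o @cmap s t =1 @cmap s u }.

Arguments smap {X} F s t _ : rename.
Arguments cmap {X} G s t _ : rename.

Program Definition constant_sheaf X : sheaf X :=
  @Sheaf X (fun=> int) (fun _ _ => id) _ _ _.
Next Obligation. by []. Qed.
Next Obligation. by []. Qed.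
Next Obligation. by []. Qed.

Program Definition constant_cosheaf X : cosheaf X :=
  @Cosheaf X (fun=> int) (fun _ _ => id) _ _ _.
Next Obligation. by []. Qed.
Next Obligation. by []. Qed.
Next Obligation. by []. Qed.

Section Homology.
Variables (X : lf_complex V) (o : orientation X).

Section SheafCohomology.
Variable F : sheaf X.

(* The condition on i is automatic unless s is a vertex. *)
Definition sheaf_diff (c : dfun F) : dfun F := fun s =>
  if s \in X then
    \sum_(i < #|` s| | face o s i \in X) smap F (face o s i) s (c (face o s i)) *~ (-1) ^+ i
  else 0.

Fact sheaf_diff_zmod : zmod_morphism sheaf_diff.
Proof.
move=> a b; apply: functional_extensionality_dep => s.
rewrite dfunB /sheaf_diff; case: ifP => [sX|_]; last by rewrite subr0.
rewrite -sumrB; apply: eq_bigr => i iX; rewrite dfunB smapB ?mulrzBl//.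
by apply/fsubsetP => v; rewrite !inE => /andP[].
Qed.
HB.instance Definition _ :=
  GRing.isZmodMorphism.Build (dfun F) (dfun F) sheaf_diff sheaf_diff_zmod.

Definition cochains_c m : subgroup (dfun F) := fin_supported F (simplices X m).

Definition cocycles_c k := ker_on (cochains_c k.+1) sheaf_diff.
Definition coboundaries_c k := im_on (cochains_c k) sheaf_diff.
Definition cohomology_c k : zmodType := subquot (cocycles_c k) (coboundaries_c k).

End SheafCohomology.

Section CosheafHomology.
Variable G : cosheaf X.

(* Coefficient at t of the sum over all s and i of (-1)^i G(s > s<i>) (c s). *)
Definition cosheaf_diff (c : dfun G) : dfun G := fun t =>
  if t \in X then
    \sum_(s <- cofaces X t) cmap G s t (c s) *~ incid o s t
  else 0.

Fact cosheaf_diff_zmod : zmod_morphism cosheaf_diff.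
Proof.
move=> a b; apply: functional_extensionality_dep => t.
rewrite dfunB /cosheaf_diff; case: ifP => [tX|_]; last by rewrite subr0.
rewrite -sumrB !big_seq; apply: eq_bigr => s; rewrite in_cofaces// => /andP[sX ts].
by rewrite dfunB cmapB// mulrzBl.
Qed.
HB.instance Definition _ :=
  GRing.isZmodMorphism.Build (dfun G) (dfun G) cosheaf_diff cosheaf_diff_zmod.

Definition chains m : subgroup (dfun G) := fin_supported G (simplices X m).
Definition cycles k := ker_on (chains k.+1) cosheaf_diff.
Definition boundaries k := im_on (chains k.+2) cosheaf_diff.
Definition homology k : zmodType := subquot (cycles k) (boundaries k).

Definition chains_lf m : subgroup (dfun G) := supported G (simplices X m).
Definition cycles_lf k := ker_on (chains_lf k.+1) cosheaf_diff.
Definition boundaries_lf k := im_on (chains_lf k.+2) cosheaf_diff.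
Definition homology_lf k : zmodType := subquot (cycles_lf k) (boundaries_lf k).

End CosheafHomology.

(* c a is the coefficient of the symbol r <| a (of r <| a^* for cochains). *)
Definition loc_fun := dfun (fun _ : {fset V} => int : zmodType).

Definition star_simplices r m : {pred {fset V}} :=
  fun s => simplices X m s && (r `<=` s).

Section LocalHomology.
Variable r : {fset V}.

Definition loc_bd (c : loc_fun) : loc_fun := fun b =>
  if (b \in X) && (r `<=` b) then \sum_(a <- cofaces X b) c a *~ incid o a b else 0.

Fact loc_bd_zmod : zmod_morphism loc_bd.
Proof.
move=> a b; apply: functional_extensionality_dep => s.
rewrite dfunB /loc_bd; case: ifP => [sX|_]; last by rewrite subr0.
by rewrite -sumrB; apply: eq_bigr => i _; rewrite dfunB mulrzBl.
Qed.
HB.instance Definition _ :=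
  GRing.isZmodMorphism.Build loc_fun loc_fun loc_bd loc_bd_zmod.

Definition loc_chains m : subgroup loc_fun :=
  fin_supported (fun=> int : zmodType) (star_simplices r m).
Definition loc_cycles k := ker_on (loc_chains k.+1) loc_bd.
Definition loc_boundaries k := im_on (loc_chains k.+2) loc_bd.
Definition loc_homology k : zmodType :=
  subquot (loc_cycles k) (loc_boundaries k).

(* For a cochain supported on the cofaces of r the sum over the faces of a is
   automatically a sum over the faces of a containing r. *)
Definition loc_cobd (c : loc_fun) : loc_fun := fun a =>
  if a \in X then \sum_(i < #|` a|) c (face o a i) *~ (-1) ^+ i else 0.

Fact loc_cobd_zmod : zmod_morphism loc_cobd.
Proof.
move=> a b; apply: functional_extensionality_dep => s.
rewrite dfunB /loc_cobd; case: ifP => [sX|_]; last by rewrite subr0.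
by rewrite -sumrB; apply: eq_bigr => i _; rewrite dfunB mulrzBl.
Qed.
HB.instance Definition _ :=
  GRing.isZmodMorphism.Build loc_fun loc_fun loc_cobd loc_cobd_zmod.

Definition loc_cochains m : subgroup loc_fun :=
  supported (fun=> int : zmodType) (star_simplices r m).
Definition loc_cocycles k := ker_on (loc_cochains k.+1) loc_cobd.
Definition loc_coboundaries k := im_on (loc_cochains k) loc_cobd.
Definition loc_cohomology k : zmodType :=
  subquot (loc_cocycles k) (loc_coboundaries k).

End LocalHomology.

Section LocalSystems.
Variable k : nat.

Definition loc_restr (t : {fset V}) (c : loc_fun) : loc_fun :=
  fun a => if t `<=` a then c a else 0.

Fact loc_restrB t : zmod_morphism (loc_restr t).
Proof.
move=> a b; apply: functional_extensionality_dep => s.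
by rewrite dfunB /loc_restr; case: ifP => // _; rewrite subr0.
Qed.

Fact loc_restr_bd s t c : s `<=` t ->
  loc_bd t (loc_restr t c) = loc_restr t (loc_bd s c).
Proof.
move=> st; apply: functional_extensionality_dep => b.
rewrite /loc_bd /loc_restr; have [tb|_] := boolP (t `<=` b); last by rewrite andbF.
rewrite (fsubset_trans st tb) !andbT; case: ifP => // bX.
rewrite !big_seq; apply: eq_bigr => a; rewrite in_cofaces// => /andP[_ ba].
by rewrite (fsubset_trans tb ba).
Qed.

Fact loc_restr_chains s t m c : s `<=` t ->
  loc_chains s m c -> loc_chains t m (loc_restr t c).
Proof.
move=> st [cs cfin]; split.
  move=> a; rewrite /loc_restr; case: ifP => // ta /cs.
  by rewrite !unfold_in => /andP[-> _].
by apply: sub_finite_set cfin => a /=; rewrite /loc_restr; case: ifP.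
Qed.

Fact loc_restr_cycles s t c : s `<=` t ->
  loc_cycles s k c -> loc_cycles t k (loc_restr t c).
Proof.
move=> st [cc c0]; split; first exact: loc_restr_chains cc.
rewrite [LHS](loc_restr_bd c st) [loc_bd s c]c0.
by apply: functional_extensionality_dep => a; rewrite /loc_restr; case: ifP.
Qed.

Fact loc_restr_boundaries s t c : s `<=` t ->
  loc_boundaries s k c -> loc_boundaries t k (loc_restr t c).
Proof.
move=> st [b bc <-]; exists (loc_restr t b); first exact: loc_restr_chains bc.
exact: loc_restr_bd.
Qed.

Definition loc_homology_map s t : loc_homology s k -> loc_homology t k :=
  induced (loc_restr t).

Fact loc_homology_mapE s t c : s `<=` t -> loc_cycles s k c ->
  loc_homology_map t (hclass (loc_cycles s k) (loc_boundaries s k) c) =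
  hclass _ _ (loc_restr t c).
Proof.
move=> st cZ; apply: induced_hclass => //.
- by move=> *; exact: loc_restrB.
- by move=> *; exact: loc_restr_cycles st _.
- by move=> *; exact: loc_restr_boundaries st _.
Qed.

Program Definition loc_homology_sheaf : sheaf X :=
  @Sheaf X (fun s => loc_homology s k) loc_homology_map _ _ _.
Next Obligation.
move=> s t _ _ st; apply: induced_zmod.
- by move=> *; exact: loc_restrB.
- by move=> *; exact: loc_restr_cycles st _.
- by move=> *; exact: loc_restr_boundaries st _.
Qed.
Next Obligation.
move=> s _ h; rewrite -[in LHS](hreprK h) loc_homology_mapE//; last exact: hreprP.
rewrite -[RHS](hreprK h); congr hclass; apply: functional_extensionality_dep => a.
have [[cs _] _] := hreprP h; rewrite /loc_restr; case: ifPn => // /negP sa.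
apply: esym; apply: contrapT => ha; have := cs a ha.
by rewrite unfold_in => /andP[_ /sa].
Qed.
Next Obligation.
move=> s t u _ _ _ st tu h /=; rewrite -(hreprK h); have hP := hreprP h.
have su := fsubset_trans st tu; have tP := loc_restr_cycles st hP.
rewrite !loc_homology_mapE//.
congr hclass; apply: functional_extensionality_dep => a; rewrite /loc_restr.
by case: ifP => // ua; rewrite (fsubset_trans tu ua).
Qed.

(* r <| a^* goes to s <| a^*, so coefficients are unchanged. *)
Definition loc_cohomology_map s t : loc_cohomology s k -> loc_cohomology t k :=
  induced id.

Fact loc_cochains_sub s t m c : t `<=` s ->
  loc_cochains s m c -> loc_cochains t m c.
Proof.
move=> ts cs a /cs; rewrite !unfold_in => /andP[-> sa].
exact: fsubset_trans sa.
Qed.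

Fact loc_cocycles_sub s t c : t `<=` s ->
  loc_cocycles s k c -> loc_cocycles t k c.
Proof. by move=> ts [cs c0]; split => //; exact: loc_cochains_sub cs. Qed.

Fact loc_coboundaries_sub s t c : t `<=` s ->
  loc_coboundaries s k c -> loc_coboundaries t k c.
Proof. by move=> ts [b bs <-]; exists b => //; exact: loc_cochains_sub bs. Qed.

Fact loc_cohomology_mapE s t c : t `<=` s -> loc_cocycles s k c ->
  loc_cohomology_map t (hclass (loc_cocycles s k) (loc_coboundaries s k) c) =
  hclass _ _ c.
Proof.
move=> ts cZ; apply: (@induced_hclass _ _ _ _ _ _ id) => //.
- by move=> *; exact: loc_cocycles_sub ts _.
- by move=> *; exact: loc_coboundaries_sub ts _.
Qed.

Program Definition loc_cohomology_cosheaf : cosheaf X :=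
  @Cosheaf X (fun s => loc_cohomology s k) loc_cohomology_map _ _ _.
Next Obligation.
move=> s t _ _ ts; apply: (@induced_zmod _ _ _ _ _ _ id) => //.
- by move=> *; exact: loc_cocycles_sub ts _.
- by move=> *; exact: loc_coboundaries_sub ts _.
Qed.
Next Obligation.
move=> s _ h; rewrite -[in LHS](hreprK h) loc_cohomology_mapE ?hreprK//.
exact: hreprP.
Qed.
Next Obligation.
move=> s t u _ _ _ ut ts h /=; rewrite -(hreprK h); have hP := hreprP h.
have us := fsubset_trans ut ts; have tP := loc_cocycles_sub ts hP.
by rewrite !loc_cohomology_mapE.
Qed.

End LocalSystems.

Definition locally_cohen_macaulay n :=
  forall s, s \in X -> forall k, k <> n -> forall h : loc_homology s k, h = 0.

Section Cap.
Variable n : nat.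
Notation hsheaf := (loc_homology_sheaf n).
Notation hcosheaf := (loc_cohomology_cosheaf n).

(* The pairing and the cap products of classes are evaluated on representatives;
   the value does not depend on them, by the Leibniz rule. *)
Definition loc_pairing r (u : loc_cohomology r n) (z : loc_homology r n) : int :=
  \sum_(a <- cofaces X r) hrepr u a * hrepr z a.

Definition cap_sheaf_chain k l (eta : dfun hcosheaf) (phi : dfun hsheaf) :
    dfun (constant_cosheaf X) := fun t =>
  if t \in X then
    \sum_(s <- cofaces X t | (#|` s| == k.+1) && (front o s (k - l) == t))
      loc_pairing (cmap hcosheaf s (back o s (k - l)) (eta s))
                  (phi (back o s (k - l)))
  else 0.

Definition cap_const_chain k l (eta : dfun hcosheaf)
    (psi : dfun (constant_sheaf X)) : dfun hcosheaf := fun t =>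
  if t \in X then
    \sum_(s <- cofaces X t | (#|` s| == k.+1) && (front o s (k - l) == t))
      cmap hcosheaf s t (eta s) *~ psi (back o s (k - l))
  else 0.

(* For l > k the truncated k - l is 0; both chains above then vanish, since
   back s 0 = s has dimension k whereas the cochain lives in dimension l. *)
Definition cap_sheaf k l (eta : homology_lf hcosheaf k)
    (phi : cohomology_c hsheaf l) : homology (constant_cosheaf X) (k - l) :=
  hclass _ _ (cap_sheaf_chain k l (hrepr eta) (hrepr phi)).

Definition cap_const k l (eta : homology_lf hcosheaf k)
    (psi : cohomology_c (constant_sheaf X) l) : homology hcosheaf (k - l) :=
  hclass _ _ (cap_const_chain k l (hrepr eta) (hrepr psi)).

(* The class of a <| a^* in H^n(X, X - st a). *)
Definition dual_class (a : {fset V}) : loc_cohomology a n :=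
  hclass _ _ ((fun b => (b == a)%:R) : loc_fun).

Definition fundamental_class : homology_lf hcosheaf n :=
  hclass _ _ ((fun a => if simplices X n.+1 a then dual_class a else 0)
                : dfun hcosheaf).

End Cap.
End Homology.

Definition subcomplex X (K : set {fset V}) :=
  (K `<=` [set s | s \in X])%classic /\
  forall s t, K s -> t `<=` s -> t != fset0 -> K t.

Definition star X (r : {fset V}) : set {fset V} :=
  smallest (subcomplex X) [set s | s \in X /\ r `<=` s].

End Complex.

Section SimplicialMaps.
Variables V W : choiceType.
Implicit Types (f : V -> W).

Definition simplicial_on f (K : set {fset V}) (L : set {fset W}) :=
  forall s, K s -> L (f @` s).

Definition simplicial (X : lf_complex V) (Y : lf_complex W) f :=
  simplicial_on f [set s | s \in X] [set s | s \in Y].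

End SimplicialMaps.

Section LocalIsomorphisms.
Variables V W : choiceType.

Definition simplicial_iso_on (f : V -> W) (K : set {fset V}) (L : set {fset W}) :=
  simplicial_on f K L /\
  exists g : W -> V, [/\ simplicial_on g L K,
    forall v, K [fset v] -> g (f v) = v &
    forall w, L [fset w] -> f (g w) = w].

Definition star_iso (X : lf_complex V) (Y : lf_complex W) (f : V -> W) :=
  forall r, r \in X -> simplicial_iso_on f (star X r) (star Y (f @` r)).

Definition fibre (X : lf_complex V) (f : V -> W) (r : {fset W}) : set {fset V} :=
  [set s | s \in X /\ (f @` s) = r].

Definition finite_fibres (X : lf_complex V) (Y : lf_complex W) (f : V -> W) :=
  forall r, r \in Y -> finite_set (fibre X f r).

End LocalIsomorphisms.

Section Realization.
Variables (R : realType) (V : choiceType) (X : lf_complex V).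

Definition barycentric (x : {fsfun V -> R with 0}) : bool :=
  [&& finsupp x \in X, all (fun v => 0 <= x v) (finsupp x)
    & \sum_(v <- finsupp x) x v == 1].

Record realization := Realization {
  bary :> {fsfun V -> R with 0};
  baryP : barycentric bary }.

HB.instance Definition _ := [isSub for bary].
HB.instance Definition _ := [Choice of realization by <:].

(* The coherent topology: U is open iff its intersection with every closed
   simplex is open for the Euclidean topology of that simplex. *)
Definition realization_open (U : set realization) :=
  forall (s : {fset V}) (x : realization), s \in X -> finsupp x `<=` s -> U x ->
  exists2 e : R, 0 < e & forall y : realization, finsupp y `<=` s ->
    (forall v, v \in s -> `|y v - x v| < e) -> U y.

Fact realization_openT : realization_open setT.
Proof. by move=> s x _ _ _; exists 1. Qed.

Fact realization_openI : setI_closed realization_open.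
Proof.
move=> A B Ao Bo s x sX xs [Ax Bx].
have [e e0 eA] := Ao s x sX xs Ax; have [d d0 dB] := Bo s x sX xs Bx.
exists (Num.min e d); first by rewrite lt_min e0.
move=> y ys xy; split; [apply: eA => // v vs|apply: dB => // v vs];
  by have := xy v vs; rewrite lt_min => /andP[].
Qed.

Fact realization_open_bigcup (I : Type) (A : I -> set realization) :
  (forall i, realization_open (A i)) -> realization_open ((\bigcup_i A i)%classic).
Proof.
move=> Ao s x sX xs [i _ Ax]; have [e e0 eA] := Ao i s x sX xs Ax.
by exists e => // y ys xy; exists i => //; exact: eA.
Qed.

HB.instance Definition _ := isOpenTopological.Build realization
  realization_openT realization_openI realization_open_bigcup.

End Realization.

Section RealizationMap.
Variables (R : realType) (V W : choiceType).
Variables (X : lf_complex V) (Y : lf_complex W) (f : V -> W).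
Hypothesis fS : simplicial X Y f.

Definition bary_push (x : {fsfun V -> R with 0}) : {fsfun W -> R with 0} :=
  [fsfun w in (f @` finsupp x) => \sum_(v <- finsupp x | f v == w) x v].

Fact bary_push_barycentric (x : realization R X) : barycentric Y (bary_push x).
Proof.
case: x => x /= /and3P[xX /allP x0 /eqP x1].
have pushE w : w \in (f @` finsupp x) ->
    bary_push x w = \sum_(v <- finsupp x | f v == w) x v.
  by move=> wx; rewrite fsfun_ffun insubT.
have push_ge0 w : w \in (f @` finsupp x) -> 0 <= bary_push x w.
  move=> wx; rewrite pushE// big_seq_cond sumr_ge0// => v /andP[vx _].
  exact: x0.
have suppE : finsupp (bary_push x) = (f @` finsupp x).
  apply/fsetP => w; rewrite mem_finsupp.
  have [wx|wx] := boolP (w \in (f @` finsupp x)); last first.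
    by rewrite fsfun_ffun insubF ?eqxx//; apply/negbTE.
  rewrite pushE//; have /imfsetP[v /= vx wE] := wx.
  rewrite gt_eqF// big_mkcond (big_fsetD1 v)//= wE eqxx ltr_pwDl//.
    by rewrite lt_neqAle x0// andbT eq_sym -mem_finsupp.
  rewrite big_seq_cond sumr_ge0// => u /andP[]; rewrite !inE => /andP[_ ux] _.
  by case: ifP => // _; exact: x0.
rewrite /barycentric suppE; apply/and3P; split.
- exact: fS.
- by apply/allP => w wx; exact: push_ge0.
- rewrite -x1 big_seq (eq_bigr _ pushE) -big_seq.
  rewrite (exchange_big_dep xpredT)//= big_seq [eqbRHS]big_seq; apply/eqP.
  apply: eq_bigr => v vx; rewrite big_mkcond (big_fsetD1 (f v)) ?in_imfset//= eqxx.
  rewrite big_seq big1 ?addr0// => w; rewrite !inE eq_sym => /andP[/negbTE-> _].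
  by [].
Qed.

Definition realization_map (x : realization R X) : realization R Y :=
  Realization (bary_push_barycentric x).

End RealizationMap.

Definition local_homeomorphism (S T : topologicalType) (g : S -> T) :=
  forall x : S, exists A : set S,
    [/\ open A, A x, open (g @` A)%classic, {within A, continuous g} &
        exists h : T -> S, (forall y, A y -> h (g y) = y) /\
          {within (g @` A)%classic, continuous h}].

(* The sign of the permutation p with s_i = t_(p i). *)
Definition perm_sign (T : eqType) (s t : seq T) : int :=
  if [pick p : 'S_(size s) | [forall i : 'I_(size s), onth s i == onth t (p i)]] is Some p
  then (-1) ^+ odd_perm p else 0.

Section InducedMaps.
Variables (V W : choiceType) (X : lf_complex V) (Y : lf_complex W).
Variables (oX : orientation X) (oY : orientation Y) (f : V -> W).

Definition osign (s : {fset V}) : int :=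
  perm_sign (map f (vseq oX s)) (vseq oY (f @` s)).

Definition push_chain (c : dfun (constant_cosheaf X)) :
    dfun (constant_cosheaf Y) := fun r =>
  \sum_(s \in fibre X f r) (osign s * c s : int).

Definition homology_push k :
  homology oX (constant_cosheaf X) k -> homology oY (constant_cosheaf Y) k :=
  induced push_chain.

Definition pull_cochain (c : dfun (constant_sheaf Y)) :
    dfun (constant_sheaf X) := fun s =>
  if s \in X then (osign s * c (f @` s) : int) else 0.

Definition cohomology_pull k :
  cohomology_c oY (constant_sheaf Y) k -> cohomology_c oX (constant_sheaf X) k :=
  induced pull_cochain.

Section Shriek.
Variable n : nat.

(* s <| a  |->  o(a) (r <| f a), used for r = f s. *)
Definition loc_push (s : {fset V}) (c : loc_fun V) : loc_fun W := fun b =>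
  \sum_(a <- cofaces X s | (f @` a) == b) osign a * c a.

Definition loc_homology_push s r :
    loc_homology oX s n -> loc_homology oY r n :=
  induced (loc_push s).

Definition shriek_cochain (c : dfun (loc_homology_sheaf oX n)) :
    dfun (loc_homology_sheaf oY n) := fun r =>
  \sum_(s \in fibre X f r) (loc_homology_push r (c s) *~ osign s).

Definition cohomology_shriek l :
  cohomology_c oX (loc_homology_sheaf oX n) l ->
  cohomology_c oY (loc_homology_sheaf oY n) l :=
  induced shriek_cochain.

(* r <| a^*  |->  o(a_t) (t <| a_t^* ), used for r = f t: the coefficient at a
   simplex b containing t is the one at f b, because b = a_t iff a = f b. *)
Definition loc_pull (t : {fset V}) (c : loc_fun W) : loc_fun V := fun b =>
  if (b \in X) && (t `<=` b) then osign b * c (f @` b) else 0.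

Definition loc_cohomology_pull r t :
    loc_cohomology oY r n -> loc_cohomology oX t n :=
  induced (loc_pull t).

Definition shriek_chain (c : dfun (loc_cohomology_cosheaf oY n)) :
    dfun (loc_cohomology_cosheaf oX n) := fun t =>
  if t \in X then loc_cohomology_pull t (c (f @` t)) *~ osign t else 0.

Definition homology_shriek l :
  homology oY (loc_cohomology_cosheaf oY n) l ->
  homology oX (loc_cohomology_cosheaf oX n) l :=
  induced shriek_chain.

End Shriek.
End InducedMaps.

Arguments homology_push {V W X Y} oX oY f {k} _.
Arguments cohomology_pull {V W X Y} oX oY f {k} _.
Arguments cohomology_shriek {V W X Y} oX oY f {n l} _.
Arguments homology_shriek {V W X Y} oX oY f {n l} _.
Arguments realization_map R {V W X Y f} fS _.

(* Main.v *)
Require Import Defs.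
From mathcomp Require Import all_boot all_order all_algebra finmap reals topology.
From HB Require Import structures.
From mathcomp Require Import all_fingroup boolp classical_sets functions cardinality fsbigop.
From mathcomp Require Import ring zify.

Set Implicit Arguments.
Unset Strict Implicit.
Unset Printing Implicit Defensive.

Import Order.TTheory GRing.Theory Num.Theory.

Local Open Scope classical_set_scope.
Local Open Scope fset_scope.
Local Open Scope ring_scope.

(** The complexes have dimension n, so that h_n(r) is a group of cycles, the
fundamental class has a single representative, and [X] ∩ φ has at t the
coefficient Σ φ_{back α}(α), summed over the n-simplices α whose front face is t.
If the orientation of X is the one pulled back from Y along f, all signs
disappear; since f is injective on simplices, it identifies the faces of α with
the faces of f α and naturality holds for chains.

It remains to see that reorienting X changes the cap products by boundaries.
Cochains are extended to words in the vertices, with values 0 on degenerate words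
and signs under permutations; the product of the front and back parts of a word
obeys a Leibniz rule.  The two orderings of a simplex are, up to sign, homotopic
among words by a homotopy that respects faces.  Evaluating the Leibniz rule on it
gives the bounding chain: the terms on the facets of the n-simplices cancel
because φ takes values in cycles, or are coboundaries in h^n(t). *)

(** * Words of vertices *)

(** The homotopy between two orders of a simplex cones from a vertex of the simplex itself and so
    repeats vertices; this is why words replace ordered simplices. Only integer functions of words
    are evaluated, so the homotopy is kept as a functional and no free group on words is formed. The
    same Leibniz computation serves the plain evaluation at an ordered simplex, which treats
    products with cocycles and coboundaries, and the homotopy, which lengthens words by one letter;
    [local_functional] covers both through its parameter [d].

    With values in h_n, the coefficient [z r a] depends on the n-simplex a as well as on r. The
    Leibniz rule is therefore applied to each a with its own integer cochain, and terms at a common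
    facet are collected afterwards. As h_n has no boundaries to divide by, its classes are handled
    as functions of a; h^n(t) is a true quotient, and identities there hold for representing
    cochains up to coboundaries of the pair at t. Products of classes use chosen representatives, so
    the explicit f_!φ and f^*ψ have to be compared with these through products with coboundaries. *)

Section SequenceCochains.
Variable T : eqType.
Implicit Types (g h : seq T -> int) (s u r : seq T).

(* The alternating sum of [g] over the words obtained from [s] by omitting one
   letter, in recursive form (see [sdiffE]). *)
Fixpoint sdiff g s : int :=
  if s is v :: u then g u - sdiff (fun w => g (v :: w)) u else 0.

Lemma eq_sdiff g h s :
  (forall w, subseq w s -> (size w).+1 = size s -> g w = h w) ->
  sdiff g s = sdiff h s.
Proof.
elim: s g h => [//|v u IH] g h gh /=; rewrite (gh u (subseq_cons u v))//.
by congr (_ - _); apply: IH => w wu sw; apply: gh; rewrite /= ?eqxx// sw.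
Qed.

Lemma sdiff_sum I (r : seq I) (a : I -> int) (h : I -> seq T -> int) s :
  sdiff (fun w => \sum_(i <- r) a i * h i w) s = \sum_(i <- r) a i * sdiff (h i) s.
Proof.
elim: s h => [|v u IH] h /=; first by rewrite big1// => i _; rewrite mulr0.
by rewrite IH -sumrB; apply: eq_bigr => i _; rewrite mulrBr.
Qed.

Lemma sdiffZ a g s : sdiff (fun w => a * g w) s = a * sdiff g s.
Proof. by elim: s g => [|v u IH] g /=; rewrite ?mulr0// IH mulrBr. Qed.

Lemma sdiffB g h s : sdiff (fun w => g w - h w) s = sdiff g s - sdiff h s.
Proof.
elim: s g h => [|v u IH] g h /=; first by rewrite subr0.
by rewrite IH !opprB addrACA [in RHS]addrACA; congr (_ + _); rewrite addrC.
Qed.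

Lemma sdiff_sdiff g s : sdiff (sdiff g) s = 0.
Proof. by elim: s g => //= v u IH g; rewrite sdiffB IH subr0 subrr. Qed.

Definition del i s := take i s ++ drop i.+1 s.

Lemma sdiffE g s : sdiff g s = \sum_(i < size s) (-1) ^+ i * g (del i s).
Proof.
elim: s g => [|v u IH] g; first by rewrite big_ord0.
rewrite big_ord_recl /= /del take0 drop1 /= expr0 mul1r IH -sumrN.
by congr (_ + _); apply: eq_bigr => i _; rewrite /bump /= add1n exprS mulN1r mulNr.
Qed.

(** The front and back words share the letter at position q. Omitting the last letter of the longer
    front word and omitting the first letter of the longer back word give the same product with
    opposite signs, so the right side contains nothing beyond the expected terms. *)
Lemma sdiff_cup g h q s : (q.+1 < size s)%N ->
  sdiff (fun w => g (take q.+1 w) * h (drop q w)) s =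
  sdiff g (take q.+2 s) * h (drop q.+1 s) +
  (-1) ^+ q * (g (take q.+1 s) * sdiff h (drop q s)).
Proof.
elim: q g s => [|q IH] g [|v s]// ss.
  case: s ss => // x s _; rewrite /= !take0 expr0 mul1r.
  by rewrite sdiffZ; ring.
by rewrite /= (IH (fun w => g (v :: w)))//= exprS; ring.
Qed.

(** * Sorting words and alternating functions of words *)

Section Sorting.
Variable L : rel T.

(* Insertion sort without repetitions; [sgn] is the sign of the sorting
   permutation, and 0 on words with a repeated letter. *)
Fixpoint ins v r := if r is w :: r' then
  if w == v then r else if L v w then v :: r else w :: ins v r' else [:: v].

Fixpoint ins_sign v r : int := if r is w :: r' then
  if w == v then 0 else if L v w then 1 else - ins_sign v r' else 1.

Fixpoint nsort s := if s is v :: u then ins v (nsort u) else [::].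

Fixpoint sgn s : int := if s is v :: u then ins_sign v (nsort u) * sgn u else 1.

Definition strict : rel T := fun v w => (v != w) && L v w.

Lemma mem_ins v r : ins v r =i v :: r.
Proof.
elim: r => //= w r IH x; case: eqVneq => [->|_]; first by rewrite !inE orbA orbb.
by case: ifP => // _; rewrite inE IH !inE orbCA.
Qed.

Lemma mem_nsort s : nsort s =i s.
Proof. by elim: s => //= v s IH x; rewrite mem_ins !inE IH. Qed.

Lemma ins_lt v r : all (strict v) r -> ins v r = v :: r /\ ins_sign v r = 1.
Proof. by case: r => //= w r /andP[/andP[vw ->] _]; rewrite eq_sym (negPf vw). Qed.

Lemma nsort_id s : pairwise strict s -> nsort s = s /\ sgn s = 1.
Proof.
by elim: s => //= v s IH /andP[vs /IH[-> ->]]; have [-> ->] := ins_lt vs; rewrite mulr1.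
Qed.

Variable D : {pred T}.
Hypothesis Ltot : {in D &, total L}.
Hypothesis Lanti : {in D &, antisymmetric L}.
Hypothesis Ltr : {in D & &, transitive L}.

Lemma strictN v w : v \in D -> w \in D -> w != v -> ~~ L v w -> strict w v.
Proof.
by move=> vD wD wv vw; rewrite /strict wv; have := Ltot vD wD; rewrite (negPf vw).
Qed.

Lemma strict_all v w r : v \in D -> w \in D -> all D r ->
  strict v w -> all (strict w) r -> all (strict v) r.
Proof.
move=> vD wD rD /andP[vw Lvw] wr; apply/allP => x xr.
have xD := allP rD x xr; have /andP[wx Lwx] := allP wr x xr.
rewrite /strict (Ltr wD vD xD Lvw Lwx) andbT; apply/eqP => vx.
by move: wx; rewrite -vx (@Lanti v w)// ?eqxx// Lvw vx.
Qed.

Lemma ins_strict v r : v \in D -> all D r -> pairwise strict r -> pairwise strict (ins v r).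
Proof.
move=> vD; elim: r => //= w r IH /andP[wD rD] /andP[wr pr].
case: eqVneq => [//|wv] /=; first by rewrite wr.
case: ifPn => [vw|vw] /=.
  rewrite wr pr !andbT; have lvw : strict v w by rewrite /strict eq_sym wv.
  by rewrite lvw (strict_all vD wD).
rewrite IH// andbT; apply/allP => x; rewrite mem_ins inE => /orP[/eqP->|/(allP wr)//].
exact: strictN.
Qed.

Lemma all_nsort s : all D s -> all D (nsort s).
Proof. by move=> /allP sD; apply/allP => x; rewrite mem_nsort; exact: sD. Qed.

Lemma nsort_strict s : all D s -> pairwise strict (nsort s).
Proof. by elim: s => //= v s IH /andP[vD sD]; rewrite ins_strict ?IH ?all_nsort. Qed.

Lemma ins_sign_mem v r : v \in D -> all D r -> pairwise strict r ->
  if v \in r then ins_sign v r = 0 else ins_sign v r * ins_sign v r = 1.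
Proof.
move=> vD; elim: r => //= w r IH /andP[wD rD] /andP[wr pr].
rewrite inE eq_sym; case: eqVneq => [//|wv] /=.
have := IH rD pr; case: ifPn => [vr ->|vr r1]; case: ifPn => vw; rewrite ?oppr0 ?mulrNN//.
move: wv; rewrite (@Lanti w v) ?eqxx// vw andbT.
by have /andP[] := allP wr _ vr.
Qed.

Lemma sgn_mem s : all D s -> if uniq s then sgn s * sgn s = 1 else sgn s = 0.
Proof.
elim: s => //= v s IH /andP[vD sD].
have := ins_sign_mem vD (all_nsort sD) (nsort_strict sD); rewrite mem_nsort.
have := IH sD; case: (v \in s) => /= [_ ->|]; first by rewrite mul0r.
by case: ifP => [_ s1 v1|_ -> _]; rewrite ?mulr0// mulrACA s1 v1.
Qed.

(** The Koszul rule ∂(v ∧ r) = r - v ∧ ∂r, with v ∧ r written in increasing order by insertion. If v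
    already occurs in r, the left side is 0 and the two terms on the right cancel. *)
Lemma sdiff_ins g v r : v \in D -> all D r -> pairwise strict r ->
  ins_sign v r * sdiff g (ins v r) =
  g r - sdiff (fun w => ins_sign v w * g (ins v w)) r.
Proof.
move=> vD; elim: r g => [|w r IH] g /=; first by rewrite mul1r !subr0.
move=> /andP[wD rD] /andP[wr pr]; case: eqVneq => [wv|wv] /=.
  rewrite mul0r; rewrite wv in wr; have [-> ->] := ins_lt wr.
  by rewrite sdiffZ mul1r wv mul0r subr0 subrr.
case: ifPn => [vw|vw] /=.
  have lvw : strict v w by rewrite /strict eq_sym wv.
  have [-> ->] := ins_lt (strict_all vD wD rD lvw wr).
  by rewrite sdiffZ !mul1r.
rewrite [in RHS](eq_sdiff (h := fun w0 => - 1 * (ins_sign v w0 * g (w :: ins v w0)))); last first.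
  by move=> x _ _; rewrite mulNr mul1r mulNr.
rewrite sdiffZ mulrBr mulNr.
have := IH (fun x => g (w :: x)) rD pr; set A := sdiff _ (ins v r); set B := sdiff _ r.
by move=> AB; rewrite !mulNr AB; ring.
Qed.

(** Sorting with sign is a chain map from words to increasing words that sends degenerate words to
    0. Dually, the alternating extension of functions commutes with the coboundary. *)
Lemma sdiff_sgn g s : all D s ->
  sdiff (fun w => sgn w * g (nsort w)) s = sgn s * sdiff g (nsort s).
Proof.
elim: s g => [|v s IH] g /=; first by rewrite mulr0.
move=> /andP[vD sD].
rewrite (eq_sdiff (h := fun w => sgn w * (ins_sign v (nsort w) * g (ins v (nsort w))))).
  rewrite (IH (fun r => ins_sign v r * g (ins v r)))// -mulrBr.
  by rewrite -sdiff_ins ?all_nsort ?nsort_strict//; ring.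
by move=> w _ _; rewrite mulrCA mulrA.
Qed.

Lemma strict_sorted_eq r s : all D r -> pairwise strict r -> pairwise strict s ->
  r =i s -> r = s.
Proof.
have hd v r0 x : all (strict v) r0 -> x \in v :: r0 -> (x == v) || strict v x.
  by move=> vr; rewrite inE => /orP[->//|/(allP vr) ->]; rewrite orbT.
elim: r s => [|v r IH] [|w s] //=.
- by move=> _ _ _ /(_ w); rewrite inE eqxx.
- by move=> _ _ _ /(_ v); rewrite inE eqxx.
move=> /andP[vD rD] /andP[vr pr] /andP[ws ps] rs.
have vw : v = w.
  have wr : w \in v :: r by rewrite rs mem_head.
  have wD : w \in D by move: wr; rewrite inE => /orP[/eqP->//|/(allP rD)].
  have := hd _ _ _ vr wr; case/orP => [/eqP->//|/andP[_ lvw]].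
  have vs : v \in w :: s by rewrite -rs mem_head.
  have := hd _ _ _ ws vs; case/orP => [/eqP->//|/andP[_ lwv]].
  by apply: Lanti; rewrite ?lvw.
rewrite -vw in ws rs *; congr (_ :: _); apply: IH => // x.
have := rs x; rewrite !inE; case: eqVneq => //= -> _.
have nin y : all (strict v) y -> (v \in y) = false.
  by move=> vy; apply/negP => /(allP vy); rewrite /strict eqxx.
by rewrite !nin.
Qed.

End Sorting.

Lemma eq_ins L L' v r : {in r, L v =1 L' v} ->
  ins L v r = ins L' v r /\ ins_sign L v r = ins_sign L' v r.
Proof.
elim: r => [|w r IH LL] /=; first by []. rewrite LL ?mem_head//.
by have [|-> ->] := IH _ => // x xr; apply: LL; rewrite inE xr orbT.
Qed.

Lemma eq_nsort L L' s : {in s &, L =2 L'} -> nsort L s = nsort L' s /\ sgn L s = sgn L' s.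
Proof.
elim: s => //= v s IH LL.
have /IH[-> ->] : {in s &, L =2 L'} by move=> x y xs ys; apply: LL; rewrite inE ?xs ?ys orbT.
have [|-> ->//] := @eq_ins L L' v (nsort L' s).
by move=> x; rewrite mem_nsort => xs; apply: LL; rewrite inE ?eqxx ?xs ?orbT.
Qed.

End SequenceCochains.

Section SortMap.
Variables (T U : eqType) (f : T -> U) (L : rel U).

Lemma ins_map v r : {in v :: r &, injective f} ->
  ins L (f v) (map f r) = map f (ins (relpre f L) v r) /\
  ins_sign L (f v) (map f r) = ins_sign (relpre f L) v r.
Proof.
elim: r => //= w r IH fi.
have -> : (f w == f v) = (w == v) by apply: (inj_in_eq fi); rewrite !inE eqxx ?orbT.
have [|-> ->] := IH.
  move=> x y xr yr; apply: fi.
    by move: xr; rewrite !inE => /orP[->|->]; rewrite ?orbT.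
  by move: yr; rewrite !inE => /orP[->|->]; rewrite ?orbT.
by do 2 case: ifP => //.
Qed.

Lemma nsort_map s : {in s &, injective f} ->
  nsort L (map f s) = map f (nsort (relpre f L) s) /\
  sgn L (map f s) = sgn (relpre f L) s.
Proof.
elim: s => //= v s IH fi.
have [|-> ->] := IH; first by move=> x y xs ys; apply: fi; rewrite inE ?xs ?ys orbT.
have [|-> ->//] := @ins_map v (nsort (relpre f L) s).
by move=> x y; rewrite !inE !mem_nsort; exact: fi.
Qed.

End SortMap.

(** * The sign of the sorting permutation *)

Section PermSign.
Variables (T : eqType) (L : rel T) (D : {pred T}).
Hypothesis Ltot : {in D &, total L}.
Hypothesis Lanti : {in D &, antisymmetric L}.
Hypothesis Ltr : {in D & &, transitive L}.

Lemma ins_split v r : v \notin r -> exists p1 p2,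
  [/\ r = p1 ++ p2, ins L v r = p1 ++ v :: p2 & ins_sign L v r = (-1) ^+ size p1].
Proof.
elim: r => [_|w r IH] /=; first by exists [::], [::].
rewrite inE negb_or eq_sym => /andP[/negPf-> /IH[p1 [p2 [-> -> ->]]]].
case: ifP => _; first by exists [::], (w :: p1 ++ p2).
by exists (w :: p1), p2; rewrite /= exprS mulN1r.
Qed.

Lemma onth_inj (r : seq T) i j : uniq r -> (i < size r)%N -> (j < size r)%N ->
  onth r i = onth r j -> i = j.
Proof.
move=> ur ir jr; rewrite !onthE => /eqP; rewrite nth_uniq ?size_map// => [/eqP//|].
by rewrite map_inj_uniq// => x y [].
Qed.

Lemma nsort_perm s : uniq s -> all D s -> exists2 p : 'S_(size s),
  (forall i : 'I_(size s), onth s i = onth (nsort L s) (p i)) & (-1) ^+ odd_perm p = sgn L s.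
Proof.
elim: s => [_ _|v u IH /= /andP[vu uu] /andP[vD uD]].
  by exists 1%g => [[]//|]; rewrite odd_perm1.
have [p pE p1] := IH uu uD.
have [|r1 [r2 [rE -> ->]]] := @ins_split v (nsort L u); first by rewrite mem_nsort.
have su : size u = (size r1 + size r2)%N.
  rewrite -size_cat -rE; apply/perm_size; apply: uniq_perm => //.
    by apply: (@pairwise_uniq _ (strict L)) => [x|]; rewrite ?/strict ?eqxx// (nsort_strict Ltot).
  by move=> x; rewrite mem_nsort.
have jP : (size r1 < (size u).+1)%N by rewrite su ltnS leq_addr.
(* The first letter goes to its place of insertion, after [r1], and the others follow [p]. The lift
   changes the parity by [size r1], the number of letters passed. *)
exists (lift_perm ord0 (Ordinal jP) p) => [i|].
  have [k ->|->] := unliftP ord0 i; last by rewrite lift_perm_id /= onth_cat ltnn subnn.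
  rewrite lift_perm_lift /= pE rE /bump; set m := nat_of_ord (p k).
  rewrite !onth_cat; case: (ltnP m (size r1)) => mr.
    by rewrite add0n mr.
  by rewrite add1n ltnNge leqW//= subSn.
by rewrite odd_lift_perm /= signr_addb signr_odd p1.
Qed.

(** The sorted word has no repetitions, so only one permutation matches it with [s], and the one
    picked in [perm_sign] is the one constructed by insertion. *)
Lemma perm_sign_nsort s : uniq s -> all D s -> perm_sign s (nsort L s) = sgn L s.
Proof.
move=> us sD; have [p pE <-] := nsort_perm us sD.
rewrite /perm_sign; case: pickP => [q /forallP qE|/(_ p)]; last first.
  by case/negP; apply/forallP => i; apply/eqP.
congr ((-1) ^+ nat_of_bool _); congr odd_perm; apply/permP => i; apply: val_inj.
have un : uniq (nsort L s).
  by apply: (@pairwise_uniq _ (strict L)) => [x|]; rewrite ?/strict ?eqxx// (nsort_strict Ltot).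
have sn : size (nsort L s) = size s.
  by apply/perm_size; apply: uniq_perm => // x; rewrite mem_nsort.
apply: (onth_inj un); rewrite ?sn ?ltn_ord//.
by rewrite -(eqP (qE i)).
Qed.
End PermSign.

(** * The homotopy from a word to its normal form *)

Section Homotopy.
Variables (T : eqType) (nf : seq T -> seq T) (sg : seq T -> int).
Hypothesis nf_mem : forall s, nf s =i s.

(* Acyclic carriers in dual form: a homotopy between [s |-> s] and
   [s |-> sg s * nf s], constructed by coning over the first letter of [s] and
   evaluated on a function [g] of words (see [sdiff_htpy]). *)
Fixpoint htpy_rec k (s : seq T) (g : seq T -> int) : int :=
  if k is k'.+1 then
    if s is v :: _ then
      g (v :: s) - sg s * g (v :: nf s) -
      sdiff (fun w => htpy_rec k' w (fun u => g (v :: u))) s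
    else 0
  else 0.

Definition htpy s := htpy_rec (size s) s.

Lemma htpy_cons v s g : htpy (v :: s) g =
  g (v :: v :: s) - sg (v :: s) * g (v :: nf (v :: s)) -
  sdiff (fun w => htpy w (fun u => g (v :: u))) (v :: s).
Proof.
rewrite -[LHS]/(g (v :: v :: s) - sg (v :: s) * g (v :: nf (v :: s)) -
  sdiff (fun w => htpy_rec (size s) w (fun u => g (v :: u))) (v :: s)).
by congr (_ - _); apply: eq_sdiff => w _ [sw]; rewrite /htpy sw.
Qed.

Lemma htpy_sum I (r : seq I) (a : I -> int) (h : I -> seq T -> int) s :
  htpy s (fun u => \sum_(i <- r) a i * h i u) = \sum_(i <- r) a i * htpy s (h i).
Proof.
have [n sn] := ubnP (size s); elim: n s sn h => // n IH [|v s] sn h.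
  by rewrite /htpy /= big1// => i _; rewrite mulr0.
rewrite htpy_cons.
rewrite (eq_sdiff (h := fun w => \sum_(i <- r) a i * htpy w (fun u => h i (v :: u)))).
  rewrite sdiff_sum mulr_sumr -!sumrB; apply: eq_bigr => i _.
  by rewrite htpy_cons; ring.
by move=> w _ sw; apply: IH; rewrite sw.
Qed.

Lemma htpyB s g h : htpy s (fun u => g u - h u) = htpy s g - htpy s h.
Proof.
have := htpy_sum [:: true; false] (fun b => if b then 1 else -1)
  (fun b => if b then g else h) s.
rewrite !big_cons big_nil /= addr0 mul1r mulN1r => <-.
by apply: f_equal; apply: funext => u; rewrite !big_cons big_nil /= addr0 mul1r mulN1r.
Qed.

(** The carrier condition: cones are taken only from letters of [s], so the homotopy stays in the
    simplex spanned by [s]. Supports of the bounding chains are controlled by this. *)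
Lemma htpy_local s g h : uniq s -> (forall w, uniq w -> size (nf w) = size w) ->
  (forall u, {subset u <= s} -> size u = (size s).+1 -> g u = h u) ->
  htpy s g = htpy s h.
Proof.
move=> + nfs; have [n sn] := ubnP (size s); elim: n s sn g h => // n IH [|v s] sn g h us gh //.
have vE w : {subset w <= v :: s} -> {subset v :: w <= v :: s}.
  by move=> ws x; rewrite inE => /orP[/eqP->|/ws//]; rewrite mem_head.
rewrite !htpy_cons (gh (v :: v :: s)) ?(gh (v :: nf (v :: s)))//.
- congr (_ - _); apply: eq_sdiff => w ws sw; apply: IH; rewrite ?sw//.
    exact: subseq_uniq ws us.
  by move=> u uw su; apply: gh; rewrite /= ?su//; apply: vE => x /uw /(mem_subseq ws).
- by apply: vE => x; rewrite nf_mem.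
- by rewrite /= nfs.
- exact: vE.
Qed.

Variable D : {pred T}.
Hypothesis sg_nil : sg [::] = 1.
Hypothesis sdiff_sg : forall s g, all D s ->
  sdiff (fun w => sg w * g (nf w)) s = sg s * sdiff g (nf s).

(** For a cone with apex v one has ∂(v·c) = c - v·∂c. Applied to c = s - sg(s) nf(s) - h(∂s), the
    chain that is coned off, it leaves c itself, provided that ∂c = 0; this follows by induction
    from the formula for h on ∂s. *)
Lemma sdiff_htpy s g : all D s ->
  htpy s (sdiff g) + sdiff (fun w => htpy w g) s = g s - sg s * g (nf s).
Proof.
have nf0 : nf [::] = [::] by case: (nf [::]) (nf_mem [::]) => // x r /(_ x); rewrite mem_head.
have [n sn] := ubnP (size s); elim: n s sn g => // n IH [|v s] sn g sD.
  by rewrite /htpy /= addr0 nf0 sg_nil mul1r subrr.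
rewrite htpy_cons.
set gv := fun u => g (v :: u).
have -> : sdiff (fun w => htpy w (fun u => sdiff g (v :: u))) (v :: s) =
    sdiff (fun w => htpy w g) (v :: s) - sdiff (fun w => htpy w (sdiff gv)) (v :: s).
  by rewrite -sdiffB; apply: eq_sdiff => w _ _; rewrite -htpyB.
(* The induction hypothesis is used on each word [w] in the boundary. Of the terms it yields, the
   iterated boundary vanishes and the sorted one is rewritten because sorting is a chain map. *)
have -> : sdiff (fun w => htpy w (sdiff gv)) (v :: s) =
    sdiff (fun w => gv w - sg w * gv (nf w) - sdiff (fun x => htpy x gv) w) (v :: s).
  apply: eq_sdiff => w ws [sw]; rewrite -(IH w) ?addrK ?sw//.
  by apply/allP => x /(mem_subseq ws)/(allP sD).
rewrite !sdiffB sdiff_sdiff sdiff_sg//.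
have vE u : sdiff g (v :: u) = g u - sdiff gv u by [].
by rewrite !vE; ring.
Qed.
End Homotopy.

(** * Oriented simplices *)

Lemma del_subseq (T : eqType) i (s : seq T) : subseq (del i s) s.
Proof.
rewrite -[X in subseq _ X](cat_take_drop i) cat_subseq//.
by rewrite -add1n -drop_drop drop_subseq.
Qed.

Section Entries.
Variable V : choiceType.
Implicit Types (s t : seq V).

Definition entries s : {fset V} := [fset v in s].

Lemma in_entries s v : (v \in entries s) = (v \in s).
Proof. by rewrite !inE. Qed.

Lemma entries_sub s t : (entries s `<=` entries t) <-> {subset s <= t}.
Proof.
split => [/fsubsetP st v vs|st]; first by have := st v; rewrite !in_entries; apply.
by apply/fsubsetP => v; rewrite !in_entries; exact: st.
Qed.

Lemma entries_neq0 s : (entries s != fset0) = (0 < size s)%N.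
Proof.
apply/fset0Pn/idP => [[v]|]; first by rewrite in_entries; case: s.
by case: s => // v s _; exists v; rewrite in_entries mem_head.
Qed.

Lemma card_entries s : uniq s -> #|` entries s| = size s.
Proof.
by move=> us; rewrite card_fseq undup_id.
Qed.

End Entries.

Section OrientedSimplices.
Variables (V : choiceType) (X : lf_complex V).
Implicit Types (o : orientation X) (s u w : seq V) (r t : {fset V}).

Lemma simplexP r : r \in X -> r != fset0.
Proof. by apply: contraTneq => ->; exact: simplex_neq0. Qed.

Lemma entries_simplex a s : a \in X -> {subset s <= a} -> (0 < size s)%N -> entries s \in X.
Proof.
move=> aX sa s0; apply: (simplex_face aX); last by rewrite entries_neq0.
by apply/fsubsetP => v; rewrite in_entries; exact: sa.
Qed.

Section OneOrientation.
Variable o : orientation X.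

Lemma mem_vseq r : vseq o r =i r.
Proof. by move=> v; rewrite mem_sort. Qed.

Lemma uniq_vseq r : uniq (vseq o r).
Proof. by rewrite sort_uniq fset_uniq. Qed.

Lemma size_vseq r : size (vseq o r) = #|` r|.
Proof. by rewrite size_sort. Qed.

Lemma vseqK r : entries (vseq o r) = r.
Proof. by apply/fsetP => v; rewrite in_entries mem_vseq. Qed.

(** The order used is that of the simplex spanned by the letters of [s] themselves, so no ambient
    simplex has to be named; [osgnE] passes to any simplex containing them. *)
Definition osgn s : int := sgn (ole o (entries s)) s.

Section InSimplex.
Variable a : {fset V}.
Hypothesis aX : a \in X.

Let Ltot := @ole_total V X o a aX.
Let Lanti := @ole_anti V X o a aX.
Let Ltr := @ole_trans V X o a aX.

Lemma vseq_strict r : r `<=` a -> pairwise (strict (ole o a)) (vseq o r).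
Proof.
have [->|r0 ra] := eqVneq r fset0.
  by rewrite (size0nil (s := vseq _ _))// size_vseq cardfs0.
have rX : r \in X by exact: simplex_face aX ra r0.
have : pairwise (ole o r) (vseq o r).
  rewrite -(sorted_pairwise_in (P := mem r)).
  - by apply: (sort_sorted_in (P := mem r)); [exact: (@ole_total V X o r rX)|apply/allP].
  - exact: (@ole_trans V X o r rX).
  - by apply/allP => v; rewrite mem_vseq.
rewrite (@eq_in_pairwise _ (mem r) _ (ole o a)); last by apply/allP => v; rewrite mem_vseq.
  move=> pr; rewrite (_ : strict _ = [rel x y | [rel x y | x != y] x y && ole o a x y])//.
  by rewrite pairwise_relI -uniq_pairwise uniq_vseq.
exact: ole_face.
Qed.

Lemma osgnE s : {subset s <= a} -> osgn s = sgn (ole o a) s.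
Proof.
case: s => // v s sa; apply: (eq_nsort _).2 => x y xs ys.
apply: ole_face; rewrite ?in_entries//; first exact: entries_simplex sa _.
by apply/fsubsetP => z; rewrite in_entries; exact: sa.
Qed.

Lemma vseq_entries s : {subset s <= a} -> vseq o (entries s) = nsort (ole o a) s.
Proof.
move=> sa; have sD : all [in a] s by apply/allP.
apply: (@strict_sorted_eq _ (ole o a) [in a] Lanti).
- by apply/allP => v; rewrite mem_vseq in_entries; exact: sa.
- by apply: vseq_strict; apply/fsubsetP => v; rewrite in_entries; exact: sa.
- exact: (nsort_strict Ltot Lanti Ltr).
- by move=> v; rewrite mem_vseq in_entries mem_nsort.
Qed.

Lemma subseq_vseq r w : r `<=` a -> subseq w (vseq o r) ->
  vseq o (entries w) = w /\ osgn w = 1.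
Proof.
move=> ra wr; have wa : {subset w <= a}.
  by move=> v /(mem_subseq wr); rewrite mem_vseq; exact: (fsubsetP ra).
rewrite vseq_entries// osgnE//; apply: nsort_id.
exact: subseq_pairwise wr (vseq_strict ra).
Qed.

Lemma osgn_uniq s : {subset s <= a} -> if uniq s then osgn s * osgn s = 1 else osgn s = 0.
Proof. by move=> sa; rewrite osgnE//; apply: (sgn_mem Ltot Lanti Ltr); apply/allP. Qed.

Lemma sdiff_osgn g s : {subset s <= a} ->
  sdiff (fun w => osgn w * g (vseq o (entries w))) s =
  osgn s * sdiff g (vseq o (entries s)).
Proof.
move=> sa; rewrite osgnE// vseq_entries// -(sdiff_sgn Ltot Lanti Ltr); last exact/allP.
apply: eq_sdiff => w ws _; have wa : {subset w <= a} by move=> v /(mem_subseq ws)/sa.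
by rewrite osgnE// vseq_entries.
Qed.

End InSimplex.

Lemma size_vseq_entries s : uniq s -> size (vseq o (entries s)) = size s.
Proof. by move=> us; rewrite size_vseq card_entries. Qed.

Lemma vposE r v k : v \in r -> (v \in take k (vseq o r)) = (vpos o r v < k)%N.
Proof. by move=> vr; rewrite in_take ?mem_vseq. Qed.

Lemma frontE r k : front o r k = entries (take k.+1 (vseq o r)).
Proof.
apply/fsetP => v; rewrite in_entries !inE.
have [vr|vr] := boolP (v \in r); first by rewrite vposE.
by apply/esym/negP => /mem_take; rewrite mem_vseq (negPf vr).
Qed.

Lemma mem_drop_vseq r v k : (v \in drop k (vseq o r)) = (v \in r) && (k <= vpos o r v)%N.
Proof.
have [vr|vr] := boolP (v \in r); last first.
  by apply/negP => /mem_drop; rewrite mem_vseq (negPf vr).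
have := uniq_vseq r; rewrite -{1}(cat_take_drop k (vseq o r)) cat_uniq.
move=> /and3P[_ /hasPn dis _]; rewrite /= leqNgt -vposE//.
have := mem_vseq r v; rewrite -{1}(cat_take_drop k (vseq o r)) mem_cat vr.
have := dis v; case: (v \in take _ _) => //=; case: (v \in drop _ _) => //.
by move=> /(_ isT).
Qed.

Lemma backE r k : back o r k = entries (drop k (vseq o r)).
Proof. by apply/fsetP => v; rewrite in_entries mem_drop_vseq !inE. Qed.

Lemma faceE r i : face o r i = entries (del i (vseq o r)).
Proof.
apply/fsetP => v; rewrite in_entries mem_cat mem_drop_vseq !inE.
have [vr|vr] := boolP (v \in r); first by rewrite vposE// neq_ltn.
rewrite andFb orbF; apply/esym/negP => /mem_take; rewrite mem_vseq (negPf vr).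
by [].
Qed.

Lemma sdiff_faces K r :
  sdiff (fun w => K (entries w)) (vseq o r) = \sum_(i < #|` r|) (-1) ^+ i * K (face o r i).
Proof.
by rewrite sdiffE size_vseq; apply: eq_bigr => i _; rewrite faceE.
Qed.

Lemma incidE r t : incid o r t = sdiff (fun w => (entries w == t)%:R) (vseq o r).
Proof.
rewrite (sdiff_faces (fun r => (r == t)%:R)) /incid big_mkcond; apply: eq_bigr => i _.
by case: eqP => _; rewrite ?mulr1 ?mulr0.
Qed.

Lemma face_sub r i : face o r i `<=` r.
Proof. by apply/fsubsetP => v; rewrite !inE => /andP[]. Qed.

Lemma card_face r (i : 'I_(#|` r|)) : (#|` face o r i|).+1 = #|` r|.
Proof.
have ir : (i < size (vseq o r))%N by rewrite size_vseq.
rewrite faceE card_entries; last exact: subseq_uniq (del_subseq _ _) (uniq_vseq _).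
by rewrite /del size_cat size_drop size_take ir; move: ir; rewrite size_vseq; lia.
Qed.

Lemma incid_neq0 r t : incid o r t != 0 -> exists i : 'I_(#|` r|), t = face o r i.
Proof.
rewrite /incid => /eqP nz; apply: contrapT => H; apply: nz.
by rewrite big1// => i /eqP it; exfalso; apply: H; exists i.
Qed.

Lemma incid_sub r t : incid o r t != 0 -> t `<=` r /\ (#|` t|).+1 = #|` r|.
Proof. by move=> /incid_neq0[i ->]; rewrite face_sub card_face. Qed.

Lemma sdiff_incid (F : {fset {fset V}}) K r :
  (forall i : 'I_(#|` r|), face o r i \notin F -> K (face o r i) = 0) ->
  sdiff (fun w => K (entries w)) (vseq o r) = \sum_(t <- F) K t * incid o r t.
Proof.
move=> KF; rewrite sdiff_faces; under [RHS]eq_bigr do rewrite /incid mulr_sumr big_mkcond.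
rewrite exchange_big /=; apply: eq_bigr => i _.
have [iF|iF] := boolP (face o r i \in F).
  rewrite (big_fsetD1 _ iF)/= eqxx mulrC big_seq big1 ?addr0// => t.
  by rewrite !inE eq_sym => /andP[/negPf->].
rewrite KF// mulr0 big_seq big1// => t tF.
by case: eqP => // it; rewrite it tF in iF.
Qed.

Lemma sdiff_osgn_incid a s t : a \in X -> {subset s <= a} ->
  sdiff (fun w => osgn w * (entries w == t)%:R) s = osgn s * incid o (entries s) t.
Proof.
move=> aX sa; rewrite incidE -(sdiff_osgn aX (fun w => (entries w == t)%:R) sa).
by apply: eq_sdiff => w _ _; rewrite vseqK.
Qed.

Lemma osgn_cons v u a : a \in X -> {subset v :: u <= a} -> uniq (v :: u) ->
  osgn u = osgn (v :: u) * incid o (entries (v :: u)) (entries u).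
Proof.
move=> aX sa /= /andP[vu uu]; rewrite -(sdiff_osgn_incid _ aX sa) /= eqxx mulr1.
rewrite (eq_sdiff (h := fun w => 0 * 0)); first by rewrite sdiffZ mul0r subr0.
move=> w _ _; case: eqP => [E|]; last by rewrite mulr0.
by move: vu; rewrite -in_entries -E in_entries mem_head.
Qed.

End OneOrientation.

Section TwoOrientations.
Variables o o' : orientation X.

Definition rsign r : int := osgn o' (vseq o r).

(** Phrased for faces of a simplex so as to include the empty face, over which [set_diff] also
    sums. *)
Lemma rsign_face_sqr r t : r \in X -> t `<=` r -> rsign t * rsign t = 1.
Proof.
move=> rX /fsubsetP tr; have := @osgn_uniq o' r rX (vseq o t); rewrite uniq_vseq; apply.
by move=> v; rewrite mem_vseq; exact: tr.
Qed.

Lemma rsign_sqr r : r \in X -> rsign r * rsign r = 1.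
Proof. by move=> rX; exact: (rsign_face_sqr rX (fsubset_refl r)). Qed.

(** The base change between the simplicial chain complexes of [o] and [o'], which multiplies r by
    [rsign r], is a chain map, because sorting is one. *)
Lemma rsign_incid r t : r \in X -> incid o r t * rsign t = rsign r * incid o' r t.
Proof.
move=> rX; have rr : {subset vseq o r <= r} by move=> v; rewrite mem_vseq.
rewrite -[X in incid o' X _](vseqK o r) -(@sdiff_osgn_incid o' _ _ _ rX rr) incidE mulrC -sdiffZ.
apply: eq_sdiff => w wr _; case: eqP => [wt|_]; last by rewrite !mulr0.
by rewrite !mulr1 /rsign -wt (subseq_vseq rX (fsubset_refl r) wr).1.
Qed.

(** Instead of composing permutations, the induction recovers the two signs of [v :: u] from those
    of [u] through the incidence numbers, which [rsign_incid] compares. Both signs are 0 on words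
    with repetitions. *)
Lemma osgn_change a s : a \in X -> {subset s <= a} ->
  osgn o' s = rsign (entries s) * osgn o s.
Proof.
move=> aX; elim: s => [|v u IH] sa;
  first by rewrite /rsign (size0nil (size_vseq_entries o (s := [::]) isT)).
have ua : {subset u <= a} by move=> x xu; apply: sa; rewrite inE xu orbT.
have := osgn_uniq o aX sa; have := osgn_uniq o' aX sa; case: ifP => [us o'1 o1|_ -> ->];
  last by rewrite mulr0.
have sX := entries_simplex aX sa isT.
have := rsign_incid (entries u) sX; have := osgn_cons o aX sa us; have := osgn_cons o' aX sa us.
have u1 := osgn_uniq o' aX ua; have uu : uniq u by case/andP: us.
rewrite uu in u1.
have := rsign_sqr sX; have := IH ua.
move: u1 o1 o'1.
set a' := osgn o' (v :: u); set b' := osgn o' u; set c := osgn o (v :: u); set d := osgn o u.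
set e := rsign (entries u); set f := rsign (entries (v :: u)).
set i := incid o _ _; set i' := incid o' _ _.
move=> u1 o1 o'1 IH' f1 bE dE if_.
have i'1 : i' * i' = 1 by move: u1; rewrite bE mulrACA o'1 mul1r.
have -> : a' = b' * i' by rewrite bE -mulrA i'1 mulr1.
rewrite IH' dE (_ : e * (c * i) * i' = c * (i * e) * i'); last by ring.
by rewrite if_ (_ : c * (f * i') * i' = f * c * (i' * i')); [rewrite i'1 mulr1|ring].
Qed.
End TwoOrientations.

(** * The Leibniz rule for alternating cochains *)

Section Leibniz.
Variable o : orientation X.
Implicit Types z : {fset V} -> int.

(* The coefficient of [t] in the chain (front part of [s]) * z (back part of [s]). *)
Definition cup_front q t z s : int :=
  (osgn o (take q.+1 s) * (entries (take q.+1 s) == t)%:R) *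
  (osgn o (drop q s) * z (entries (drop q s))).

(** The simplicial coboundary, except that at a vertex it also sees the empty set; hence the
    conditions that r has more than one vertex whenever it is compared with [sheaf_diff]. *)
Definition set_diff z r : int := \sum_(i < #|` r|) (-1) ^+ i * z (face o r i).

Lemma set_diffE z r : set_diff z r = \sum_(t <- fpowerset r) z t * incid o r t.
Proof.
rewrite /set_diff -sdiff_faces; apply: sdiff_incid => i.
by rewrite fpowersetE face_sub.
Qed.

(** The coboundary of the indicator of t is the sum of the indicators of its cofaces t', weighted by
    [incid o t' t]. Thus the first term of the Leibniz rule is the coefficient at t of a simplicial
    boundary. *)
Lemma sdiff_cup_front a q t z s : a \in X -> t \in X -> {subset s <= a} -> (q.+1 < size s)%N ->
  sdiff (cup_front q t z) s =
  \sum_(t' <- cofaces X t) incid o t' t * cup_front q.+1 t' z s +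
  (-1) ^+ q * cup_front q t (set_diff z) s.
Proof.
move=> aX tX sa sq.
rewrite /cup_front (sdiff_cup (fun u => osgn o u * (entries u == t)%:R) (fun u => osgn o u * z
  (entries u)))//.
have ta : {subset take q.+2 s <= a} by move=> v /mem_take /sa.
have da : {subset drop q s <= a} by move=> v /mem_drop /sa.
congr (_ + _ * (_ * _)).
  rewrite (sdiff_osgn_incid o t aX ta); set u := take _ _; set b := drop _ _.
  under eq_bigr do rewrite mulrA; rewrite -mulr_suml; congr (_ * _).
  have uX : entries u \in X.
    by apply: entries_simplex aX ta _; rewrite size_take; case: ifP => // _; exact: ltn_trans sq.
  have [uc|uc] := boolP (entries u \in cofaces X t).
    rewrite (big_fsetD1 _ uc)/= eqxx mulr1 mulrC big_seq big1 ?addr0// => r.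
    by rewrite !inE eq_sym => /andP[/negPf->]; rewrite !mulr0.
  have -> : incid o (entries u) t = 0.
    apply/eqP; apply: contraNT uc => /incid_sub[tu _]; rewrite in_cofaces// uX.
    exact: tu.
  rewrite mulr0 big_seq big1// => r rc; case: eqP => [ru|]; last by rewrite !mulr0.
  by rewrite ru rc in uc.
have -> : sdiff (fun u => osgn o u * z (entries u)) (drop q s) =
    sdiff (fun u => osgn o u * z (entries (vseq o (entries u)))) (drop q s).
  by apply: eq_sdiff => w _ _; rewrite vseqK.
by rewrite (sdiff_osgn o aX (fun w => z (entries w)))// sdiff_faces.
Qed.
End Leibniz.

End OrientedSimplices.

(** * Local classes and the fundamental class *)

Section Subquotients.
Variables (A : zmodType) (Z B : subgroup A).

Lemma sgN x : Z x -> Z (- x).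
Proof. by move=> Zx; rewrite -sub0r; apply: sg_setB => //; exact: sg_set0. Qed.

Lemma sgD x y : Z x -> Z y -> Z (x + y).
Proof. by move=> Zx Zy; rewrite -[y]opprK; apply: sg_setB => //; exact: sgN. Qed.

Lemma sg_sum (I : eqType) (r : seq I) (x : I -> A) (e : I -> int) :
  (forall i, i \in r -> Z (x i)) -> Z (\sum_(i <- r) x i *~ e i).
Proof.
have ZM y (m : int) : Z y -> Z (y *~ m).
  move=> Zy; have ZMn k : Z (y *+ k) by elim: k => [|k IH]; [exact: sg_set0|rewrite mulrS;
    exact: sgD].
  by case: m => k; [exact: ZMn|rewrite NegzE mulrNz; apply: sgN; exact: ZMn].
elim: r => [|i r IH] Zx; first by rewrite big_nil; exact: sg_set0.
rewrite big_cons; apply: sgD; first by apply: ZM; apply: Zx; rewrite mem_head.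
by apply: IH => j jr; apply: Zx; rewrite inE jr orbT.
Qed.

Lemma hclass0 : hclass Z B 0 = 0.
Proof. by have := @hclassB _ Z B 0 0 (sg_set0 _) (sg_set0 _); rewrite !subr0 subrr. Qed.

Lemma hclassN x : Z x -> hclass Z B (- x) = - hclass Z B x.
Proof. by move=> Zx; rewrite -sub0r hclassB ?hclass0 ?sub0r//; exact: sg_set0. Qed.

Lemma hclassD x y : Z x -> Z y -> hclass Z B (x + y) = hclass Z B x + hclass Z B y.
Proof.
move=> Zx Zy; rewrite -[in LHS](opprK y) hclassB ?hclassN ?opprK//; exact: sgN.
Qed.

Lemma hclassMz x (m : int) : Z x -> hclass Z B (x *~ m) = hclass Z B x *~ m.
Proof.
move=> Zx; have MnE k : Z (x *+ k) /\ hclass Z B (x *+ k) = hclass Z B x *+ k.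
  elim: k => [|k [Zk IH]]; first by split; [exact: sg_set0|exact: hclass0].
  by rewrite !mulrS; split; [exact: sgD|rewrite hclassD// IH].
case: m => k; first by rewrite -!pmulrn (MnE k).2.
by rewrite NegzE !mulrNz -!pmulrn hclassN ?(MnE k.+1).2//; exact: (MnE k.+1).1.
Qed.

Lemma hclass_sum (I : eqType) (r : seq I) (x : I -> A) (e : I -> int) :
  (forall i, i \in r -> Z (x i)) ->
  hclass Z B (\sum_(i <- r) x i *~ e i) = \sum_(i <- r) hclass Z B (x i) *~ e i.
Proof.
elim: r => [|i r IH] Zx; first by rewrite !big_nil hclass0.
have Zr j : j \in r -> Z (x j) by move=> jr; apply: Zx; rewrite inE jr orbT.
have Zi : Z (x i) by apply: Zx; rewrite mem_head.
have := @sg_sum _ [:: i] x e; rewrite big_seq1 => Z1.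
rewrite !big_cons hclassD ?hclassMz ?IH//; first by apply: Z1 => j; rewrite inE => /eqP->.
exact: sg_sum.
Qed.

Lemma hclass_eq0 x : Z x -> B x -> hclass Z B x = 0.
Proof.
by move=> Zx Bx; rewrite -hclass0; apply/hclass_eq; rewrite ?subr0//; exact: sg_set0.
Qed.

Hypothesis B0 : forall y, B y -> y = 0.

Lemma hrepr_hclass x : Z x -> hrepr (hclass Z B x) = x.
Proof. by move=> Zx; apply/eqP; rewrite -subr_eq0; apply/eqP/B0/hclass_repr. Qed.

(** When [B] is trivial, the choice of representatives is a homomorphism. This makes the
    coefficients of a class in the top local homology additive in the class. *)
Lemma hreprB : zmod_morphism (@hrepr A Z B).
Proof.
move=> h k; rewrite -[in LHS](hreprK h) -[in LHS](hreprK k) -hclassB ?hrepr_hclass//;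
  try exact: hreprP.
by apply: sg_setB; exact: hreprP.
Qed.

Lemma hrepr_sum I (r : seq I) (P : pred I) (h : I -> subquot Z B) (e : I -> int) :
  hrepr (\sum_(i <- r | P i) h i *~ e i) = \sum_(i <- r | P i) hrepr (h i) *~ e i.
Proof.
pose hm : {additive subquot Z B -> A} :=
  HB.pack (@hrepr A Z B) (GRing.isZmodMorphism.Build _ _ (@hrepr A Z B) hreprB).
by rewrite -[LHS]/(hm _) raddf_sum; apply: eq_bigr => i _; rewrite raddfMz.
Qed.

Lemma hrepr0 : hrepr (0 : subquot Z B) = 0.
Proof. by rewrite -hclass0 hrepr_hclass//; exact: sg_set0. Qed.

End Subquotients.

(** * The dimension of a Cohen--Macaulay complex *)

Section Dimension.
Variables (V : choiceType) (X : lf_complex V) (o : orientation X) (n : nat).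

Lemma coface_refl r : r \in X -> r \in cofaces X r.
Proof. by move=> rX; rewrite in_cofaces// rX fsubset_refl. Qed.

Lemma cofaces_widen r t (F : {fset V} -> int) : r \in X -> t \in X -> r `<=` t ->
  (forall a, a \in X -> r `<=` a -> ~~ (t `<=` a) -> F a = 0) ->
  \sum_(a <- cofaces X r) F a = \sum_(a <- cofaces X t) F a.
Proof.
move=> rX tX rt F0; apply/esym/big_fset_incl.
  apply/fsubsetP => a; rewrite !in_cofaces// => /andP[-> ta].
  exact: fsubset_trans ta.
by move=> a; rewrite !in_cofaces// => /andP[aX ra]; rewrite aX; exact: F0.
Qed.

(** By local finiteness r has finitely many cofaces, and one with the most vertices is maximal. *)
Lemma maximal_coface r : r \in X ->
  exists a, [/\ a \in X, r `<=` a & forall b, b \in X -> a `<=` b -> b = a].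
Proof.
move=> rX; have rc := coface_refl rX.
pose i0 : cofaces X r := FSetSub rc.
case: (@arg_maxnP _ i0 xpredT (fun a => #|` val a|) isT) => -[a /= ac] _ amax.
have := ac; rewrite in_cofaces// => /andP[aX ra]; exists a; split => // b bX ab.
have bc : b \in cofaces X r by rewrite in_cofaces// bX (fsubset_trans ra ab).
have /= ba := amax (FSetSub bc) isT.
by apply/esym/eqP; rewrite eqEfcard ab.
Qed.

Lemma incid_id a : incid o a a = 0.
Proof.
apply/eqP; apply/contraT => /incid_sub[_ /eqP].
by rewrite -{2}(addn0 #|` a|) -addn1 eqn_add2l.
Qed.

(** A maximal simplex a is the only coface of itself, so a is a cycle relative to the complement of
    its open star and bounds nothing. Its class is a nonzero local homology class in dimension dim
    a, which must therefore be n when a has more than n + 1 vertices, and that is absurd. *)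
Lemma cm_card : locally_cohen_macaulay o n -> forall r, r \in X -> (#|` r| <= n.+1)%N.
Proof.
move=> cm r rX; have [a [aX ra amax]] := maximal_coface rX.
apply: (leq_trans (fsubset_leq_card ra)); rewrite leqNgt; apply/negP => na.
pose m := #|` a|.-1; have am : m.+1 = #|` a| by rewrite /m prednK// (leq_trans _ na).
pose d : loc_fun V := fun b => (b == a)%:R.
have dZ : loc_cycles o a m d.
  split; first split.
  - move=> b; rewrite /d; case: eqP => // -> _.
    by rewrite unfold_in /star_simplices /simplices fsubset_refl aX am eqxx.
  - apply: sub_finite_set (finite_set1 a) => b /=; rewrite /d.
    by case: eqP.
  apply: functional_extensionality_dep => b; rewrite /= /loc_bd; case: ifP => // /andP[bX ab].
  rewrite (amax b bX ab) big_seq big1// => c _; rewrite /d; case: eqP => [->|_];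
    last by rewrite mul0rz.
  by rewrite incid_id mulr0z.
have mn : m <> n by move=> mn; move: na; rewrite -am mn ltnn.
have := cm a aX m mn (hclass _ _ d); rewrite -(hclass0 (loc_cycles o a m) (loc_boundaries o a m)).
move=> /(hclass_eq _ dZ (sg_set0 _)).1; rewrite subr0 => -[e [es _] ed].
have e0 : e = 0.
  apply: functional_extensionality_dep => b; apply: contrapT => /es.
  rewrite unfold_in /star_simplices /simplices => /andP[/andP[bX /eqP bm] ab].
  by move: bm; rewrite (amax b bX ab) -am => /n_Sn.
have : d a = 0 by rewrite -ed e0 raddf0.
by rewrite /d eqxx.
Qed.

End Dimension.

Section LocalClasses.
Variables (V : choiceType) (X : lf_complex V) (o : orientation X) (n : nat).
Hypothesis dimX : forall r, r \in X -> (#|` r| <= n.+1)%N.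

Lemma supported0 (G : {fset V} -> zmodType) (c : dfun G) :
  supported G (simplices X n.+2) c -> c = 0.
Proof.
move=> cs; apply: functional_extensionality_dep => r; apply: contrapT => /cs.
by rewrite unfold_in /simplices => /andP[/dimX + /eqP rn]; rewrite rn ltnn.
Qed.

Lemma loc_boundaries0 r c : loc_boundaries o r n c -> c = 0.
Proof.
move=> [b [bs _] <-]; rewrite (_ : b = 0) ?raddf0//; apply: supported0 => a /bs.
by rewrite !unfold_in => /andP[].
Qed.

Lemma boundaries_lf0 (G : cosheaf X) c : boundaries_lf o G n c -> c = 0.
Proof. by move=> [b bs <-]; rewrite (supported0 bs) raddf0. Qed.

Definition loc_coeff r (h : loc_homology o r n) : {fset V} -> int := hrepr h.

Definition dirac (a : {fset V}) : loc_fun V := fun b => (b == a)%:R.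

(** The coboundary of such a cochain would live on simplices with n + 2 vertices, and there are
    none. *)
Lemma loc_cocyclesP r c : (forall a, c a <> 0 -> [/\ a \in X, #|` a| = n.+1 & r `<=` a]) ->
  loc_cocycles o r n c.
Proof.
move=> cs; split.
  move=> a /cs[aX an ra]; rewrite unfold_in /star_simplices /simplices aX an ra.
  by rewrite eqxx.
apply: functional_extensionality_dep => a; rewrite /= /loc_cobd; case: ifP => // aX.
rewrite big1// => i _; have [->|/eqP/cs[fX fn _]] := eqVneq (c (face o a i)) 0.
  by rewrite mul0rz.
by exfalso; have := dimX aX; have := card_face o i; rewrite fn; lia.
Qed.

Lemma dirac_cocycle r a : a \in X -> #|` a| = n.+1 -> r `<=` a ->
  loc_cocycles o r n (dirac a).
Proof.
by move=> aX an ra; apply: loc_cocyclesP => b; rewrite /dirac; case: eqP => // ->.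
Qed.

Lemma loc_cobdE r (c : loc_fun V) a : r \in X -> a \in X ->
  (forall b, c b <> 0 -> r `<=` b) ->
  loc_cobd o c a = \sum_(b <- cofaces X r) c b * incid o a b.
Proof.
move=> rX aX cr; rewrite /loc_cobd aX -(sdiff_incid (o := o) (K := c)).
  by rewrite sdiff_faces; apply: eq_bigr => i _; rewrite mulrC -mulrzr intz.
move=> i; rewrite in_cofaces//; apply: contraNeq => /eqP/cr rb; rewrite rb andbT.
apply: (simplex_face aX (face_sub _ _ _)); apply: contraTneq rb => ->.
by rewrite fsubset0; exact: simplexP rX.
Qed.

(** A chain with coefficients in h^n presented by cochains, one for each t; by [class_diffE] its
    boundary can be computed on these cochains. *)
Definition class_chain (F : {fset V} -> loc_fun V) : dfun (loc_cohomology_cosheaf o n) :=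
  fun t => hclass (loc_cocycles o t n) (loc_coboundaries o t n) (F t).

Lemma dfun_sumE (T : Type) (G : T -> zmodType) I (r : seq I) (P : pred I) (F : I -> dfun G) t :
  (\sum_(i <- r | P i) F i) t = \sum_(i <- r | P i) F i t.
Proof. by elim/big_ind2: _ => // x1 x2 y1 y2 <- <-. Qed.

Lemma dfun_MzE (T : Type) (G : T -> zmodType) (c : dfun G) (m : int) t :
  (c *~ m) t = c t *~ m.
Proof.
have MnE k : (c *+ k) t = c t *+ k by elim: k => [|k IH]; rewrite ?mulr0n// !mulrS dfunD IH.
case: m => k; first by rewrite -!pmulrn.
by rewrite NegzE !mulrNz -!pmulrn -MnE -sub0r -[RHS]sub0r.
Qed.

Lemma class_diffE F t : t \in X -> (forall s, s \in X -> loc_cocycles o s n (F s)) ->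
  cosheaf_diff o (class_chain F) t =
  hclass (loc_cocycles o t n) (loc_coboundaries o t n) (\sum_(s <- cofaces X t) F s *~ incid o s t).
Proof.
move=> tX FZ; rewrite /cosheaf_diff tX hclass_sum; last first.
  by move=> s; rewrite in_cofaces// => /andP[sX ts]; exact: loc_cocycles_sub ts (FZ s sX).
rewrite !big_seq; apply: eq_bigr => s; rewrite in_cofaces// => /andP[sX ts].
by congr (_ *~ _); apply: (loc_cohomology_mapE ts); exact: FZ.
Qed.

Definition top_dirac a : loc_fun V := if simplices X n.+1 a then dirac a else 0.

Lemma top_dirac_cocycle a : loc_cocycles o a n (top_dirac a).
Proof.
rewrite /top_dirac; case: ifP => [/andP[aX /eqP an]|_]; last exact: sg_set0.
exact: dirac_cocycle.
Qed.

(** At t the boundary is the class of the cochain a ↦ [incid o a t] on the n-simplices. It vanishes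
    unless dim t = n - 1, and in that case it is the coboundary of the cochain dual to t, which is a
    relative cochain for the pair at t. *)
Lemma top_dirac_cycle : cycles_lf o (loc_cohomology_cosheaf o n) n (class_chain top_dirac).
Proof.
split.
  move=> a; rewrite /class_chain /top_dirac unfold_in; case: ifP => // _.
  by rewrite hclass0.
apply: functional_extensionality_dep => t.
have [tX|tX] := boolP (t \in X); last by rewrite /= /cosheaf_diff (negPf tX).
rewrite [LHS]class_diffE//; last by move=> s _; exact: top_dirac_cocycle.
set c := \sum_(_ <- _) _.
have cE a : c a = if simplices X n.+1 a then incid o a t else 0.
  rewrite /c dfun_sumE; under eq_bigr do rewrite dfun_MzE.
  have [/andP[aX /eqP an]|an] := ifP; last first.
    rewrite big_seq big1// => s; rewrite in_cofaces// => /andP[sX ts].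
    rewrite /top_dirac; case: ifP => [sn|_]; last by rewrite mul0rz.
    by rewrite /dirac; case: eqP => [as_|_]; [rewrite as_ sn in an|rewrite mul0rz].
  have aE s : top_dirac s a *~ incid o s t = if s == a then incid o a t else 0.
    rewrite /top_dirac /dirac; case: eqVneq => [->|sa].
      by rewrite /simplices aX an eqxx /= eqxx intz.
    by case: ifP => _; rewrite ?mul0rz//= eq_sym (negPf sa) mul0rz.
  have [ac|ac] := boolP (a \in cofaces X t).
    rewrite (big_fsetD1 _ ac) /= aE eqxx big_seq big1 ?addr0// => s.
    by rewrite !inE aE => /andP[/negPf->].
  rewrite big_seq big1 => [|s sc]; last by rewrite aE; case: eqP => // sa; rewrite -sa sc in ac.
  apply/esym/eqP; apply: contraNT ac => /incid_sub[ta _]; rewrite in_cofaces// aX.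
  exact: ta.
have cZ : loc_cocycles o t n c.
  apply: loc_cocyclesP => a; rewrite cE; case: ifP => // /andP[aX /eqP an] /eqP/incid_sub[].
  by [].
apply: (hclass_eq0 cZ); have [tn|tn] := eqVneq #|` t| n; last first.
  rewrite (_ : c = 0); first exact: sg_set0.
  apply: functional_extensionality_dep => a; rewrite cE; case: ifP => // /andP[aX /eqP an].
  apply/eqP; apply: contraNT tn => /incid_sub[_]; rewrite an => -[->].
  by [].
exists (dirac t).
  move=> b; rewrite /dirac; case: eqP => // -> _; rewrite unfold_in /star_simplices /simplices.
  by rewrite tX tn eqxx fsubset_refl.
apply: functional_extensionality_dep => a; rewrite cE /= /loc_cobd /simplices.
case: ifP => aX //=.
have incE : \sum_(i < #|` a|) dirac t (face o a i) *~ (-1) ^+ i = incid o a t.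
  rewrite /incid [RHS]big_mkcond; apply: eq_bigr => i _; rewrite /dirac.
  by case: eqP; rewrite ?intz ?mul0rz.
rewrite incE; case: eqP => // an; apply/eqP; apply/contraT => /incid_sub[_ aE].
by case: an; rewrite -aE tn.
Qed.

Lemma fundamental_classE : hrepr (fundamental_class o n) = class_chain top_dirac.
Proof.
have -> : class_chain top_dirac =
    (fun a => if simplices X n.+1 a then dual_class o n a else 0).
  apply: functional_extensionality_dep => a; rewrite /class_chain /top_dirac.
  by case: ifP => // _; rewrite hclass0.
apply: hrepr_hclass; first exact: boundaries_lf0.
have := top_dirac_cycle; congr (cycles_lf _ _ _ _).
apply: functional_extensionality_dep => a; rewrite /class_chain /top_dirac.
by case: ifP => // _; rewrite hclass0.
Qed.

Lemma loc_coeffP r h : r \in X -> 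
  [/\ forall a, @loc_coeff r h a != 0 -> [/\ a \in X, #|` a| = n.+1 & r `<=` a] &
     forall b, b \in X -> r `<=` b -> \sum_(a <- cofaces X b) loc_coeff h a * incid o a b = 0].
Proof.
move=> rX; have [[hs _] h0] := hreprP h; split => [a /eqP/hs|b bX rb].
  by rewrite unfold_in /star_simplices /simplices => /andP[/andP[-> /eqP->] ->].
have : loc_bd o r (hrepr h) b = 0 by rewrite -[loc_bd o r _]/(_ (hrepr h)) h0.
rewrite /loc_bd bX rb /= => E; rewrite -[RHS]E; apply: eq_bigr => a _.
by rewrite mulrC -mulrzl intz.
Qed.

(** The pairing is evaluated on an unknown representative of the class dual to a. It differs from
    the dual cochain by a coboundary, which pairs to 0 with the cycle h. *)
Lemma loc_pairing_top r a (h : loc_homology o r n) :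
  r \in X -> simplices X n.+1 a -> r `<=` a ->
  loc_pairing (loc_cohomology_map r (class_chain top_dirac a)) h = loc_coeff h a.
Proof.
move=> rX aT ra; have /andP[aX /eqP an] := aT.
rewrite (loc_cohomology_mapE ra); last exact: top_dirac_cocycle.
have aZ : loc_cocycles o r n (top_dirac a) by rewrite /top_dirac aT; exact: dirac_cocycle.
have [b bs bE] := hclass_repr (loc_coboundaries o r n) aZ.
have [hS h0] := loc_coeffP h rX.
rewrite /loc_pairing (eq_big_seq (fun c => loc_cobd o b c * loc_coeff h c + (top_dirac a c *
  loc_coeff h c))); last first.
  move=> c _; have <- : (loc_cobd o b + top_dirac a) c = hrepr (hclass (loc_cocycles o r n)
    (loc_coboundaries o r n) (top_dirac a)) c.
    by rewrite [X in X + _]bE subrK.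
  by rewrite dfunD mulrDl.
rewrite big_split /= [X in X + _](_ : _ = 0) ?add0r.
  have ac : a \in cofaces X r by rewrite in_cofaces// aX.
  rewrite (big_fsetD1 _ ac) /= /top_dirac aT /dirac eqxx mul1r big_seq big1 ?addr0// => c.
  by rewrite !inE => /andP[/negPf->]; rewrite mul0r.
(* The coboundary is moved to the other side of the pairing: after exchanging the sums, the
   coefficient of [b d] is the boundary of h at d. *)
rewrite (eq_big_seq (fun c => \sum_(d <- cofaces X r) (b d * (loc_coeff h c * incid o c d))));
  last first.
  move=> c; rewrite in_cofaces// => /andP[cX rc]; rewrite (loc_cobdE rX cX); last first.
    by move=> d /bs; rewrite unfold_in => /andP[].
  by rewrite mulr_suml; apply: eq_bigr => d _; rewrite -mulrA [incid _ _ _ * _]mulrC.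
rewrite exchange_big big_seq big1 // => d; rewrite in_cofaces// => /andP[dX rd].
rewrite -mulr_sumr; apply/eqP; rewrite mulf_eq0; apply/orP; right; apply/eqP.
rewrite -[RHS](h0 d dX rd); apply: cofaces_widen => // a' _ _ da'.
by apply/eqP; rewrite mulf_eq0; apply/orP; right; apply: contraNT da' => /incid_sub[].
Qed.

End LocalClasses.

(** * Change of orientation *)

Section LocalFunctionals.
Variables (V : choiceType).

(* [H s] is a linear functional on functions of words; it only evaluates them on
   words of length [size s + d] in the entries of [s]. *)
Record local_functional (d : nat) (H : seq V -> (seq V -> int) -> int) := LocalFunctional {
  lf_sum : forall (I : Type) (r : seq I) (a : I -> int) (h : I -> seq V -> int) s,
    H s (fun u => \sum_(i <- r) a i * h i u) = \sum_(i <- r) a i * H s (h i);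
  lf_local : forall s g h, uniq s ->
    (forall u, {subset u <= s} -> size u = (size s + d)%N -> g u = h u) -> H s g = H s h }.

Lemma local_eval : local_functional 0 (fun s g => g s).
Proof.
split; first by [].
by move=> s g h _; apply => //; rewrite addn0.
Qed.

Lemma local_htpy (X : lf_complex V) (o : orientation X) :
  local_functional 1 (htpy (fun s => vseq o (entries s)) (osgn o)).
Proof.
split; first by move=> *; exact: htpy_sum.
move=> s g h us gh; apply: htpy_local => //.
- by move=> w v; rewrite mem_vseq in_entries.
- by move=> w uw; rewrite size_vseq_entries.
- by move=> u uss su; apply: gh; rewrite ?addn1.
Qed.

Variables (d : nat) (H : seq V -> (seq V -> int) -> int).
Hypothesis Hloc : local_functional d H.

Lemma lf_neq0 s g : uniq s -> H s g != 0 ->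
  exists u, [/\ {subset u <= s}, size u = (size s + d)%N & g u != 0].
Proof.
move=> us; apply: contraNP => ng; apply/eqP.
(* Linearity for an empty family gives the value 0 on the zero function. *)
have := @lf_sum _ _ Hloc bool [::] (fun=> 0) (fun _ => g) s; rewrite big_nil => H0.
rewrite -[RHS]H0; apply: (lf_local Hloc us) => u uss su; rewrite big_nil.
by apply/eqP; apply: contra_notT ng => gu; exists u.
Qed.

Lemma lfD s g h a b : H s (fun u => a * g u + b * h u) = a * H s g + b * H s h.
Proof.
have := @lf_sum _ _ Hloc bool [:: true; false] (fun i => if i then a else b)
  (fun i => if i then g else h) s.
rewrite !big_cons big_nil /= addr0 => <-; congr (H s); apply: funext => u.
by rewrite !big_cons big_nil /= addr0.
Qed.

End LocalFunctionals.

Section CapSums.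
Variables (V : choiceType) (X : lf_complex V) (o : orientation X) (n : nat).

Lemma cup_front_neq0 q t z s : cup_front o q t z s != 0 ->
  entries (take q.+1 s) = t /\ z (entries (drop q s)) != 0.
Proof.
rewrite /cup_front; have [-> E|_] := eqVneq (entries (take q.+1 s)) t; last first.
  by rewrite mulr0 mul0r eqxx.
by split => //; apply: contraNneq E => ->; rewrite mulr0 mulr0.
Qed.

Lemma cup_front_card a q t z s : a \in X -> {subset s <= a} -> (q < size s)%N ->
  cup_front o q t z s != 0 -> [/\ t \in X, #|` t| = q.+1 & t `<=` entries s].
Proof.
move=> aX sa qs nz; have [te _] := cup_front_neq0 nz.
have ta : {subset take q.+1 s <= a} by move=> v /mem_take /sa.
have st : size (take q.+1 s) = q.+1 by rewrite size_takel.
split; rewrite -te.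
- by apply: entries_simplex aX ta _; rewrite st.
- rewrite card_entries ?st//; apply: contraNT nz => un.
  have := osgn_uniq o aX ta; rewrite (negPf un) /cup_front => ->.
  by rewrite !mul0r.
- by apply/entries_sub => v /mem_take.
Qed.

Variables (d : nat) (H : seq V -> (seq V -> int) -> int).
Hypothesis Hloc : local_functional d H.

(* With [H] the evaluation at a word this is the cap product [cap_sheaf_chain];
   with [H = htpy] it is the chain bounding the difference of the cap products
   formed with two orientations. *)
Definition capsum q (z : {fset V} -> {fset V} -> int) t : int :=
  \sum_(a <- cofaces X t | #|` a| == n.+1) H (vseq o a) (cup_front o q t (z^~ a)).

(** Source of all support and finiteness statements: a nonzero coefficient at t requires an
    n-simplex or facet a that contains both t and a simplex r in the support of z. *)
Lemma functional_neq0 a q t z : a \in X -> (q < #|` a| + d)%N ->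
  H (vseq o a) (cup_front o q t z) != 0 ->
  [/\ t \in X, #|` t| = q.+1, t `<=` a & exists r, [/\ r \in X, r `<=` a & z r != 0]].
Proof.
move=> aX qa /(lf_neq0 Hloc (uniq_vseq _ _))[u [ua su nz]].
have {}ua : {subset u <= a} by move=> v /ua; rewrite mem_vseq.
have qu : (q < size u)%N by rewrite su size_vseq.
have [tX tq tu] := cup_front_card aX ua qu nz; split => //.
  by apply: (fsubset_trans tu); apply/fsubsetP => v; rewrite in_entries; exact: ua.
have da : {subset drop q u <= a} by move=> v /mem_drop /ua.
exists (entries (drop q u)); split; last by case: (cup_front_neq0 nz).
  by apply: entries_simplex aX da _; rewrite size_drop subn_gt0.
by apply/fsubsetP => v; rewrite in_entries; exact: da.
Qed.

Lemma functional_cup a q t z : a \in X -> t \in X -> (q.+1 < #|` a| + d)%N ->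
  H (vseq o a) (sdiff (cup_front o q t z)) =
  \sum_(t' <- cofaces X t) incid o t' t * H (vseq o a) (cup_front o q.+1 t' z) +
  (-1) ^+ q * H (vseq o a) (cup_front o q t (set_diff o z)).
Proof.
move=> aX tX qa; rewrite -(lf_sum Hloc) -[X in X + _]mul1r -(lfD Hloc).
apply: (lf_local Hloc (uniq_vseq _ _)) => u ua su.
rewrite mul1r (sdiff_cup_front o z aX tX) ?su ?size_vseq// => v /ua.
by rewrite mem_vseq.
Qed.

(** The Leibniz rule under H, summed over a. By locality a contributes to the coefficient at t' only
    if it contains t', so every sum may run over the cofaces of t. *)
Lemma capsum_diff q z t : t \in X -> (q.+1 < n.+1 + d)%N ->
  \sum_(t' <- cofaces X t) capsum q.+1 z t' * incid o t' t =
  \sum_(a <- cofaces X t | #|` a| == n.+1) H (vseq o a) (sdiff (cup_front o q t (z^~ a))) -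
  (-1) ^+ q * capsum q (fun r a => set_diff o (z^~ a) r) t.
Proof.
move=> tX qn; rewrite /capsum mulr_sumr -sumrB.
transitivity (\sum_(t' <- cofaces X t) \sum_(a <- cofaces X t | #|` a| == n.+1)
   incid o t' t * H (vseq o a) (cup_front o q.+1 t' (z^~ a))).
  apply: eq_big_seq => t'; rewrite in_cofaces// => /andP[t'X tt'].
  rewrite -mulr_sumr mulrC; congr (_ * _); rewrite big_mkcond [RHS]big_mkcond.
  apply/esym/cofaces_widen => // a aX ta ta'; case: eqP => // an; apply/eqP.
  by apply: contraNT ta' => /functional_neq0[]//; rewrite an.
rewrite exchange_big /= big_mkcond [RHS]big_mkcond; apply: eq_big_seq => a.
rewrite in_cofaces// => /andP[aX ta]; case: eqP => // an.
by rewrite functional_cup ?an// addrK.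
Qed.

(** As a function of its second argument, each [z r] satisfies the cycle equation of the pair (X, X
    - st r) at the (n-1)-simplices. The cochains with values in h_n give such z, and so do their
    multiples. *)
Definition local_cycles (z : {fset V} -> {fset V} -> int) :=
  forall r b, r \in X -> b \in X -> r `<=` b -> #|` b| = n ->
    \sum_(a <- cofaces X b) z r a * incid o a b = 0.

(** The terms are regrouped by the facet b instead of by a. By linearity, H at b is then applied to
    a single function, whose coefficients are the sums of z(r, a) [incid o a b] over a, that is, the
    boundary of z(r, ·) at b. *)
Lemma capsum_cycle q z t : t \in X -> (q < n + d)%N -> local_cycles z ->
  \sum_(a <- cofaces X t | #|` a| == n.+1)
    sdiff (fun w => H w (cup_front o q t (z^~ a))) (vseq o a) = 0.
Proof.
move=> tX qn zc.
transitivity (\sum_(a <- cofaces X t | #|` a| == n.+1) \sum_(b <- cofaces X t)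
   H (vseq o b) (cup_front o q t (z^~ a)) * incid o a b).
  rewrite big_mkcond [RHS]big_mkcond; apply: eq_big_seq => a.
  rewrite in_cofaces// => /andP[aX ta]; case: eqP => // an.
  rewrite -(sdiff_incid (o := o) (K := fun r => H (vseq o r) (cup_front o q t (z^~ a)))).
    by apply: eq_sdiff => w ws _; rewrite (subseq_vseq aX (fsubset_refl _) ws).1.
  move=> i ni; apply/eqP; apply: contraNT ni => nz.
  have cf := card_face o i.
  (* The empty set is not a simplex and is excluded separately: it is a facet only for n = 0, where
     H sees just the empty word, so that d = 0, against q < n + d. *)
  have [f0|f0] := eqVneq (face o a i) fset0.
    have [[|v u] [us su un]] := lf_neq0 Hloc (uniq_vseq _ _) nz; last first.
      by have := us v (mem_head _ _); rewrite mem_vseq f0 inE.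
    by exfalso; move: cf su; rewrite size_vseq /= f0 cardfs0 an; lia.
  have fX := simplex_face aX (face_sub o a i) f0.
  by have [] := functional_neq0 fX _ nz; first lia; rewrite in_cofaces// fX.
rewrite exchange_big big_seq big1// => b; rewrite in_cofaces// => /andP[bX tb].
have [bn|bn] := eqVneq #|` b| n; last first.
  rewrite big1// => a /eqP an; apply/eqP; rewrite mulf_eq0; apply/orP; right.
  by apply: contraNT bn => /incid_sub[_]; rewrite an => -[->].
transitivity (H (vseq o b) (fun u => \sum_(a <- cofaces X t)
   (if #|` a| == n.+1 then incid o a b else 0) * cup_front o q t (z^~ a) u)).
  rewrite (lf_sum Hloc) big_mkcond; apply: eq_bigr => a _; case: ifP => _; last by rewrite mul0r.
  by rewrite mulrC.
apply/eqP/contraT => /(lf_neq0 Hloc (uniq_vseq _ _))[u [ub su]].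
rewrite size_vseq bn in su.
have {}ub : {subset u <= b} by move=> v /ub; rewrite mem_vseq.
rewrite (_ : \sum_(_ <- _) _ = 0) ?eqxx// /cup_front.
set r := entries (drop q u); set c := _ * _%:R; set e := osgn _ _.
have db : {subset drop q u <= b} by move=> v /mem_drop /ub.
have rX : r \in X by apply: entries_simplex bX db _; rewrite size_drop subn_gt0 su.
have rb : r `<=` b by apply/fsubsetP => v; rewrite in_entries; exact: db.
(* Locality of H has put the back part r inside b, as the cycle condition requires. *)
transitivity (c * e * \sum_(a <- cofaces X t) z r a * incid o a b).
  rewrite mulr_sumr; apply: eq_big_seq => a; rewrite in_cofaces// => /andP[aX ta].
  case: eqP => [_|an]; first by ring.
  have [->|/incid_sub[_ E]] := eqVneq (incid o a b) 0; first by ring.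
  by case: an; rewrite -E bn.
rewrite (cofaces_widen _ bX tb) ?zc ?mulr0// => a _ _ ba.
by apply/eqP; rewrite mulf_eq0; apply/orP; right; apply: contraNT ba => /incid_sub[].
Qed.

End CapSums.

Section CapSumLemmas.
Variables (V : choiceType) (X : lf_complex V) (o : orientation X) (n : nat).

(** The words seen by H have n + 1 + d letters, so their back parts have n + 1 + d - q; back parts
    with repetitions carry the sign 0. *)
Lemma capsum_eq d H q z z' t : local_functional d H -> t \in X -> (q < n.+1 + d)%N ->
  (forall r a, r \in X -> a \in X -> r `<=` a -> #|` r| = (n.+1 + d - q)%N ->
     z r a = z' r a) ->
  capsum o n H q z t = capsum o n H q z' t.
Proof.
move=> Hloc tX qn zz; rewrite /capsum big_mkcond [RHS]big_mkcond; apply: eq_big_seq => a.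
rewrite in_cofaces// => /andP[aX ta]; case: eqP => // an.
apply: (lf_local Hloc (uniq_vseq _ _)) => u ua su.
have {}ua : {subset u <= a} by move=> v /ua; rewrite mem_vseq.
have da : {subset drop q u <= a} by move=> v /mem_drop /ua.
rewrite size_vseq an in su.
rewrite /cup_front; congr (_ * _); have := osgn_uniq o aX da.
case: ifP => [ud _|_ ->]; last by rewrite !mul0r.
rewrite zz ?card_entries ?size_drop ?su//.
  by apply: entries_simplex aX da _; rewrite size_drop su subn_gt0.
by apply/fsubsetP => v; rewrite in_entries; exact: da.
Qed.

Lemma capsum0 d H q z t : local_functional d H -> t \in X -> (q < n.+1 + d)%N ->
  (forall r a, r \in X -> a \in X -> r `<=` a -> #|` r| = (n.+1 + d - q)%N ->
     z r a = 0) ->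
  capsum o n H q z t = 0.
Proof.
move=> Hloc tX qn z0; rewrite (capsum_eq Hloc (z' := fun _ _ => 0))//.
rewrite /capsum big_seq_cond big1// => a /andP[]; rewrite in_cofaces// => /andP[aX ta] /eqP an.
apply/eqP/contraT => /(functional_neq0 Hloc aX)[]; first by rewrite an.
by move=> _ _ _ [r [_ _ /eqP]].
Qed.

Lemma capsum_neq0 d H q z t : local_functional d H -> t \in X -> (q < n.+1 + d)%N ->
  capsum o n H q z t != 0 -> #|` t| = q.+1 /\
    exists r a, [/\ a \in cofaces X r, t `<=` a, r \in X & z r a != 0].
Proof.
move=> Hloc tX qn nz; apply: contrapT => NE; move/eqP: nz; apply.
rewrite /capsum big_seq_cond big1// => a /andP[]; rewrite in_cofaces// => /andP[aX ta] /eqP an.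
apply/eqP/contraT => /(functional_neq0 Hloc aX)[]; first by rewrite an.
move=> _ tq _ [r [rX ra zr]]; exfalso; apply: NE; split => //; exists r, a; split => //.
by rewrite in_cofaces// aX.
Qed.

Lemma capsum_eval q z t : t \in X ->
  capsum o n (fun s g => g s) q z t =
  \sum_(a <- cofaces X t | (#|` a| == n.+1) && (front o a q == t)) z (back o a q) a.
Proof.
move=> tX; rewrite /capsum big_mkcond [RHS]big_mkcond; apply: eq_big_seq => a.
rewrite in_cofaces// => /andP[aX ta]; case: eqP => //= an.
rewrite /cup_front frontE backE.
have sub w : subseq w (vseq o a) -> osgn o w = 1 by move=> wa; rewrite (subseq_vseq aX _ wa).2.
rewrite !sub ?take_subseq ?drop_subseq// !mul1r.
by case: eqP => _; rewrite ?mul0r ?mul1r.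
Qed.

Hypothesis dimX : forall r, r \in X -> (#|` r| <= n.+1)%N.
Notation F := (loc_homology_sheaf o n).

Definition coeffs (phi : dfun F) (r a : {fset V}) : int := loc_coeff (phi r) a.

Lemma coeffs_cycle phi : local_cycles o n (coeffs phi).
Proof. by move=> r b rX bX rb _; apply: (loc_coeffP (phi r) rX).2. Qed.

(** The inclusion of r in a matters because the restriction map of the sheaf kills the symbols at
    simplices not containing r; on the others it leaves coefficients unchanged. *)
Lemma coeffs_diff phi r a : r \in X -> (1 < #|` r|)%N -> r `<=` a ->
  set_diff o ((coeffs phi)^~ a) r = coeffs (sheaf_diff o phi) r a.
Proof.
move=> rX r1 ra; rewrite /coeffs /loc_coeff /sheaf_diff rX.
have fX (i : 'I_(#|` r|)) : face o r i \in X.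
  apply: (simplex_face rX (face_sub _ _ _)); apply: contraTneq r1 => f0.
  by have := card_face o i; rewrite f0 cardfs0 => <-.
rewrite (eq_bigl xpredT) => [|i]; last by rewrite fX.
rewrite hrepr_sum; last exact: loc_boundaries0.
rewrite dfun_sumE; apply: eq_bigr => i _; rewrite dfun_MzE mulrC -mulrzr intz; congr (_ * _).
rewrite (_ : smap r (phi (face o r i)) = hclass (loc_cycles o r n) (loc_boundaries o r n)
  (loc_restr r (hrepr (phi (face o r i))))); last first.
  rewrite -[X in smap _ X]hreprK.
  by apply: loc_homology_mapE (face_sub _ _ _) _; exact: hreprP.
rewrite hrepr_hclass; first by rewrite /loc_restr ra.
  exact: loc_boundaries0.
by apply: loc_restr_cycles (face_sub o r i) _; exact: hreprP.
Qed.

Lemma cap_sheaf_chainE l phi t : 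
  cap_sheaf_chain n l (hrepr (fundamental_class o n)) phi t =
  if t \in X then capsum o n (fun s g => g s) (n - l) (coeffs phi) t else 0.
Proof.
rewrite /cap_sheaf_chain; case: ifP => // tX; rewrite capsum_eval// fundamental_classE//.
rewrite big_mkcond [RHS]big_mkcond; apply: eq_big_seq => a.
rewrite in_cofaces// => /andP[aX ta]; case: ifP => // /andP[/eqP an _].
have ba : {subset drop (n - l) (vseq o a) <= a} by move=> v /mem_drop; rewrite mem_vseq.
apply: (loc_pairing_top dimX).
- rewrite backE; apply: (entries_simplex aX) => //.
  by rewrite size_drop size_vseq an; lia.
- by rewrite /simplices aX an eqxx.
- by rewrite backE; apply/fsubsetP => v; rewrite in_entries; exact: ba.
Qed.

End CapSumLemmas.

(** * Cap sums for two orientations *)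

Section Reorientation.
Variables (V : choiceType) (X : lf_complex V) (o o' : orientation X) (n : nat).

(** The same cochain in terms of [o']: the simplex r and the symbol a both change by their signs. *)
Definition resign (z : {fset V} -> {fset V} -> int) r a : int :=
  rsign o o' r * rsign o o' a * z r a.

Lemma osgn_vseq_rsign a w : a \in X -> subseq w (vseq o' a) ->
  osgn o w = rsign o o' (entries w).
Proof.
move=> aX wa; have sa : {subset w <= a} by move=> v /(mem_subseq wa); rewrite mem_vseq.
have := osgn_change o o' aX sa; rewrite (subseq_vseq aX (fsubset_refl _) wa).2.
have := osgn_uniq o aX sa; rewrite (subseq_uniq wa (uniq_vseq _ _)).
set x := osgn o w; set e := rsign _ _ _ => xx ex.
by rewrite -[LHS]mul1r ex -mulrA xx mulr1.
Qed.

(** On an [o']-increasing word the [o]-sign is the sign of the simplex it spans. The signs of a and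
    of the back part are absorbed into [resign], and that of the front part t remains. *)
Lemma cup_front_change q t z a : a \in X -> 
  rsign o o' a * cup_front o q t (z^~ a) (vseq o' a) =
  rsign o o' t * cup_front o' q t ((resign z)^~ a) (vseq o' a).
Proof.
move=> aX; rewrite /cup_front /resign.
have [ts ds] := (take_subseq (vseq o' a) q.+1, drop_subseq (vseq o' a) q).
rewrite !(osgn_vseq_rsign aX)// !(subseq_vseq aX (fsubset_refl _) _).2//.
by case: eqP => [->|_] /=; ring.
Qed.

Lemma capsum_reorient q z t : t \in X -> local_cycles o n z -> (q <= n)%N ->
  \sum_(t' <- cofaces X t)
     capsum o n (htpy (fun s => vseq o' (entries s)) (osgn o')) q.+1 z t' * incid o t' t =
  capsum o n (fun s g => g s) q z t -
  rsign o o' t * capsum o' n (fun s g => g s) q (resign z) t -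
  (-1) ^+ q * capsum o n (htpy (fun s => vseq o' (entries s)) (osgn o')) q
    (fun r a => set_diff o (z^~ a) r) t.
Proof.
move=> tX zc qn; have Hl := local_htpy o'.
rewrite (capsum_diff o Hl) ?addn1//; congr (_ - _).
have qn1 : (q < n + 1)%N by rewrite addn1.
(* The vanishing sum over facets is added, so that the homotopy formula can be used for each a
   separately. *)
rewrite -[LHS]addr0 -[X in _ + X = _](capsum_cycle Hl tX qn1 zc).
rewrite -big_split /= /capsum mulr_sumr -sumrB big_mkcond [RHS]big_mkcond.
apply: eq_big_seq => a; rewrite in_cofaces// => /andP[aX ta]; case: eqP => // an.
rewrite -cup_front_change//.
have := @sdiff_htpy _ (fun s => vseq o' (entries s)) (osgn o') _ [in a] erefl _
   (vseq o a) (cup_front o q t (z^~ a)).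
rewrite vseqK; apply.
- by move=> s v; rewrite mem_vseq in_entries.
- by move=> s g /allP sa; apply: (sdiff_osgn _ aX).
- by apply/allP => v; rewrite mem_vseq.
Qed.

End Reorientation.

Section CapChains.
Variables (V : choiceType) (X : lf_complex V) (o : orientation X) (n : nat).

(** Closed stars of finitely many simplices contain only finitely many simplices. If r is not in X,
    the cofaces may be ill-behaved as a notion, but they are still a finite set. *)
Lemma finite_faces_cofaces (S : set {fset V}) : finite_set S ->
  finite_set [set t | exists r a, [/\ S r, a \in cofaces X r & t `<=` a]].
Proof.
move=> Sf; apply: (@sub_finite_set _ _ (\bigcup_(r in S) \bigcup_(a in [set` cofaces X r])
   [set` fpowerset a])%classic).
  move=> t [r [a [Sr ar ta]]]; exists r => //; exists a => //=.
  by rewrite fpowersetE.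
by apply: bigcup_finite => // r _; apply: bigcup_finite => // a _.
Qed.

Definition cap_chain H q (z : {fset V} -> {fset V} -> int) : dfun (constant_cosheaf X) :=
  fun t => if t \in X then capsum o n H q z t else 0.

Lemma cap_chain_chains d H q z (S : set {fset V}) : local_functional d H ->
  (q < n.+1 + d)%N -> finite_set S -> (forall r a, z r a <> 0 -> S r) ->
  chains (constant_cosheaf X) q.+1 (cap_chain H q z).
Proof.
move=> Hl qn Sf zS; split.
  move=> t; rewrite /cap_chain; case: ifP => // tX /eqP/(capsum_neq0 Hl tX qn)[tq _].
  by rewrite unfold_in /simplices tX tq eqxx.
apply: sub_finite_set (finite_faces_cofaces Sf) => t /=.
rewrite /cap_chain; case: ifP => // tX /eqP/(capsum_neq0 Hl tX qn)[_ [r [a [ar ta _ zr]]]].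
by exists r, a; split => //; apply: (zS _ a); exact/eqP.
Qed.

Lemma constant_diffE (c : dfun (constant_cosheaf X)) t : t \in X ->
  cosheaf_diff o c t = \sum_(s <- cofaces X t) c s * incid o s t.
Proof.
by move=> tX; rewrite /cosheaf_diff tX; apply: eq_bigr => s _; rewrite -mulrzr intz.
Qed.

Lemma constant_diff_cap H q z t : t \in X ->
  cosheaf_diff o (cap_chain H q z) t =
  \sum_(s <- cofaces X t) capsum o n H q z s * incid o s t.
Proof.
move=> tX; rewrite constant_diffE//; apply: eq_big_seq => s; rewrite in_cofaces// => /andP[sX _].
by rewrite /cap_chain sX.
Qed.

Hypothesis dimX : forall r, r \in X -> (#|` r| <= n.+1)%N.
Notation F := (loc_homology_sheaf o n).
Notation eval := (fun (s : seq V) (g : seq V -> int) => g s).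

Lemma coeffs_neq0 (phi : dfun F) r a : coeffs phi r a <> 0 -> phi r <> 0.
Proof.
move=> nz p0; apply: nz; rewrite /coeffs /loc_coeff p0 hrepr0//.
exact: loc_boundaries0.
Qed.

Lemma coeffs_diff0 (phi : dfun F) p r a : cocycles_c o F p phi -> r \in X ->
  #|` r| = p.+2 -> r `<=` a -> set_diff o ((coeffs phi)^~ a) r = 0.
Proof.
move=> [_ p0] rX rp ra; rewrite coeffs_diff ?rp// /coeffs /loc_coeff.
rewrite [sheaf_diff o phi]p0 hrepr0//; exact: loc_boundaries0.
Qed.

Lemma cap_chain_cycle (phi : dfun F) p q : (p + q)%N = n -> cocycles_c o F p phi ->
  cycles o (constant_cosheaf X) q (cap_chain eval q (coeffs phi)).
Proof.
move=> pq phiZ; have [[_ pf] _] := phiZ; split.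
  apply: (cap_chain_chains (local_eval _) _ pf); first by lia.
  by move=> r a; exact: coeffs_neq0.
apply: functional_extensionality_dep => t.
have [tX|tX] := boolP (t \in X); last by rewrite /= /cosheaf_diff (negPf tX).
rewrite [LHS]constant_diff_cap// dfun0.
case: q pq => [|q] pq.
  rewrite big_seq big1// => s; rewrite in_cofaces// => /andP[sX ts].
  have [->|/incid_sub[_ st]] := eqVneq (incid o s t) 0; first by rewrite mulr0.
  rewrite (_ : capsum _ _ _ _ _ _ = 0) ?mul0r//;
    apply/eqP/contraT => /(capsum_neq0 (local_eval _) sX)[|].
    by rewrite addn0.
  rewrite -st => -[/eqP]; rewrite cardfs_eq0 => /eqP t0 _.
  by move: tX; rewrite t0 (negPf (simplex_neq0 X)).
rewrite (capsum_diff o (local_eval V)) ?addn0//; last lia.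
(* For the evaluation, H applied to a coboundary is already the sum over facets. *)
have := capsum_cycle (local_eval V) tX _ (coeffs_cycle phi); move=> /(_ q) ->; last lia.
rewrite (capsum0 o (local_eval V)) ?mulr0 ?subr0//; first lia.
move=> r a rX aX ra rq; apply: (coeffs_diff0 phiZ) => //; lia.
Qed.

(** Up to sign, the product with δx is the boundary of the product with x. In degree p = 0 there is
    no x, as no simplex has 0 vertices. *)
Lemma cap_chain_boundary (phi : dfun F) p q : (p + q)%N = n -> coboundaries_c o F p phi ->
  boundaries o (constant_cosheaf X) q (cap_chain eval q (coeffs phi)).
Proof.
move=> pq [x [xs xf] <-].
have [p0|p0] := posnP p.
  rewrite (_ : x = 0).
    rewrite raddf0 (_ : cap_chain _ _ _ = 0); first exact: sg_set0.
    apply: functional_extensionality_dep => t; rewrite /cap_chain; case: ifP => // tX.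
    apply: (capsum0 o (local_eval V)) => //; first by lia.
    move=> r a _ _ _ _; apply/eqP/contraT => /eqP/coeffs_neq0.
    by rewrite dfun0.
  apply: functional_extensionality_dep => r; apply: contrapT => /xs.
  rewrite unfold_in /simplices p0 => /andP[rX]; rewrite cardfs_eq0 => /eqP r0.
  by move: rX; rewrite r0 (negPf (simplex_neq0 X)).
(* The front part gains a vertex since the back part, where x is evaluated, loses one. The sign
   cancels the factor -(-1)^q left by the Leibniz rule. *)
exists (cap_chain eval q.+1 (fun r a => (-1) ^+ q.+1 * coeffs x r a)).
  apply: (cap_chain_chains (local_eval _) _ xf); first by lia.
  by move=> r a nz; apply: (@coeffs_neq0 _ _ a) => c0; apply: nz; rewrite c0 mulr0.
apply: functional_extensionality_dep => t; rewrite /= [RHS]/cap_chain.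
have [tX|tX] := boolP (t \in X); last by rewrite /cosheaf_diff (negPf tX).
rewrite constant_diff_cap// (capsum_diff o (local_eval V)) ?addn0//; last lia.
have zc : local_cycles o n (fun r a => (-1) ^+ q.+1 * coeffs x r a).
  move=> r b rX bX rb bn; under eq_bigr do rewrite -mulrA.
  by rewrite -mulr_sumr (coeffs_cycle x) ?mulr0.
have := capsum_cycle (local_eval V) tX _ zc; move=> /(_ q) ->; last lia.
rewrite sub0r (capsum_eq o (local_eval V) (z' := fun r a => (-1) ^+ q.+1 * coeffs (sheaf_diff o
  x) r a))//; first last.
- move=> r a rX aX ra rq; rewrite -coeffs_diff//; last by lia.
  by rewrite /set_diff mulr_sumr; apply: eq_bigr => i _; rewrite mulrCA.
- lia.
have sgE : - (-1) ^+ q * (-1) ^+ q.+1 = 1 :> int by rewrite exprS mulN1r mulrNN -expr2 sqrr_sign.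
rewrite !capsum_eval// -mulNr mulr_sumr; apply: eq_bigr => a _.
by rewrite mulrA sgE mul1r.
Qed.

Section Reoriented.
Variable o' : orientation X.
Notation htp := (htpy (fun s => vseq o' (entries s)) (osgn o')).

Lemma cap_chain_reorient (phi : dfun F) p q t : (p + q)%N = n -> cocycles_c o F p phi ->
  t \in X -> cosheaf_diff o (cap_chain htp q.+1 (coeffs phi)) t =
  cap_chain eval q (coeffs phi) t - rsign o o' t * capsum o' n eval q (resign o o' (coeffs phi)) t.
Proof.
move=> pq phiZ tX; rewrite constant_diff_cap// capsum_reorient//; last lia.
  rewrite (capsum0 o (local_htpy o') tX) ?mulr0 ?subr0; first by rewrite /cap_chain tX.
    by lia.
  by move=> r a rX aX ra rq; apply: (coeffs_diff0 phiZ) => //; lia.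
exact: coeffs_cycle.
Qed.

Lemma cap_chain_htpy_chains (phi : dfun F) p q : (p + q)%N = n -> cocycles_c o F p phi ->
  chains (constant_cosheaf X) q.+2 (cap_chain htp q.+1 (coeffs phi)).
Proof.
move=> pq [[_ pf] _]; apply: (cap_chain_chains (local_htpy o') _ pf); first by lia.
by move=> r a; exact: coeffs_neq0.
Qed.
End Reoriented.


End CapChains.

(** * Naturality for sheaf coefficients *)

Lemma sdiff_map (T U : eqType) (f : T -> U) (g : seq U -> int) s :
  sdiff g (map f s) = sdiff (fun w => g (map f w)) s.
Proof. by elim: s g => //= v s IH g; rewrite IH. Qed.

Lemma fimset_entries (V W : choiceType) (f : V -> W) s :
  (f @` entries s) = entries (map f s).
Proof.
apply/fsetP => w; rewrite in_entries; apply/imfsetP/mapP => [[v /=]|[v vs ->]].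
  by rewrite in_entries => vs ->; exists v.
by exists v; rewrite //= in_entries.
Qed.

Lemma eq_big_fset_support (I : choiceType) (A B : {fset I}) (F : I -> int) :
  (forall i, i \in A -> F i != 0 -> i \in B) -> (forall i, i \in B -> F i != 0 -> i \in A) ->
  \sum_(i <- A) F i = \sum_(i <- B) F i.
Proof.
move=> AB BA; transitivity (\sum_(i <- A `&` B) F i).
  apply/esym/big_fset_incl => [|i iA]; first exact: fsubsetIl.
  by rewrite !inE iA /= => iB; apply/eqP; apply: contraNT iB; exact: AB.
apply/big_fset_incl => [|i iB]; first exact: fsubsetIr.
by rewrite !inE iB andbT => iA; apply/eqP; apply: contraNT iA; exact: BA.
Qed.

(** * The orientation pulled back along f *)

Section PulledOrientation.
Variables (V W : choiceType) (X : lf_complex V) (Y : lf_complex W).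
Variables (oX : orientation X) (oY : orientation Y) (f : V -> W).
Hypothesis fS : simplicial X Y f.
Hypothesis f_inj : forall s, s \in X -> {in s &, injective f}.

Program Definition pulled_orientation : orientation X :=
  @Orientation V X (fun s u v => ole oY (f @` s) (f u) (f v)) _ _ _ _.
Next Obligation.
move=> s sX u v us vs; apply: ole_total; rewrite ?in_imfset//; exact: fS.
Qed.
Next Obligation.
move=> s sX u v us vs uv; apply: (f_inj sX) => //.
by apply: (ole_anti (fS sX)) uv; rewrite ?in_imfset.
Qed.
Next Obligation.
move=> s sX u v w us vs ws; apply: (ole_trans (fS sX)); rewrite ?in_imfset//.
Qed.
Next Obligation.
move=> s t sX tX ts u v ut vt; apply: ole_face; rewrite ?in_imfset//; try exact: fS.
by apply/fsubsetP => w /imfsetP[x /= xt ->]; rewrite in_imfset//=; exact: (fsubsetP ts).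
Qed.

Notation o' := pulled_orientation.

Lemma map_vseq a w : a \in X -> subseq w (vseq o' a) ->
  map f w = vseq oY (f @` entries w).
Proof.
move=> aX wa; rewrite fimset_entries (vseq_entries _ (fS aX)); last first.
  by move=> y /mapP[v /(mem_subseq wa)]; rewrite mem_vseq => va ->; rewrite in_imfset.
rewrite (nsort_map _ _).1; last first.
  by move=> u v /(mem_subseq wa) + /(mem_subseq wa); rewrite !mem_vseq; exact: f_inj.
congr map; apply/esym; apply: (nsort_id _).1.
exact: (subseq_pairwise wa (vseq_strict o' aX (fsubset_refl _))).
Qed.

Lemma map_vseq_id a : a \in X -> map f (vseq o' a) = vseq oY (f @` a).
Proof. by move=> aX; rewrite (map_vseq aX (subseq_refl _)) vseqK. Qed.

Lemma card_fimset a : a \in X -> #|` f @` a| = #|` a|.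
Proof. by move=> aX; rewrite card_in_imfset//; exact: f_inj. Qed.

Lemma fimset_front a k : a \in X -> (f @` front o' a k) = front oY (f @` a) k.
Proof. by move=> aX; rewrite !frontE fimset_entries -map_vseq_id// map_take. Qed.

Lemma fimset_back a k : a \in X -> (f @` back o' a k) = back oY (f @` a) k.
Proof. by move=> aX; rewrite !backE fimset_entries -map_vseq_id// map_drop. Qed.

Lemma fimset_face a k : a \in X -> (f @` face o' a k) = face oY (f @` a) k.
Proof.
by move=> aX; rewrite !faceE fimset_entries -map_vseq_id// /del map_cat map_take map_drop.
Qed.

(** Sorting the images of the vertices of a by the order on f a is sorting the vertices by the
    pulled-back order. Thus all signs in the induced maps are those of a change of orientation on
    X. *)
Lemma osignE a : a \in X -> osign oX oY f a = rsign oX o' a.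
Proof.
move=> aX; have aa : {subset vseq oX a <= a} by move=> v; rewrite mem_vseq.
have mi : {in vseq oX a &, injective f} by move=> u v /aa ua /aa; exact: f_inj.
have fa : {subset map f (vseq oX a) <= f @` a}.
  by move=> y /mapP[v /aa va ->]; rewrite in_imfset.
have fE : (f @` a) = entries (map f (vseq oX a)) by rewrite -fimset_entries vseqK.
rewrite /osign {1}fE (vseq_entries _ (fS aX) fa) /rsign (osgnE _ aX aa).
rewrite (perm_sign_nsort (D := [in f @` a])).
- exact: (nsort_map _ _).2.
- exact: (@ole_total _ _ oY _ (fS aX)).
- exact: (@ole_anti _ _ oY _ (fS aX)).
- exact: (@ole_trans _ _ oY _ (fS aX)).
- by rewrite map_inj_in_uniq ?uniq_vseq.
- exact/allP.
Qed.

Lemma fimset_sub s t : s `<=` t -> (f @` s) `<=` (f @` t).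
Proof.
move=> /fsubsetP st; apply/fsubsetP => w /imfsetP[v /= vs ->].
by rewrite in_imfset//=; exact: st.
Qed.

Lemma fimset_subK a s t : a \in X -> s `<=` a -> t `<=` a -> (f @` s) `<=` (f @` t) -> s `<=` t.
Proof.
move=> aX /fsubsetP sa /fsubsetP ta /fsubsetP st; apply/fsubsetP => v vs.
have /st/imfsetP[u /= ut vu] : f v \in f @` s by rewrite in_imfset.
by rewrite (f_inj aX (sa _ vs) (ta _ ut) vu).
Qed.

Lemma fimset_inj a s t : a \in X -> s `<=` a -> t `<=` a -> (f @` s) = (f @` t) -> s = t.
Proof.
move=> aX sa ta st; apply/eqP; rewrite eqEfsubset.
by apply/andP; split; apply: (fimset_subK aX) => //; rewrite st fsubset_refl.
Qed.

(* The unique face of [a] lying over [r] when [r] is a face of [f @` a]. *)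
Definition lift_face (a : {fset V}) (r : {fset W}) : {fset V} := [fset v in a | f v \in r].

Lemma lift_face_sub a r : lift_face a r `<=` a.
Proof. by apply/fsubsetP => v; rewrite !inE => /andP[]. Qed.

Lemma fimset_lift_face a r : r `<=` (f @` a) -> (f @` lift_face a r) = r.
Proof.
move=> /fsubsetP ra; apply/fsetP => w; apply/imfsetP/idP => [[v /=]|wr].
  by rewrite !inE => /andP[_ vr] ->.
by have /imfsetP[v /= va wv] := ra w wr; exists v; rewrite //= !inE va -wv.
Qed.

Lemma lift_face_simplex a r : a \in X -> r \in Y -> r `<=` (f @` a) -> lift_face a r \in X.
Proof.
move=> aX rY ra; apply: (simplex_face aX (lift_face_sub _ _)).
apply: contraTneq rY => l0; rewrite -(fimset_lift_face ra) l0 imfset0.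
exact: simplex_neq0.
Qed.

(** The faces of f a are the images of the faces of a. The index set [S] is left free so that one
    finite set can serve all a at once; as t is nonempty, it may omit the empty face. *)
Lemma incid_fimset a t (S : {fset {fset V}}) : a \in X ->
  (forall s, s `<=` a -> s != fset0 -> s \in S) -> t != fset0 ->
  incid oY (f @` a) t = \sum_(s <- S | (f @` s) == t) incid o' a s.
Proof.
move=> aX aS t0; rewrite incidE -map_vseq_id// sdiff_map.
rewrite (eq_sdiff (h := fun w => ((f @` entries w) == t)%:R)); last first.
  by move=> w _ _; rewrite fimset_entries.
rewrite (sdiff_incid (o := o') (F := S) (K := fun s => ((f @` s) == t)%:R)) => [|i].
  by rewrite [RHS]big_mkcond; apply: eq_bigr => s _; case: eqP; rewrite ?mul1r ?mul0r.
case: eqP => // ft; rewrite aS ?face_sub//; apply: contraNneq t0 => s0.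
by rewrite -ft s0 imfset0.
Qed.

Lemma fibre_sum (G : zmodType) (S : {fset {fset V}}) (F : {fset V} -> G) r :
  (forall s, s \in S -> s \in X) -> (forall s, s \in X -> F s <> 0 -> s \in S) ->
  \sum_(s \in fibre X f r) F s = \sum_(s <- S | (f @` s) == r) F s.
Proof.
move=> SX FS; rewrite fsbig_mkcond (fsbigTE S).
  rewrite [RHS]big_mkcond; apply: eq_big_seq => s sS; rewrite /patch.
  case: eqP => sr; first by rewrite ifT// inE; split => //; exact: SX.
  by rewrite ifF//; apply/negP; rewrite inE => -[].
move=> s sS; rewrite /patch; case: ifP => // /set_mem[sX _].
by apply: contrapT => /(FS s sX); rewrite (negPf sS).
Qed.

End PulledOrientation.

(** * Push-forward of chains *)

Section PushChains.
Variables (V W : choiceType) (X : lf_complex V) (Y : lf_complex W).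
Variables (oX : orientation X) (oY : orientation Y) (f : V -> W).
Hypothesis fS : simplicial X Y f.
Hypothesis f_inj : forall s, s \in X -> {in s &, injective f}.
Notation o' := (pulled_orientation oY fS f_inj).
Notation eps := (rsign oX o').

(** Provides a common finite index set, containing all faces involved, over which the sums along
    fibres can be rewritten and exchanged. *)
Lemma finite_face_closure (C : set {fset V}) : finite_set C -> (forall s, C s -> s \in X) ->
  exists S : {fset {fset V}}, (forall s, s \in S -> s \in X) /\
    forall s t, C s -> t `<=` s -> t != fset0 -> t \in S.
Proof.
move=> Cf CX; pose D := [set t : {fset V} | t != fset0 /\ exists2 s, C s & t `<=` s].
have Df : finite_set D.
  apply: (@sub_finite_set _ _ (\bigcup_(s in C) [set` fpowerset s])%classic).
    by move=> t [_ [s Cs ts]]; exists s => //=; rewrite fpowersetE.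
  by apply: bigcup_finite => // s _.
exists (fset_set D); split => [t|s t Cs ts t0].
  rewrite in_fset_set// => /set_mem[t0 [s Cs ts]]; exact: simplex_face (CX _ Cs) ts t0.
by rewrite in_fset_set//; apply/mem_set; split => //; exists s.
Qed.

Definition fin_chain (c : dfun (constant_cosheaf X)) :=
  finite_set [set s | c s <> 0] /\ forall s, c s <> 0 -> s \in X.

Lemma push_chainE c (S : {fset {fset V}}) r : (forall s, s \in S -> s \in X) ->
  (forall s, s \in X -> c s <> 0 -> s \in S) ->
  push_chain oX oY f c r = \sum_(s <- S | (f @` s) == r) eps s * c s.
Proof.
move=> SX cS; rewrite /push_chain (fibre_sum f (S := S))//.
  by rewrite big_seq_cond [RHS]big_seq_cond; apply: eq_bigr => s /andP[/SX sX _];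
    rewrite (osignE _ _ fS f_inj).
move=> s sX nz; apply: cS => // c0; apply: nz; rewrite c0 mulr0.
by [].
Qed.

(** For the pulled-back orientation f preserves incidence numbers; [rsign_incid] then trades the
    sign of s for that of its face t, which is the sign that the push-forward puts on t. *)
Lemma push_chain_diff c : fin_chain c ->
  cosheaf_diff oY (push_chain oX oY f c : dfun (constant_cosheaf Y)) =
  push_chain oX oY f (cosheaf_diff oX c).
Proof.
move=> [cf cX]; have [S [SX cS]] := finite_face_closure cf cX.
have cS' s : c s <> 0 -> forall t, t `<=` s -> t != fset0 -> t \in S by move=> cs t; exact: cS.
have cSs s : s \in X -> c s <> 0 -> s \in S by move=> sX cs;
  exact: (cS' s cs s (fsubset_refl s) (simplexP sX)).
apply: functional_extensionality_dep => r; have [rY|rY] := boolP (r \in Y); last first.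
  rewrite /cosheaf_diff (negPf rY) /push_chain fsbig1// => s [sX sr].
  by move: rY; rewrite -sr (fS sX).
rewrite constant_diffE// (push_chainE (S := S))//; last first.
  move=> t tX; rewrite constant_diffE// => /eqP nz; apply: contrapT => tS; move/eqP: nz; apply.
  rewrite big_seq big1// => s; rewrite in_cofaces// => /andP[sX ts].
  have [->|/eqP cs] := eqVneq (c s) 0; first by rewrite mul0r.
  by case: tS; exact: (cS' s cs t ts (simplexP tX)).
transitivity (\sum_(u <- cofaces Y r) \sum_(s <- S | (f @` s) == u) eps s * c s * incid oY (f @`
  s) r).
  by apply: eq_bigr => u _; rewrite (push_chainE u SX cSs) mulr_suml; apply: eq_bigr => s /eqP->.
transitivity (\sum_(s <- S) eps s * c s * incid oY (f @` s) r).
  rewrite (exchange_big_dep xpredT)//=; apply: eq_big_seq => s sS.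
  have fsY := fS (SX _ sS).
  have [fsr|fsr] := boolP ((f @` s) \in cofaces Y r).
    rewrite big_mkcond (big_fsetD1 _ fsr)/= eqxx big_seq big1 ?addr0// => u.
    by rewrite !inE eq_sym => /andP[/negPf->].
  rewrite big_seq_cond big1; last by move=> u /andP[ur /eqP fu]; rewrite fu ur in fsr.
  apply/esym/eqP; rewrite mulf_eq0; apply/orP; right; apply: contraNT fsr => /incid_sub[rs _].
  by rewrite in_cofaces// rs andbT; exact: fsY.
transitivity (\sum_(s <- S) \sum_(t <- S | (f @` t) == r) eps t * (c s * incid oX s t)).
  apply: eq_big_seq => s sS; have sX := SX _ sS.
  have [->|/eqP cs] := eqVneq (c s) 0.
    by rewrite mulr0 mul0r big1// => t _; rewrite mul0r mulr0.
  rewrite (incid_fimset oY fS f_inj (S := S))//; last 2 first.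
  - by move=> t ts t0; exact: (cS' s).
  - exact: simplexP rY.
  rewrite mulr_sumr; apply: eq_bigr => t _.
  have := rsign_incid oX o' t sX; set e := rsign _ _ _; set e' := rsign _ _ _.
  by move=> E; rewrite (_ : e * _ = c s * (incid oX s t * e)); [rewrite E; ring|ring].
rewrite exchange_big /= big_seq_cond [RHS]big_seq_cond; apply: eq_bigr => t /andP[tS _].
have tX := SX t tS; rewrite constant_diffE//.
rewrite -mulr_sumr; congr (_ * _); apply: eq_big_fset_support => s.
  move=> sS nz; rewrite in_cofaces// SX//=.
  by apply: contraNT nz => ts; rewrite mulf_eq0; apply/orP; right;
    apply: contraNT ts => /incid_sub[].
rewrite in_cofaces// => /andP[sX ts] nz; apply: cSs => // c0.
by move: nz; rewrite c0 mul0r eqxx.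
Qed.

Lemma push_chain_chains m c : chains (constant_cosheaf X) m c ->
  chains (constant_cosheaf Y) m (push_chain oX oY f c).
Proof.
move=> [cs cf].
have nz r : push_chain oX oY f c r <> 0 -> exists2 s, c s <> 0 & (f @` s) = r /\ s \in X.
  move=> nz; apply: contrapT => NE; apply: nz; rewrite /push_chain fsbig1// => s [sX sr].
  have [->|/eqP cs0] := eqVneq (c s) 0; first by rewrite mulr0.
  by case: NE; exists s.
split.
  move=> r /nz[s /cs]; rewrite !unfold_in /simplices => /andP[sX sm] [<- _].
  by rewrite (card_fimset f_inj sX) sm andbT; exact: fS.
apply: sub_finite_set (finite_image (fun s : {fset V} => f @` s) cf) => r /nz[s cs0 [<- _]].
by exists s.
Qed.

Lemma fin_chainW m c : chains (constant_cosheaf X) m c -> fin_chain c.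
Proof. by move=> [cs cf]; split => // s /cs; rewrite unfold_in => /andP[]. Qed.

Lemma push_chainB c d : fin_chain c -> fin_chain d ->
  push_chain oX oY f (c - d) = push_chain oX oY f c - push_chain oX oY f d.
Proof.
move=> [cf cX] [df dX].
have [S [SX cS]] : exists S : {fset {fset V}}, (forall s, s \in S -> s \in X) /\
   forall s t, (c s <> 0 \/ d s <> 0) -> t `<=` s -> t != fset0 -> t \in S.
  have cdf : finite_set ([set s | c s <> 0] `|` [set s | d s <> 0])%classic.
    by rewrite finite_setU.
  by apply: (finite_face_closure cdf) => s [/cX|/dX].
have cS' s : s \in X -> (c s <> 0 \/ d s <> 0) -> s \in S.
  by move=> sX cd; exact: (cS s s cd (fsubset_refl s) (simplexP sX)).
apply: functional_extensionality_dep => r; rewrite dfunB !(push_chainE (S := S))//.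
- by rewrite -sumrB; apply: eq_bigr => s _; rewrite dfunB mulrBr.
- by move=> s sX ds; apply: cS' => //; right.
- by move=> s sX cs; apply: cS' => //; left.
- move=> s sX; rewrite dfunB => cd; apply: cS' => //;
  apply: contrapT => /not_orP[/contrapT c0 /contrapT d0].
  by apply: cd; rewrite c0 d0 subrr.
Qed.

Lemma push_chain_cycles k c : cycles oX (constant_cosheaf X) k c ->
  cycles oY (constant_cosheaf Y) k (push_chain oX oY f c).
Proof.
move=> [cc c0]; split; first exact: push_chain_chains.
rewrite [LHS](push_chain_diff (fin_chainW cc)) (_ : cosheaf_diff oX c = 0)//.
by apply: functional_extensionality_dep => r; rewrite /push_chain fsbig1// => s _; rewrite mulr0.
Qed.

Lemma push_chain_boundaries k c : boundaries oX (constant_cosheaf X) k c ->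
  boundaries oY (constant_cosheaf Y) k (push_chain oX oY f c).
Proof.
move=> [b bc <-]; exists (push_chain oX oY f b); first exact: push_chain_chains.
exact: (push_chain_diff (fin_chainW bc)).
Qed.

Lemma homology_pushE k c : cycles oX (constant_cosheaf X) k c ->
  homology_push oX oY f (hclass _ (boundaries oX (constant_cosheaf X) k) c) =
  hclass _ _ (push_chain oX oY f c).
Proof.
move=> cZ; apply: induced_hclass => //.
- by move=> x y [xc _] [yc _]; rewrite push_chainB//; [exact: fin_chainW xc|exact: fin_chainW yc].
- exact: push_chain_cycles.
- by move=> x _; exact: push_chain_boundaries.
Qed.


End PushChains.

Lemma big_fset_only (I : choiceType) (T : {fset I}) (P : pred I) (F : I -> int) x :
  (forall s, s \in T -> P s -> s != x -> F s = 0) ->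
  (F x != 0 -> (x \in T) && P x) -> \sum_(s <- T | P s) F s = F x.
Proof.
move=> F0 Fx; have [/andP[xT Px]|nx] := boolP ((x \in T) && P x); last first.
  have /eqP-> : F x == 0 by exact: contraNT Fx nx.
  rewrite big_seq_cond big1// => s /andP[sT Ps].
  by apply: F0 => //; apply: contraNneq nx => <-; rewrite sT.
rewrite big_mkcond (big_fsetD1 _ xT)/= Px big_seq big1 ?addr0// => s.
by rewrite !inE => /andP[sx sT]; case: ifP => // Ps; exact: F0.
Qed.

(** * The map f_! on cochains with values in local homology *)

Section ShriekCochains.
Variables (V W : choiceType) (X : lf_complex V) (Y : lf_complex W).
Variables (oX : orientation X) (oY : orientation Y) (f : V -> W) (n : nat).
Hypothesis fS : simplicial X Y f.
Hypothesis f_inj : forall s, s \in X -> {in s &, injective f}.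
Hypothesis dimX : forall r, r \in X -> (#|` r| <= n.+1)%N.
Hypothesis dimY : forall r, r \in Y -> (#|` r| <= n.+1)%N.
Notation o' := (pulled_orientation oY fS f_inj).
Notation eps := (rsign oX o').
Notation FX := (loc_homology_sheaf oX n).
Notation FY := (loc_homology_sheaf oY n).

Lemma loc_push_cycle s c : s \in X -> loc_cycles oX s n c ->
  loc_cycles oY (f @` s) n (loc_push oX oY f s c).
Proof.
move=> sX [[cs cf] c0].
have nz b : loc_push oX oY f s c b <> 0 -> exists a, [/\ a \in cofaces X s, (f @` a) = b & c a <>
  0].
  move=> nz; apply: contrapT => NE; apply: nz;
    rewrite /loc_push big_seq_cond big1// => a /andP[ac /eqP ab].
  have [->|/eqP ca] := eqVneq (c a) 0; first by rewrite mulr0.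
  by case: NE; exists a.
split; first split.
- move=> b /nz[a [+ <- /cs]]; rewrite in_cofaces// => /andP[aX sa].
  rewrite !unfold_in /star_simplices /simplices => /andP[/andP[_ an] _].
  by rewrite (card_fimset f_inj aX) an fimset_sub// !andbT; exact: fS.
- apply: sub_finite_set (finite_image (fun a : {fset V} => f @` a) cf) => b /nz[a [_ <- ca]].
  by exists a.
apply: functional_extensionality_dep => b; rewrite /= /loc_bd; case: ifP => // /andP[bY sb].
have [S [SX aS]] := @finite_face_closure _ X [set` cofaces X s] (finite_fset _)
  (fun a (ac : a \in cofaces X s) => (andP (etrans (esym (in_cofaces a sX)) ac)).1).
transitivity (\sum_(u <- cofaces Y b) \sum_(a <- cofaces X s | (f @` a) == u)
    eps a * c a * incid oY (f @` a) b).
  apply: eq_bigr => u _; rewrite -mulrzr intz /loc_push mulr_suml.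
  rewrite big_seq_cond [RHS]big_seq_cond; apply: eq_bigr => a /andP[+ /eqP<-].
  by rewrite in_cofaces// => /andP[aX _]; rewrite (osignE _ _ fS f_inj).
transitivity (\sum_(a <- cofaces X s) eps a * c a * incid oY (f @` a) b).
  rewrite (exchange_big_dep xpredT)//=; apply: eq_big_seq => a.
  rewrite in_cofaces// => /andP[aX sa].
  apply: (big_fset_only (F := fun u => eps a * c a * incid oY (f @` a) b) (x := f @` a)).
    by move=> u _ /eqP -> /eqP.
  rewrite eqxx andbT !mulf_eq0 !negb_or => /andP[_ /incid_sub[ba _]].
  by rewrite in_cofaces// ba andbT; exact: fS.
transitivity (\sum_(a <- cofaces X s) \sum_(t <- S | (f @` t) == b) eps t * (c a * incid oX a t)).
  apply: eq_big_seq => a ac; have := ac; rewrite in_cofaces// => /andP[aX sa].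
  rewrite (incid_fimset oY fS f_inj (S := S))//; last 2 first.
  - by move=> t; exact: aS.
  - exact: simplexP bY.
  rewrite mulr_sumr; apply: eq_bigr => t _.
  have := rsign_incid oX o' t aX; set e := rsign _ _ _; set e' := rsign _ _ _.
  by move=> E; rewrite (_ : e * _ = c a * (incid oX a t * e)); [rewrite E; ring|ring].
rewrite exchange_big /= big_seq_cond big1// => t /andP[tS /eqP tb].
have tX := SX t tS; rewrite -mulr_sumr.
(* For t containing s this is the cycle equation of c at t. Any other t contributes nothing: if t
   were a face of some a containing s, then f s ⊆ b = f t and injectivity on a would give s ⊆ t. *)
have [st|st] := boolP (s `<=` t).
  have : loc_bd oX s c t = 0 by rewrite [loc_bd oX s c]c0.
  rewrite /loc_bd tX st /= => E; rewrite (cofaces_widen sX tX st).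
    rewrite (_ : \sum_(_ <- _) _ = 0) ?mulr0// -[RHS]E; apply: eq_bigr => a _.
    by rewrite -mulrzr intz.
  move=> a aX sa ta; apply/eqP; rewrite mulf_eq0; apply/orP; right.
  by apply: contraNT ta => /incid_sub[].
rewrite big_seq big1 ?mulr0// => a; rewrite in_cofaces// => /andP[aX sa].
apply/eqP; rewrite mulf_eq0; apply/orP; right.
apply: contraNT st => /incid_sub[ta _]; apply: (fimset_subK f_inj aX sa ta).
by rewrite tb.
Qed.

(** All simplices at which φ, its products or their faces can be nonzero lie in T, so that every
    fibre sum for f_! is a finite sum over T. *)
Lemma cochain_faces p (phi : dfun FX) : cochains_c FX p phi ->
  exists T : {fset {fset V}}, (forall s, s \in T -> s \in X) /\
    forall s a t, s \in X -> phi s <> 0 -> a \in X -> s `<=` a ->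
      t `<=` a -> t != fset0 -> t \in T.
Proof.
move=> [_ pf].
pose C := [set a | exists s, [/\ phi s <> 0, s \in X & a \in cofaces X s]].
have Cf : finite_set C.
  by apply: sub_finite_set (finite_faces_cofaces X pf) => a [s [ps sX ac]]; exists s, a.
have CX s : C s -> s \in X by move=> [r [_ rX]]; rewrite in_cofaces// => /andP[].
have [T [TX CT]] := finite_face_closure Cf CX; exists T; split => // s a t sX ps aX sa.
by apply: CT; exists s; split => //; rewrite in_cofaces// aX.
Qed.

Section OneCochain.
Variables (p : nat) (phi : dfun FX).
Hypothesis phiC : cochains_c FX p phi.
Variable T : {fset {fset V}}.
Hypothesis TX : forall s, s \in T -> s \in X.
Hypothesis Tphi : forall s a t, s \in X -> phi s <> 0 -> a \in X -> s `<=` a ->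
  t `<=` a -> t != fset0 -> t \in T.

Notation z' := (resign oX o' (coeffs phi)).
Notation shriek := (shriek_cochain oY f phi : dfun FY).

Lemma phi_in s : s \in X -> phi s <> 0 -> s \in T.
Proof. by move=> sX ps; exact: (Tphi sX ps sX (fsubset_refl s) (fsubset_refl s) (simplexP sX)). Qed.

Lemma resign_neq0 s a : s \in X -> z' s a != 0 ->
  [/\ phi s <> 0, a \in X, #|` a| = n.+1 & s `<=` a].
Proof.
move=> sX; rewrite /resign !mulf_eq0 !negb_or => /andP[_ nz].
by have [aX an sa] := (loc_coeffP (phi s) sX).1 a nz; split => //;
  apply: (@coeffs_neq0 _ _ _ _ dimX _ _ a); exact/eqP.
Qed.

Lemma loc_homology_push0 s r : loc_homology_push oY f r (0 : loc_homology oX s n) = 0 :>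
  loc_homology oY r n.
Proof.
rewrite /loc_homology_push /induced hrepr0; last exact: loc_boundaries0.
rewrite (_ : loc_push _ _ _ _ _ = 0) ?hclass0//.
by apply: functional_extensionality_dep => b; rewrite /loc_push big1// => a _; rewrite mulr0.
Qed.

(** A nonzero coefficient at a forces s to be a face of a, and a has exactly one face over u when u
    ⊆ f a. The double sum over the fibres of u and b therefore has one term for each a. *)
Lemma shriek_coeffs u b : u \in Y ->
  coeffs shriek u b =
  \sum_(a <- T | (f @` a) == b) if u `<=` b then z' (lift_face f a u) a else 0.
Proof.
move=> uY; rewrite /coeffs /loc_coeff /shriek_cochain (fibre_sum f (S := T))//; last first.
  move=> s sX nz; apply: phi_in => // p0; apply: nz; rewrite p0 loc_homology_push0 mul0rz.
  by [].
rewrite hrepr_sum; last exact: loc_boundaries0.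
rewrite dfun_sumE.
transitivity (\sum_(s <- T | (f @` s) == u) \sum_(a <- T | (f @` a) == b) z' s a).
  rewrite big_seq_cond [RHS]big_seq_cond; apply: eq_bigr => s /andP[sT /eqP su].
  have sX := TX sT; rewrite dfun_MzE /loc_homology_push /induced hrepr_hclass; first last.
  - by rewrite -su; apply: loc_push_cycle => //; exact: hreprP.
  - exact: loc_boundaries0.
  rewrite -mulrzr intz /loc_push mulr_suml.
  transitivity (\sum_(a <- cofaces X s | (f @` a) == b) z' s a).
    rewrite big_seq_cond [RHS]big_seq_cond; apply: eq_bigr => a /andP[].
    rewrite in_cofaces// => /andP[aX _] _; rewrite !(osignE _ _ fS f_inj)//.
    by rewrite /resign /coeffs /loc_coeff; ring.
  rewrite big_mkcond [RHS]big_mkcond; apply: eq_big_fset_support => a.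
    rewrite in_cofaces// => /andP[aX sa]; case: ifP => [_|_]; last by rewrite eqxx.
    move=> /(resign_neq0 sX)[ps _ _ _].
    exact: (Tphi sX ps aX sa (fsubset_refl a) (simplexP aX)).
  move=> aT; case: ifP => [_|_]; last by rewrite eqxx.
  by move=> /(resign_neq0 sX)[_ aX _ sa]; rewrite in_cofaces// aX.
rewrite (exchange_big_dep (fun a : {fset V} => (f @` a) == b))//= big_seq_cond [RHS]big_seq_cond.
apply: eq_bigr => a /andP[aT /eqP ab]; have aX := TX aT.
rewrite (eq_bigl (fun s : {fset V} => (f @` s) == u)); last by move=> s; rewrite ab eqxx andbT.
case: ifPn => ub; last first.
  apply: big1_fset => s sT /eqP su; apply/eqP.
  apply: contraNT ub => /(resign_neq0 (TX sT))[_ _ _ sa].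
  by rewrite -su -ab fimset_sub.
have ua : u `<=` (f @` a) by rewrite ab.
have lX := lift_face_simplex aX uY ua.
apply: (big_fset_only (F := z'^~ a)).
  move=> s sT /eqP su sl; apply/eqP; apply: contraNT sl => /(resign_neq0 (TX sT))[_ _ _ sa].
  apply/eqP; apply: (fimset_inj f_inj aX sa (lift_face_sub _ _ _)).
  by rewrite fimset_lift_face.
by move=> /(resign_neq0 lX)[pl _ _ _]; rewrite fimset_lift_face// eqxx andbT phi_in.
Qed.

Lemma shriek_cochain_c : cochains_c FY p shriek.
Proof.
have [ps pf] := phiC.
have nz r : shriek r <> 0 -> exists2 s, phi s <> 0 & (f @` s) = r /\ s \in X.
  move=> nz; apply: contrapT => NE; apply: nz; rewrite /shriek_cochain fsbig1// => s [sX sr].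
  have [->|/eqP cs0] := eqVneq (phi s) 0; first by rewrite loc_homology_push0 mul0rz.
  by case: NE; exists s.
split.
  move=> r /nz[s /ps]; rewrite !unfold_in /simplices => /andP[sX sm] [<- _].
  by rewrite (card_fimset f_inj sX) sm andbT; exact: fS.
apply: sub_finite_set (finite_image (fun s : {fset V} => f @` s) pf) => r /nz[s cs0 [<- _]].
by exists s.
Qed.

Lemma lift_back a q : a \in X -> lift_face f a (back oY (f @` a) q) = back o' a q.
Proof.
move=> aX; have bs : back o' a q `<=` a by apply/fsubsetP => v; rewrite !inE => /andP[].
apply: (fimset_inj f_inj aX (lift_face_sub _ _ _) bs).
rewrite fimset_lift_face; first by rewrite (fimset_back oY fS f_inj q aX).
by apply/fsubsetP => v; rewrite !inE => /andP[].
Qed.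

(** Naturality on chains for the pulled-back orientation. Both sides are rearranged into one sum
    over the n-simplices a in T such that the front face of f a is r, with the term z' at the back
    face of a and at a. *)
Lemma push_cap q r : r \in Y -> (q <= n)%N ->
  \sum_(t <- T | (f @` t) == r) capsum o' n (fun s g => g s) q z' t =
  capsum oY n (fun s g => g s) q (coeffs shriek) r.
Proof.
move=> rY qn; rewrite capsum_eval//.
transitivity (\sum_(a <- T | (#|` a| == n.+1) && (front oY (f @` a) q == r)) z' (back o' a q) a).
  have backX a : a \in X -> #|` a| == n.+1 -> back o' a q \in X.
    move=> aX /eqP an; rewrite backE; apply: (entries_simplex aX).
      by move=> v /mem_drop; rewrite mem_vseq.
    by rewrite size_drop size_vseq an; lia.
  transitivity (\sum_(t <- T | (f @` t) == r)
      \sum_(a <- T | (#|` a| == n.+1) && (front o' a q == t)) z' (back o' a q) a).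
    rewrite big_seq_cond [RHS]big_seq_cond; apply: eq_bigr => t /andP[tT /eqP tr].
    have tX := TX tT; rewrite capsum_eval// big_mkcond [RHS]big_mkcond.
    apply: eq_big_fset_support => a.
      rewrite in_cofaces// => /andP[aX ta]; case: ifP => [/andP[an _]|_]; last by rewrite eqxx.
      move=> /(resign_neq0 (backX a aX an))[pb _ _ ba].
      exact: (Tphi (backX a aX an) pb aX ba (fsubset_refl a) (simplexP aX)).
    move=> aT; have aX := TX aT; case: ifP => [/andP[an /eqP ft] _|_]; last by rewrite eqxx.
    by rewrite in_cofaces// aX -ft; apply/fsubsetP => v; rewrite !inE => /andP[].
  rewrite (exchange_big_dep xpredT)//= [RHS]big_mkcond; apply: eq_big_seq => a aT.
  have aX := TX aT; have ftE := fimset_front oY fS f_inj q aX.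
  have [an|an] := boolP (#|` a| == n.+1); last first.
    by rewrite big1// => t; rewrite andbF.
  case: eqP => /= fr; last first.
    rewrite big1// => t /andP[/eqP tr /eqP ft]; case: fr.
    by rewrite -ftE ft.
  apply: (big_fset_only (F := fun=> z' (back o' a q) a) (x := front o' a q)).
    by move=> t _ /andP[_ /eqP->]; rewrite eqxx.
  rewrite ftE fr !eqxx /= => /(resign_neq0 (backX a aX an))[pb _ _ ba].
  rewrite andbT; apply: (Tphi (backX a aX an) pb aX ba).
    by apply/fsubsetP => v; rewrite !inE => /andP[].
  by apply: contraTneq rY => f0; rewrite -fr -ftE f0 imfset0 (simplex_neq0 Y).
transitivity (\sum_(b <- cofaces Y r | (#|` b| == n.+1) && (front oY b q == r))
    \sum_(a <- T | (f @` a) == b) z' (back o' a q) a).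
  rewrite [RHS](exchange_big_dep xpredT)//= [LHS]big_mkcond; apply: eq_big_seq => a aT.
  have aX := TX aT; have fE := card_fimset f_inj aX.
  case: ifPn => ar; last first.
    rewrite big1// => b /andP[+ /eqP fb]; rewrite -fb fE => ar'.
    by rewrite ar' in ar.
  apply/esym/(big_fset_only (F := fun=> z' (back o' a q) a) (x := f @` a)).
    by move=> b _ /andP[_ /eqP->]; rewrite eqxx.
  move=> _; have /andP[an /eqP fr] := ar; rewrite fE an fr !eqxx !andbT in_cofaces// -fr.
  apply/andP; split; first exact: fS.
  by apply/fsubsetP => v; rewrite !inE => /andP[].
rewrite big_seq_cond [RHS]big_seq_cond; apply: eq_bigr => b /andP[].
rewrite in_cofaces// => /andP[bY rb] /andP[/eqP bn /eqP br].
have bkb : back oY b q `<=` b by apply/fsubsetP => v; rewrite !inE => /andP[].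
rewrite shriek_coeffs; last first.
  rewrite backE; apply: (entries_simplex bY); first by move=> v /mem_drop; rewrite mem_vseq.
  by rewrite size_drop size_vseq bn; lia.
rewrite big_seq_cond [RHS]big_seq_cond; apply: eq_bigr => a /andP[aT /eqP ab].
by rewrite bkb -ab lift_back// TX.
Qed.

Lemma shriek_set_diff u b : u \in Y -> (1 < #|` u|)%N -> u `<=` b ->
  set_diff oY ((coeffs shriek)^~ b) u =
  \sum_(a <- T | (f @` a) == b) set_diff o' (z'^~ a) (lift_face f a u).
Proof.
move=> uY u1 ub; rewrite /set_diff.
transitivity (\sum_(i < #|` u|) \sum_(a <- T | (f @` a) == b)
   (-1) ^+ i * z' (face o' (lift_face f a u) i) a).
  apply: eq_bigr => i _; rewrite -mulr_sumr; congr (_ * _).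
  have iY : face oY u i \in Y.
    apply: (simplex_face uY (face_sub _ _ _)); apply: contraTneq u1 => f0.
    by have := card_face oY i; rewrite f0 cardfs0 => <-.
  rewrite shriek_coeffs// (fsubset_trans (face_sub _ _ _) ub).
  rewrite big_seq_cond [RHS]big_seq_cond; apply: eq_bigr => a /andP[aT /eqP ab].
  have aX := TX aT; have ua : u `<=` (f @` a) by rewrite ab.
  have lX := lift_face_simplex aX uY ua.
  congr (z' _ _); apply: (fimset_inj f_inj aX (lift_face_sub _ _ _)).
    exact: fsubset_trans (face_sub _ _ _) (lift_face_sub _ _ _).
  rewrite fimset_lift_face ?(fsubset_trans (face_sub _ _ _) ua)//.
  by rewrite (fimset_face oY fS f_inj i lX) fimset_lift_face.
rewrite exchange_big /= big_seq_cond [RHS]big_seq_cond; apply: eq_bigr => a /andP[aT /eqP ab].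
have aX := TX aT; have ua : u `<=` (f @` a) by rewrite ab.
have lX := lift_face_simplex aX uY ua.
by rewrite -(card_fimset f_inj lX) fimset_lift_face.
Qed.

End OneCochain.

Lemma set_diff_resign (o1 o2 : orientation X) z r a : r \in X ->
  set_diff o2 ((resign o1 o2 z)^~ a) r =
  rsign o1 o2 r * rsign o1 o2 a * set_diff o1 (z^~ a) r.
Proof.
move=> rX; rewrite !set_diffE mulr_sumr; apply: eq_big_seq => s; rewrite fpowersetE => sr.
rewrite /resign; have := rsign_incid o1 o2 s rX.
have := rsign_sqr o1 o2 rX; have := rsign_face_sqr o1 o2 rX sr.
set e := rsign _ _ r; set e' := rsign _ _ s; set i := incid _ _ _; set j := incid _ _ _.
move=> e'e' ee E; transitivity (e' * rsign o1 o2 a * z s a * (e * (e * j))).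
  by rewrite [e * (e * j)]mulrA ee mul1r.
by rewrite -E -[RHS]mul1r -e'e'; ring.
Qed.

Lemma shriek_cocycle p (phi : dfun FX) : cocycles_c oX FX p phi ->
  cocycles_c oY FY p (shriek_cochain oY f phi).
Proof.
move=> [phiC phi0]; split; first exact: shriek_cochain_c.
have [T [TX Tphi]] := cochain_faces phiC.
apply: functional_extensionality_dep => u.
have [uY|uY] := boolP (u \in Y); last by rewrite /= /sheaf_diff (negPf uY).
rewrite -[LHS]hreprK (_ : hrepr _ = 0) ?hclass0//.
apply: functional_extensionality_dep => b.
pose psi := shriek_cochain oY f phi : dfun FY.
rewrite -[LHS]/(coeffs (sheaf_diff oY psi) u b).
have [u1|u1] := ltnP 1 #|` u|; last first.
  rewrite /coeffs /loc_coeff /sheaf_diff uY big1 ?hrepr0//; first exact: loc_boundaries0.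
  move=> i iY; have := card_face oY i => ci.
  by move: iY; rewrite (_ : face _ _ _ = fset0) ?(negPf (simplex_neq0 Y))//; apply/eqP;
    rewrite -cardfs_eq0; lia.
apply/eqP/contraT => nz.
have [_ _ ub] := (loc_coeffP _ uY).1 b nz; move: nz.
rewrite -coeffs_diff// (shriek_set_diff TX Tphi)// big_seq_cond big1 ?eqxx// => a /andP[aT /eqP ab].
have aX := TX a aT; have ua : u `<=` (f @` a) by rewrite ab.
have lX := lift_face_simplex aX uY ua.
rewrite set_diff_resign// coeffs_diff//; last exact: lift_face_sub.
  rewrite /coeffs /loc_coeff [sheaf_diff oX phi]phi0 hrepr0 ?mulr0//.
  exact: loc_boundaries0.
by rewrite -(card_fimset f_inj lX) fimset_lift_face.
Qed.





End ShriekCochains.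

Section SheafNaturality.
Variables (V W : choiceType) (X : lf_complex V) (Y : lf_complex W).
Variables (oX : orientation X) (oY : orientation Y) (f : V -> W) (n : nat).
Hypothesis fS : simplicial X Y f.
Hypothesis f_inj : forall s, s \in X -> {in s &, injective f}.
Hypothesis dimX : forall r, r \in X -> (#|` r| <= n.+1)%N.
Hypothesis dimY : forall r, r \in Y -> (#|` r| <= n.+1)%N.
Notation o' := (pulled_orientation oY fS f_inj).
Notation eps := (rsign oX o').
Notation FX := (loc_homology_sheaf oX n).
Notation FY := (loc_homology_sheaf oY n).

Lemma cap_sheafE (U : choiceType) (Z : lf_complex U) (o : orientation Z) p
    (h : cohomology_c o (loc_homology_sheaf o n) p) :
  (forall r, r \in Z -> (#|` r| <= n.+1)%N) ->
  cap_sheaf (fundamental_class o n) h =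
  hclass _ _ (cap_chain o n (fun s g => g s) (n - p) (coeffs (hrepr h))).
Proof.
move=> dimZ; rewrite /cap_sheaf; congr (hclass _ _ _).
by apply: functional_extensionality_dep => t; rewrite cap_sheaf_chainE.
Qed.

(** Above the dimension there are no simplices to carry the cochain. The case is separate because
    the degree n - p of the product is truncated there. *)
Lemma cap_chain_high (U : choiceType) (Z : lf_complex U) (o : orientation Z) p q
    (phi : dfun (loc_homology_sheaf o n)) :
  (forall r, r \in Z -> (#|` r| <= n.+1)%N) -> (n < p)%N -> (q <= n)%N ->
  cochains_c (loc_homology_sheaf o n) p.+1 phi ->
  cap_chain o n (fun s g => g s) q (coeffs phi) = 0.
Proof.
move=> dimZ np qn [ps _]; apply: functional_extensionality_dep => t; rewrite /cap_chain.
case: ifP => // tZ; apply: (capsum0 o (local_eval U)) => //; first by rewrite addn0 ltnS.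
move=> r a _ _ _ _; apply/eqP/contraT => /eqP /(coeffs_neq0 dimZ)/ps.
by rewrite unfold_in /simplices => /andP[/dimZ rn /eqP rp]; move: rn; rewrite rp ltnS leqNgt np.
Qed.

(** The factor [eps t] cancels the sign that the push-forward puts on t, which leaves the sign-free
    comparison [push_cap]. *)
Lemma push_resigned p q (phi : dfun FX) : (q <= n)%N -> cochains_c FX p phi ->
  push_chain oX oY f (fun t => eps t * cap_chain o' n (fun s g => g s) q (resign oX o' (coeffs
    phi)) t)
  = cap_chain oY n (fun s g => g s) q (coeffs (shriek_cochain oY f phi : dfun FY)).
Proof.
move=> qn phiC; have [T [TX Tphi]] := cochain_faces phiC.
apply: functional_extensionality_dep => r; rewrite [RHS]/cap_chain.
have [rY|rY] := boolP (r \in Y); last first.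
  by rewrite /push_chain fsbig1// => s [sX sr]; move: rY; rewrite -sr (fS sX).
rewrite -(push_cap oY fS f_inj dimX dimY TX Tphi rY qn) (push_chainE oX oY fS f_inj r TX).
  rewrite big_seq_cond [RHS]big_seq_cond; apply: eq_bigr => t /andP[/TX tX _].
  by rewrite mulrA rsign_sqr// mul1r /cap_chain tX.
move=> t tX nz; rewrite /cap_chain tX in nz.
have {nz} : capsum o' n (fun s g => g s) q (resign oX o' (coeffs phi)) t != 0.
  by apply: contra_notN nz => /eqP->; rewrite mulr0.
move=> /(capsum_neq0 (local_eval V) tX)[|_ [s [a [+ ta sX]]]]; first by rewrite addn0 ltnS.
rewrite in_cofaces// => /andP[aX sa] /(resign_neq0 dimX sX)[ps _ _ _].
exact: (Tphi s a t sX ps aX sa ta (simplexP tX)).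
Qed.

Lemma cap_sheaf_natural p (h : cohomology_c oX FX p) :
  homology_push oX oY f (cap_sheaf (fundamental_class oX n) h) =
  cap_sheaf (fundamental_class oY n) (cohomology_shriek oX oY f h).
Proof.
rewrite !cap_sheafE//; set phi := hrepr h; set psi := hrepr (cohomology_shriek _ _ _ _).
have phiZ : cocycles_c oX FX p phi by exact: hreprP.
have psiZ : cocycles_c oY FY p psi by exact: hreprP.
have [pn|np] := leqP p n; last first.
  have [[phiC _] [psiC _]] := (phiZ, psiZ).
  have q0 : (n - p <= n)%N by rewrite leq_subr.
  rewrite !(cap_chain_high _ np q0)// homology_pushE//; last exact: sg_set0.
  congr (hclass _ _ _); apply: functional_extensionality_dep => r.
  by rewrite /push_chain fsbig1// => s _; rewrite mulr0.
move: (n - p)%N (subnKC pn) => q pq.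
have cZ := cap_chain_cycle dimX pq phiZ.
rewrite homology_pushE//.
pose sh := shriek_cochain oY f phi : dfun FY.
have shZ : cocycles_c oY FY p sh by exact: (shriek_cocycle oY fS f_inj dimX dimY phiZ).
apply/hclass_eq; first exact: (push_chain_cycles oY fS f_inj cZ).
  exact: (cap_chain_cycle dimY pq psiZ).
have capB (a b : dfun FY) : cap_chain oY n (fun s g => g s) q (coeffs (a - b)) =
    cap_chain oY n (fun s g => g s) q (coeffs a) - cap_chain oY n (fun s g => g s) q (coeffs b).
  apply: functional_extensionality_dep => t; rewrite dfunB /cap_chain; case: ifP => // tY.
  rewrite !capsum_eval// -sumrB; apply: eq_bigr => c _.
  rewrite /coeffs /loc_coeff dfunB hreprB//; exact: loc_boundaries0.
have E1 : boundaries oY (constant_cosheaf Y) q (cap_chain oY n (fun s g => g s) q (coeffs psi) -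
     cap_chain oY n (fun s g => g s) q (coeffs sh)).
  rewrite -capB; apply: (cap_chain_boundary dimY pq).
  exact: (hclass_repr _ shZ).
set A := push_chain _ _ _ _; set B := cap_chain _ _ _ _ (coeffs psi).
(* C is the product with the explicit representative [sh] of f_! h. Then B - C is a product with a
   coboundary, and A - C is the push-forward of the boundary that changes [oX] into the pulled-back
   orientation. *)
pose C := cap_chain oY n (fun s g => g s) q (coeffs sh).
rewrite (_ : A - B = (A - C) - (B - C)); last by rewrite opprB addrA subrK.
apply: sg_setB => //.
pose htp := htpy (fun s => vseq o' (entries s)) (osgn o').
pose b := cap_chain oX n htp q.+1 (coeffs phi).
have bC : chains (constant_cosheaf X) q.+2 b by exact: (cap_chain_htpy_chains dimX o' pq phiZ).
exists (push_chain oX oY f b); first exact: (push_chain_chains oX oY fS f_inj bC).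
rewrite [LHS](push_chain_diff oX oY fS f_inj (fin_chainW bC)).
pose e : dfun (constant_cosheaf X) := fun t => eps t * cap_chain o' n (fun s g => g s) q (resign
  oX o' (coeffs phi)) t.
have qn : (q <= n)%N by rewrite -pq leq_addl.
have phiC : cochains_c FX p.+1 phi by case: phiZ.
rewrite /C -(push_resigned qn phiC) -push_chainB//.
- congr push_chain; apply: functional_extensionality_dep => t; rewrite dfunB.
  have [tX|tX] := boolP (t \in X); last first.
    by rewrite /cosheaf_diff /cap_chain (negPf tX) mulr0 subrr.
  by rewrite (cap_chain_reorient dimX o' pq phiZ tX) /cap_chain tX.
- by case: cZ => cC _; exact: fin_chainW cC.
have [_ pf] := phiC.
have eC : chains (constant_cosheaf X) q.+1 (cap_chain o' n (fun s g => g s) q (resign oX o'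
  (coeffs phi))).
  apply: (cap_chain_chains o' (local_eval V) _ pf); first by rewrite addn0 ltnS.
  move=> r a nz; apply: (coeffs_neq0 dimX (a := a)) => c0; apply: nz.
  by rewrite /resign c0 mulr0.
have [ef eX] := fin_chainW eC; split.
  by apply: sub_finite_set ef => t /= nz c0; apply: nz; rewrite c0 mulr0.
by move=> t nz; apply: eX => c0; apply: nz; rewrite c0 mulr0.
Qed.

End SheafNaturality.

(** * Naturality for constant coefficients *)

Section ConstantCaps.
Variables (V : choiceType) (X : lf_complex V) (o : orientation X) (n : nat).
Hypothesis dimX : forall r, r \in X -> (#|` r| <= n.+1)%N.
Notation G := (loc_cohomology_cosheaf o n).
Notation eval := (fun (s : seq V) (g : seq V -> int) => g s).
Notation class t := (hclass (loc_cocycles o t n) (loc_coboundaries o t n)).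

Definition top_cochain H (g : seq V -> int) : loc_fun V :=
  fun a => if (a \in X) && (#|` a| == n.+1) then H (vseq o a) g else 0.

(** The counterpart of [capsum] for constant coefficients: the values at the n-simplices a are not
    added up but form a cochain, whose class in h^n(t) is the coefficient at t. For the evaluation
    it is the product with the fundamental class, by [cap_const_chainE]. *)
Definition cup_class H q (z : {fset V} -> int) : dfun G :=
  @class_chain V X o n (fun t => top_cochain H (cup_front o q t z)).

Section Functional.
Variables (d : nat) (H : seq V -> (seq V -> int) -> int).
Hypothesis Hl : local_functional d H.

Lemma top_cochain_cocycle q t z : (q < n.+1 + d)%N ->
  loc_cocycles o t n (top_cochain H (cup_front o q t z)).
Proof.
move=> qn; apply: (loc_cocyclesP o dimX) => a; rewrite /top_cochain.
case: ifP => // /andP[aX /eqP an] /eqP/(functional_neq0 Hl aX)[]; first by rewrite an.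
by [].
Qed.

Lemma cup_class_neq0 q t z : (q < n.+1 + d)%N -> cup_class H q z t <> 0 ->
  [/\ t \in X, #|` t| = q.+1 & exists r a, [/\ z r <> 0, a \in cofaces X r & t `<=` a]].
Proof.
move=> qn nz; apply: contrapT => NE; apply: nz; rewrite /cup_class /class_chain.
rewrite (_ : top_cochain _ _ = 0) ?hclass0//; apply: functional_extensionality_dep => a.
rewrite /top_cochain; case: ifP => // /andP[aX /eqP an]; apply/eqP/contraT => nz.
have [|tX tq ta [r [rX ra zr]]] := functional_neq0 Hl aX _ nz; first by rewrite an.
case: NE; split => //; exists r, a; split => //; first exact/eqP.
by rewrite in_cofaces// aX.
Qed.

Lemma cup_class_chains q z : (q < n.+1 + d)%N -> finite_set [set r | z r <> 0] ->
  chains G q.+1 (cup_class H q z).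
Proof.
move=> qn zf; split.
  by move=> t /(cup_class_neq0 qn)[tX tq _]; rewrite unfold_in /simplices tX tq eqxx.
by apply: sub_finite_set (finite_faces_cofaces X zf) => t /(cup_class_neq0 qn)[].
Qed.

(** Dual to [capsum_cycle]: the sum over the facets of a is the value at a of the coboundary of b ↦
    H(b) on (n-1)-simplices. Locality makes the latter a relative cochain, supported on simplices
    containing t. *)
Lemma functional_coboundary q t z : t \in X -> (q < n + d)%N ->
  loc_coboundaries o t n (top_cochain (fun s g => sdiff (fun w => H w g) s) (cup_front o q t z)).
Proof.
move=> tX qn; pose c : loc_fun V :=
  fun b => if (b \in X) && (#|` b| == n) then H (vseq o b) (cup_front o q t z) else 0.
exists c.
  move=> b; rewrite /c; case: ifP => // /andP[bX /eqP bn] /eqP/(functional_neq0 Hl bX)[].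
    by rewrite bn.
  by rewrite unfold_in /star_simplices /simplices bX bn eqxx => _ _ ->.
apply: functional_extensionality_dep => a; rewrite /= /loc_cobd /top_cochain.
case: ifP => // aX /=; case: eqP => an; last first.
  rewrite big1// => i _; rewrite /c; case: ifP => [/andP[_ /eqP fn]|]; last by rewrite mul0rz.
  by case: an; rewrite -(card_face o i) fn.
rewrite (eq_sdiff (h := fun w => H (vseq o (entries w)) (cup_front o q t z))); last first.
  by move=> w ws _; rewrite (subseq_vseq aX (fsubset_refl _) ws).1.
rewrite (sdiff_faces o (fun r => H (vseq o r) (cup_front o q t z))).
apply: eq_bigr => i _; rewrite mulrC -mulrzr intz /c; congr (_ * _).
have cf := card_face o i; have fn : #|` face o a i| = n by lia.
rewrite fn eqxx andbT; case: ifPn => // fX.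
have f0 : face o a i = fset0.
  by apply/eqP; apply: contraNT fX => f0; exact: simplex_face aX (face_sub o a i) f0.
(* An empty face means n = 0 and leaves only the empty word, so d = 0, against q < n + d. *)
apply/esym/eqP/contraT => nz; exfalso.
have [[|v u] [us su un]] := lf_neq0 Hl (uniq_vseq _ _) nz; last first.
  by have := us v (mem_head _ _); rewrite mem_vseq f0 inE.
by move: fn su; rewrite size_vseq /= f0 cardfs0; lia.
Qed.

Lemma top_cochain_sum q t z : t \in X -> (q.+1 < n.+1 + d)%N ->
  \sum_(s <- cofaces X t) top_cochain H (cup_front o q.+1 s z) *~ incid o s t =
  top_cochain (fun s g => H s (sdiff g)) (cup_front o q t z) -
  top_cochain H (cup_front o q t (set_diff o z)) *~ (-1) ^+ q.
Proof.
move=> tX qn; apply: functional_extensionality_dep => a.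
have [/andP[aX /eqP an]|na] := boolP ((a \in X) && (#|` a| == n.+1)); last first.
  rewrite dfunB dfun_MzE dfun_sumE /top_cochain (negPf na) big1 ?mul0rz ?subr0// => s _.
  by rewrite dfun_MzE (negPf na) mul0rz.
rewrite dfunB dfun_MzE dfun_sumE /top_cochain aX an eqxx /= -mulrzr intz [in RHS]mulrC.
rewrite (functional_cup o Hl z aX tX) ?an// addrK.
by apply: eq_bigr => s _; rewrite dfun_MzE aX an eqxx /= -mulrzr intz mulrC.
Qed.

Lemma top_cochain_Mz_cocycle q t z (m : int) : (q < n.+1 + d)%N ->
  loc_cocycles o t n (top_cochain H (cup_front o q t z) *~ m).
Proof.
move=> qn; have := @sg_sum _ (loc_cocycles o t n) unit [:: tt]
  (fun=> top_cochain H (cup_front o q t z)) (fun=> m).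
by rewrite big_seq1; apply => _ _; exact: top_cochain_cocycle.
Qed.

Lemma top_cochain_sdiff_cocycle q t z : t \in X -> (q.+1 < n.+1 + d)%N ->
  loc_cocycles o t n (top_cochain (fun s g => H s (sdiff g)) (cup_front o q t z)).
Proof.
move=> tX qn; have qn' : (q < n.+1 + d)%N by exact: ltn_trans qn.
have /eqP := top_cochain_sum z tX qn; rewrite eq_sym subr_eq => /eqP ->.
apply: sgD; last exact: top_cochain_Mz_cocycle.
apply: sg_sum => s; rewrite in_cofaces// => /andP[sX ts].
by apply: loc_cocycles_sub ts _; exact: top_cochain_cocycle.
Qed.

Lemma cup_class_diff q z t : t \in X -> (q.+1 < n.+1 + d)%N ->
  cosheaf_diff o (cup_class H q.+1 z) t =
  class t (top_cochain (fun s g => H s (sdiff g)) (cup_front o q t z)) -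
  cup_class H q (set_diff o z) t *~ (-1) ^+ q.
Proof.
move=> tX qn; have qn' : (q < n.+1 + d)%N by exact: ltn_trans qn.
rewrite /cup_class class_diffE//; last by move=> s _; exact: top_cochain_cocycle.
rewrite top_cochain_sum// hclassB ?hclassMz//; first exact: top_cochain_cocycle.
  exact: top_cochain_sdiff_cocycle.
exact: top_cochain_Mz_cocycle.
Qed.

Lemma cup_class_eq q z z' t : t \in X -> (q < n.+1 + d)%N ->
  (forall r, r \in X -> #|` r| = (n.+1 + d - q)%N -> z r = z' r) ->
  cup_class H q z t = cup_class H q z' t.
Proof.
move=> tX qn zz; congr (class t _); apply: functional_extensionality_dep => a.
rewrite /top_cochain; case: ifP => // /andP[aX /eqP an].
apply: (lf_local Hl (uniq_vseq _ _)) => u ua su.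
have {}ua : {subset u <= a} by move=> v /ua; rewrite mem_vseq.
have da : {subset drop q u <= a} by move=> v /mem_drop /ua.
rewrite size_vseq an in su.
rewrite /cup_front; congr (_ * _); have := osgn_uniq o aX da.
case: ifP => [ud _|_ ->]; last by rewrite !mul0r.
rewrite zz ?card_entries ?size_drop ?su//.
by apply: entries_simplex aX da _; rewrite size_drop su subn_gt0.
Qed.

Lemma cup_class0 q z t : t \in X -> (q < n.+1 + d)%N ->
  (forall r, r \in X -> #|` r| = (n.+1 + d - q)%N -> z r = 0) ->
  cup_class H q z t = 0.
Proof.
move=> tX qn z0; rewrite (@cup_class_eq q z (fun=> 0))//.
by apply: contrapT => /(cup_class_neq0 qn)[_ _ [r [a [/(_ erefl)]]]].
Qed.

Lemma cup_class_comb q z z' (m m' : int) t : (q < n.+1 + d)%N ->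
  cup_class H q (fun r => m * z r + m' * z' r) t =
  cup_class H q z t *~ m + cup_class H q z' t *~ m'.
Proof.
move=> qn; rewrite /cup_class /class_chain -!hclassMz; try exact: top_cochain_cocycle.
rewrite -hclassD; try exact: top_cochain_Mz_cocycle.
congr (class t _); apply: functional_extensionality_dep => a.
rewrite dfunD !dfun_MzE /top_cochain; case: ifP => _; last by rewrite !mul0rz addr0.
have zE (x k : int) : x *~ k = k * x by rewrite -mulrzr intz mulrC.
rewrite !zE -(lfD Hl).
by congr (H _); apply: funext => u; rewrite /cup_front; ring.
Qed.

End Functional.

Lemma cap_const_chainE l (psi : dfun (constant_sheaf X)) : 
  cap_const_chain n l (hrepr (fundamental_class o n)) psi = cup_class eval (n - l) psi.
Proof.
apply: functional_extensionality_dep => t; rewrite /cap_const_chain.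
have [tX|tX] := boolP (t \in X); last first.
  apply/esym; apply: contrapT => /(cup_class_neq0 (local_eval V))[].
    by rewrite addn0 ltnS leq_subr.
  by rewrite (negPf tX).
rewrite fundamental_classE// /cup_class /class_chain.
rewrite (_ : top_cochain _ _ = \sum_(s <- cofaces X t) top_dirac X n s *~
   (if (#|` s| == n.+1) && (front o s (n - l) == t) then psi (back o s (n - l)) else 0)).
  rewrite hclass_sum.
    rewrite big_mkcond; apply: eq_big_seq => s; rewrite in_cofaces// => /andP[sX ts].
    case: ifP => _; last by rewrite mulr0z.
    by congr (_ *~ _); apply: (loc_cohomology_mapE ts); exact: top_dirac_cocycle.
  move=> s; rewrite in_cofaces// => /andP[sX ts].
  by apply: loc_cocycles_sub ts _; exact: top_dirac_cocycle.
apply: functional_extensionality_dep => a; rewrite dfun_sumE.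
pose c s := if (#|` s| == n.+1) && (front o s (n - l) == t) then psi (back o s (n - l)) else 0.
have [/andP[aX /eqP an]|na] := boolP ((a \in X) && (#|` a| == n.+1)); last first.
  rewrite /top_cochain (negPf na) big1// => s _; rewrite dfun_MzE /top_dirac.
  case: ifP => [sn|_]; last by rewrite mul0rz.
  by rewrite /dirac; case: eqP => [as_|_];
    [rewrite -as_ /simplices (negPf na) in sn|rewrite mul0rz].
have sub w : subseq w (vseq o a) -> osgn o w = 1 by move=> wa; rewrite (subseq_vseq aX _ wa).2.
transitivity (if front o a (n - l) == t then psi (back o a (n - l)) else 0).
  rewrite /top_cochain aX an eqxx /= /cup_front frontE backE.
  rewrite !sub ?take_subseq ?drop_subseq// !mul1r.
  by case: eqP => _; rewrite ?mul0r ?mul1r.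
apply/esym; transitivity (\sum_(s <- cofaces X t) if s == a then c a else 0).
  apply: eq_bigr => s _; rewrite dfun_MzE /top_dirac /dirac; case: (eqVneq s a) => [->|sa].
    have aT : simplices X n.+1 a by rewrite /simplices aX an eqxx.
    by rewrite aT /= eqxx -mulrzr intz mul1r.
  by case: ifP => _; rewrite ?mul0rz//= eq_sym (negPf sa) mul0rz.
rewrite -big_mkcond (big_fset_only (F := fun=> c a) (x := a)).
- by rewrite /c an eqxx.
- by move=> s _ /eqP->; rewrite eqxx.
rewrite /c an !eqxx /= andbT; case: ifP => [/eqP ft _|_ /eqP]; last by [].
by rewrite in_cofaces// aX -ft; apply/fsubsetP => v; rewrite !inE => /andP[].
Qed.

Lemma constant_sheaf_diffE (psi : dfun (constant_sheaf X)) r : r \in X -> (1 < #|` r|)%N ->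
  sheaf_diff o psi r = set_diff o psi r.
Proof.
move=> rX r1; rewrite /sheaf_diff rX /set_diff (eq_bigl xpredT) => [|i].
  by apply: eq_bigr => i _; rewrite mulrC -mulrzr intz.
apply: (simplex_face rX (face_sub _ _ _)); apply: contraTneq r1 => f0.
by have := card_face o i; rewrite f0 cardfs0 => <-.
Qed.

(** For the evaluation, the term with H applied to a coboundary is itself the facet term, hence zero
    in h^n(t). *)
Lemma eval_class_diff q z t : t \in X -> (q < n)%N ->
  cosheaf_diff o (cup_class eval q.+1 z) t =
  - (cup_class eval q (set_diff o z) t *~ (-1) ^+ q).
Proof.
move=> tX qn; rewrite (cup_class_diff (local_eval V)) ?addn0//.
rewrite hclass_eq0 ?add0r//.
  by apply: (top_cochain_sdiff_cocycle (local_eval V)); rewrite ?addn0.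
by apply: (functional_coboundary (local_eval V)); rewrite ?addn0.
Qed.

Lemma cup_class_cycle (psi : dfun (constant_sheaf X)) p q : (p + q)%N = n ->
  cocycles_c o (constant_sheaf X) p psi -> cycles o G q (cup_class eval q psi).
Proof.
move=> pq [[_ pf] p0]; split; first by apply: (cup_class_chains (local_eval V) _ pf); lia.
apply: functional_extensionality_dep => t.
have [tX|tX] := boolP (t \in X); last by rewrite /= /cosheaf_diff (negPf tX).
case: q pq => [|q] pq.
  rewrite /= /cosheaf_diff tX big_seq big1// => s; rewrite in_cofaces// => /andP[sX ts].
  have [->|/incid_sub[_ st]] := eqVneq (incid o s t) 0; first by rewrite mulr0z.
  rewrite (_ : cmap _ _ = 0) ?mul0rz//.
  have [cs|/eqP] := eqVneq (cup_class eval 0 psi s) 0; last first.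
    move=> /(cup_class_neq0 (local_eval V))[|_ s1 _]; first by rewrite addn0.
    by move: tX; rewrite (_ : t = fset0) ?(negPf (simplex_neq0 X))//; apply/eqP;
      rewrite -cardfs_eq0; lia.
  by rewrite cs; have := cmapB (c := G) sX tX ts 0 0; rewrite !subrr.
rewrite [LHS](eval_class_diff psi tX); last by lia.
rewrite (cup_class0 (local_eval V)) ?mul0rz ?oppr0 ?addn0//; first by lia.
move=> r rX rq; rewrite -constant_sheaf_diffE//; last by lia.
by rewrite [sheaf_diff o psi]p0.
Qed.

Lemma cup_class_boundary (psi : dfun (constant_sheaf X)) p q : (p + q)%N = n ->
  coboundaries_c o (constant_sheaf X) p psi -> boundaries o G q (cup_class eval q psi).
Proof.
move=> pq [x [xs xf] <-].
have [p0|p0] := posnP p.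
  rewrite (_ : cup_class _ _ _ = 0); first exact: sg_set0.
  apply: functional_extensionality_dep => t; apply: contrapT.
  move=> /(cup_class_neq0 (local_eval V))[|_ _ [r [a [nz _ _]]]]; first by rewrite addn0; lia.
  apply: nz; rewrite (_ : x = 0) ?raddf0//.
  apply: functional_extensionality_dep => s; apply: contrapT => /xs.
  rewrite unfold_in /simplices p0 => /andP[sX]; rewrite cardfs_eq0 => /eqP s0.
  by move: sX; rewrite s0 (negPf (simplex_neq0 X)).
(* The sign cancels the one in [eval_class_diff]; the summand [0 * x r] gives the cochain the
   two-term shape of [cup_class_comb]. *)
exists (cup_class eval q.+1 (fun r => (-1) ^+ q.+1 * x r + 0 * x r)).
  apply: (cup_class_chains (local_eval V)); first by lia.
  by apply: sub_finite_set xf => r /= nz x0; apply: nz; rewrite x0 !mulr0 addr0.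
apply: functional_extensionality_dep => t.
have [tX|tX] := boolP (t \in X); last first.
  rewrite /= /cosheaf_diff (negPf tX); apply/esym; apply: contrapT.
  move=> /(cup_class_neq0 (local_eval V))[]; first by rewrite addn0; lia.
  by rewrite (negPf tX).
rewrite [LHS](eval_class_diff _ tX); last by lia.
rewrite (cup_class_eq (local_eval V) (z' := fun r => (-1) ^+ q.+1 * set_diff o x r + 0 * x r))
  ?addn0//; last 2 first.
- by lia.
- move=> r rX rq; rewrite /set_diff mul0r addr0 mulr_sumr; apply: eq_bigr => i _.
  by rewrite mul0r addr0 mulrCA.
rewrite (cup_class_comb (local_eval V)) ?addn0; last by lia.
rewrite mulr0z addr0 -mulrzA -mulrNz.
rewrite (_ : - ((-1) ^+ q.+1 * (-1) ^+ q) = 1 :> int) ?mulr1z;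
  last by rewrite exprS mulN1r mulNr opprK -expr2 sqrr_sign.
apply: (cup_class_eq (local_eval V)); rewrite ?addn0//; first by lia.
by move=> r rX rq; rewrite -constant_sheaf_diffE//; lia.
Qed.

Section Reoriented.
Variable o' : orientation X.
Notation htp := (htpy (fun s => vseq o' (entries s)) (osgn o')).

Lemma cup_class_reorient (psi : dfun (constant_sheaf X)) p q t : (p + q)%N = n ->
  cocycles_c o (constant_sheaf X) p psi -> t \in X ->
  cosheaf_diff o (cup_class htp q.+1 psi) t =
  cup_class eval q psi t -
  class t (top_cochain (fun s g => rsign o o' (entries s) * g (vseq o' (entries s))) (cup_front o
    q t psi)).
Proof.
move=> pq [_ p0] tX; have Hl := local_htpy o'.
rewrite (cup_class_diff Hl) ?addn1//; last by lia.
rewrite (cup_class0 Hl) ?mul0rz ?subr0 ?addn1//; last 2 first.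
- by lia.
- move=> r rX rq; rewrite -constant_sheaf_diffE//; last by lia.
  by rewrite [sheaf_diff o psi]p0.
pose A := top_cochain (fun s g => htp s (sdiff g)) (cup_front o q t psi).
pose R := top_cochain (fun s g => rsign o o' (entries s) * g (vseq o' (entries s)))
  (cup_front o q t psi).
pose E := top_cochain eval (cup_front o q t psi).
have AE : A = E - R - top_cochain (fun s g => sdiff (fun w => htp w g) s) (cup_front o q t psi).
  apply: functional_extensionality_dep => a; rewrite !dfunB /A /E /R /top_cochain.
  case: ifP => [/andP[aX _]|_]; last by rewrite !subr0.
  have := @sdiff_htpy _ (fun s => vseq o' (entries s)) (osgn o') _ [in a] erefl _
     (vseq o a) (cup_front o q t psi).
  rewrite vseqK => <-; rewrite ?addrK//.
  - by move=> s v; rewrite mem_vseq in_entries.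
  - by move=> s g /allP sa; apply: (sdiff_osgn _ aX).
  - by apply/allP => v; rewrite mem_vseq.
have AZ : loc_cocycles o t n A.
  by apply: (top_cochain_sdiff_cocycle Hl) => //; rewrite addn1; lia.
have EZ : loc_cocycles o t n E by apply: (top_cochain_cocycle (local_eval V)); rewrite addn0; lia.
have RZ : loc_cocycles o t n R.
  apply: (loc_cocyclesP o dimX) => a; rewrite /R /top_cochain.
  case: ifP => // /andP[aX /eqP an] /eqP; rewrite mulf_eq0 negb_or => /andP[_ nz].
  rewrite vseqK in nz; have [||_ _ +] := cup_front_card aX _ _ nz.
  - by move=> v; rewrite mem_vseq.
  - by rewrite size_vseq an; lia.
  - by rewrite vseqK.
rewrite -[LHS]/(class t A) -[RHS]/(class t E - class t R).
(* By [AE] the difference E - R - A is the facet term of the homotopy formula, a coboundary. *)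
rewrite -[class t A]addr0 -(hclass_eq0 (x := E - R - A)).
- by rewrite hclassB ?hclassB//; [rewrite addrC subrK|exact: sg_setB].
- by apply: sg_setB => //; exact: sg_setB.
rewrite AE subKr; apply: (functional_coboundary Hl) => //; lia.
Qed.

End Reoriented.

End ConstantCaps.

(** * The map f^! on chains with coefficients in local cohomology *)

Section ShriekChains.
Variables (V W : choiceType) (X : lf_complex V) (Y : lf_complex W).
Variables (oX : orientation X) (oY : orientation Y) (f : V -> W) (n : nat).
Hypothesis fS : simplicial X Y f.
Hypothesis f_inj : forall s, s \in X -> {in s &, injective f}.
Hypothesis dimX : forall r, r \in X -> (#|` r| <= n.+1)%N.
Hypothesis dimY : forall r, r \in Y -> (#|` r| <= n.+1)%N.
Notation o' := (pulled_orientation oY fS f_inj).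
Notation eps := (rsign oX o').
Notation GX := (loc_cohomology_cosheaf oX n).
Notation GY := (loc_cohomology_cosheaf oY n).
Notation classX t := (hclass (loc_cocycles oX t n) (loc_coboundaries oX t n)).
Notation classY t := (hclass (loc_cocycles oY t n) (loc_coboundaries oY t n)).

Lemma loc_pullB t : zmod_morphism (loc_pull oX oY f t).
Proof.
move=> c d; apply: functional_extensionality_dep => b; rewrite dfunB /loc_pull.
by case: ifP => _; rewrite ?subr0// dfunB mulrBr.
Qed.

Lemma loc_pull_cocycle t c : loc_cocycles oY (f @` t) n c ->
  loc_cocycles oX t n (loc_pull oX oY f t c).
Proof.
move=> [cs _]; apply: (loc_cocyclesP oX dimX) => a; rewrite /loc_pull.
case: ifP => // /andP[aX ta] /eqP; rewrite mulf_eq0 negb_or => /andP[_ /eqP/cs].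
rewrite unfold_in /star_simplices /simplices (card_fimset f_inj aX) => /andP[/andP[_ /eqP an] _].
by [].
Qed.

Lemma loc_pull_coboundary t c : t \in X -> loc_coboundaries oY (f @` t) n c ->
  loc_coboundaries oX t n (loc_pull oX oY f t c).
Proof.
move=> tX [b bs <-]; exists (loc_pull oX oY f t b).
  move=> a; rewrite /loc_pull; case: ifP => // /andP[aX ta] /eqP.
  rewrite mulf_eq0 negb_or => /andP[_ /eqP/bs].
  by rewrite !unfold_in /star_simplices /simplices (card_fimset f_inj aX) aX ta => /andP[/andP[_
    ->]].
(* The pull-back of b without signs. It commutes with the coboundary formed with the pulled-back
   orientation, and [rsign_incid] moves the signs from the faces of a to a. *)
pose y : loc_fun V := fun a => if (a \in X) && (t `<=` a) then b (f @` a) else 0.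
have yt a : y a <> 0 -> t `<=` a by rewrite /y; case: ifP => // /andP[].
apply: functional_extensionality_dep => a /=.
have [aX|aX] := boolP (a \in X); last by rewrite /loc_cobd /loc_pull (negPf aX).
rewrite (loc_cobdE oX tX aX); last by move=> s; rewrite /loc_pull; case: ifP => // /andP[].
transitivity (eps a * loc_cobd o' y a).
  rewrite (loc_cobdE o' tX aX yt) mulr_sumr; apply: eq_big_seq => s.
  rewrite in_cofaces// => /andP[sX ts]; rewrite /loc_pull /y sX ts /= (osignE oX oY fS f_inj sX).
  have := rsign_incid oX o' s aX; set e := rsign _ _ s; set e' := rsign _ _ a => E.
  rewrite (_ : e * _ * _ = b (f @` s) * (incid oX a s * e)); last by ring.
  by rewrite E; ring.
rewrite /loc_cobd /loc_pull aX (fS aX) /=; case: ifPn => ta; last first.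
  rewrite big1 ?mulr0// => i _; rewrite /y; case: ifP => [/andP[_ tf]|_]; last by rewrite mul0rz.
  by rewrite (fsubset_trans tf (face_sub _ _ _)) in ta.
rewrite (osignE oX oY fS f_inj aX); congr (_ * _).
rewrite (card_fimset f_inj aX); apply: eq_bigr => i _; congr (_ *~ _).
rewrite /y -(fimset_face oY fS f_inj i aX); case: ifPn => // nf.
apply/esym; apply: contrapT => /bs; rewrite unfold_in => /andP[_ tf].
have tf' := fimset_subK f_inj aX ta (face_sub o' a i) tf.
move: nf; rewrite tf' andbT (simplex_face aX (face_sub _ _ _))//.
by apply: contraTneq tf' => ->; rewrite fsubset0; exact: (simplexP tX).
Qed.

Lemma loc_cohomology_pullE t c : t \in X -> loc_cocycles oY (f @` t) n c ->
  loc_cohomology_pull oX f t (classY (f @` t) c) = classX t (loc_pull oX oY f t c).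
Proof.
move=> tX cZ; apply: induced_hclass => //.
- by move=> *; exact: loc_pullB.
- by move=> x; exact: loc_pull_cocycle.
- by move=> x _; exact: loc_pull_coboundary.
Qed.

Definition pull_family (F : {fset W} -> loc_fun W) : {fset V} -> loc_fun V :=
  fun t => if t \in X then loc_pull oX oY f t (F (f @` t)) *~ eps t else 0.

Lemma pull_family_cocycle F t : (forall u, u \in Y -> loc_cocycles oY u n (F u)) ->
  loc_cocycles oX t n (pull_family F t).
Proof.
move=> FZ; rewrite /pull_family; case: ifP => [tX|_]; last exact: sg_set0.
have := @sg_sum _ (loc_cocycles oX t n) unit [:: tt] (fun=> loc_pull oX oY f t (F (f @` t)))
  (fun=> eps t).
by rewrite big_seq1; apply => _ _; apply: loc_pull_cocycle; apply: FZ; exact: fS.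
Qed.

Lemma shriek_classE F : (forall u, u \in Y -> loc_cocycles oY u n (F u)) ->
  shriek_chain oX f (class_chain oY n F : dfun GY) = class_chain oX n (pull_family F) :> dfun GX.
Proof.
move=> FZ; apply: functional_extensionality_dep => t;
  rewrite /shriek_chain /class_chain /pull_family.
case: ifP => tX; last by rewrite hclass0.
have FtZ : loc_cocycles oY (f @` t) n (F (f @` t)) by apply: FZ; exact: fS.
rewrite loc_cohomology_pullE// (osignE oX oY fS f_inj tX) hclassMz//.
exact: loc_pull_cocycle.
Qed.

Lemma incid_map t s : s \in X -> t `<=` s -> t != fset0 ->
  incid oY (f @` s) (f @` t) = incid o' s t.
Proof.
move=> sX ts t0; rewrite (incid_fimset oY fS f_inj (S := fpowerset s))//.
- apply: (big_fset_only (F := incid o' s)).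
    move=> u; rewrite fpowersetE => us /eqP fut /eqP; case.
    exact: (fimset_inj f_inj sX us ts fut).
  by rewrite fpowersetE ts eqxx.
- by move=> u us _; rewrite fpowersetE.
rewrite -cardfs_eq0 (card_fimset f_inj (simplex_face sX ts t0)) cardfs_eq0.
exact: t0.
Qed.

(** Compare representing cochains at a fixed b containing t. The simplices s with t ⊆ s ⊆ b
    correspond under f to the u with f t ⊆ u ⊆ f b, with inverse [lift_face f b], and incidence
    numbers agree for the pulled-back orientation. *)
Lemma shriek_chain_diff (c : dfun GY) :
  cosheaf_diff oX (shriek_chain oX f c : dfun GX) = shriek_chain oX f (cosheaf_diff oY c).
Proof.
pose F u := hrepr (c u).
have FZ u : loc_cocycles oY u n (F u) by exact: hreprP.
have cE : c = class_chain oY n F.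
  by apply: functional_extensionality_dep => u; rewrite /class_chain hreprK.
rewrite cE shriek_classE//; apply: functional_extensionality_dep => t.
have [tX|tX] := boolP (t \in X); last by rewrite /cosheaf_diff /shriek_chain (negPf tX).
rewrite class_diffE//; last by move=> s _; apply: pull_family_cocycle.
have ftY := fS tX.
have SZ : loc_cocycles oY (f @` t) n (\sum_(u <- cofaces Y (f @` t)) F u *~ incid oY u (f @` t)).
  by apply: sg_sum => u; rewrite in_cofaces// => /andP[uY tu]; exact: loc_cocycles_sub tu _.
rewrite /shriek_chain tX class_diffE// loc_cohomology_pullE// (osignE oX oY fS f_inj tX).
rewrite -hclassMz; last exact: loc_pull_cocycle.
congr (classX t _); apply: functional_extensionality_dep => b.
rewrite dfun_sumE dfun_MzE {1}/loc_pull; case: ifPn => [/andP[bX tb]|nb]; last first.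
  rewrite mul0rz big_seq big1// => s; rewrite in_cofaces// => /andP[sX ts].
  rewrite dfun_MzE /pull_family sX dfun_MzE /loc_pull ifN ?mul0rz//.
  by apply: contraNN nb => /andP[-> sb]; exact: fsubset_trans sb.
pose K u : int := F u (f @` b) * incid oY u (f @` t).
have FS u : F u (f @` b) <> 0 -> u `<=` (f @` b).
  by case: (FZ u) => Fs _ /Fs; rewrite unfold_in => /andP[].
have zE (x k : int) : x *~ k = k * x by rewrite -mulrzr intz mulrC.
transitivity (eps b * eps t * \sum_(s <- cofaces X t | s `<=` b) K (f @` s)).
  rewrite mulr_sumr [RHS]big_mkcond; apply: eq_big_seq => s; rewrite in_cofaces// => /andP[sX ts].
  rewrite dfun_MzE /pull_family sX dfun_MzE /loc_pull bX /=; case: ifPn => sb;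
    last by rewrite !mul0rz.
  rewrite (osignE oX oY fS f_inj bX) !zE /K (incid_map sX ts (simplexP tX)).
  have := rsign_incid oX o' t sX; have := rsign_sqr oX o' sX; have := rsign_sqr oX o' tX.
  set e := rsign _ _ t; set e' := rsign _ _ s => ee ee' E.
  rewrite -[LHS]mul1r -ee (_ : e * e * _ = rsign oX o' b * F (f @` s) (f @` b) * e * e' * (incid
    oX s t * e)); last by ring.
  by rewrite E (_ : _ * e' * (e' * _) = rsign oX o' b * F (f @` s) (f @` b) * e * (e' * e') *
    incid o' s t); [rewrite ee'; ring|ring].
rewrite (osignE oX oY fS f_inj bX) zE mulrA [eps b * _]mulrC; congr (_ * _).
rewrite dfun_sumE (eq_bigr K); last by move=> u _; rewrite dfun_MzE zE mulrC.
transitivity (\sum_(u <- cofaces Y (f @` t)) \sum_(s <- cofaces X t | (s `<=` b) && ((f @` s) ==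
  u)) K u).
  rewrite [RHS](exchange_big_dep (fun s : {fset V} => s `<=` b))/=; last by move=> u s _ /andP[].
  rewrite big_seq_cond [RHS]big_seq_cond; apply: eq_bigr => s /andP[].
  rewrite in_cofaces// => /andP[sX ts] sb.
  rewrite (eq_bigl (fun u => u == (f @` s))); last by move=> u; rewrite sb eq_sym.
  apply/esym/(big_fset_only (F := K)); first by move=> u _ /eqP->; rewrite eqxx.
  by move=> _; rewrite eqxx in_cofaces// fimset_sub// !andbT; exact: fS.
apply: eq_big_seq => u; rewrite in_cofaces// => /andP[uY tu].
have [K0|K0] := eqVneq (K u) 0; first by rewrite big1 ?K0// => s _; rewrite K0.
have ub : u `<=` (f @` b).
  by apply: FS => F0; move: K0; rewrite /K F0 mul0r eqxx.
apply: (big_fset_only (F := fun=> K u) (x := lift_face f b u)).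
  move=> s _ /andP[sb /eqP su] /eqP; case.
  by apply: (fimset_inj f_inj bX sb (lift_face_sub _ _ _)); rewrite fimset_lift_face.
move=> _; rewrite fimset_lift_face// eqxx lift_face_sub /= andbT in_cofaces//.
rewrite (lift_face_simplex bX uY ub) /=; apply: (fimset_subK f_inj bX tb (lift_face_sub _ _ _)).
by rewrite fimset_lift_face.
Qed.

Hypothesis f_fin : finite_fibres X Y f.

Lemma finite_preimage (C : set {fset W}) : finite_set C -> (forall u, C u -> u \in Y) ->
  finite_set [set s | s \in X /\ C (f @` s)].
Proof.
move=> Cf CY; apply: (@sub_finite_set _ _ (\bigcup_(u in C) fibre X f u)%classic).
  by move=> s [sX Cs]; exists (f @` s).
by apply: bigcup_finite => // u /CY; exact: f_fin.
Qed.

Lemma shriek_chain_chains m (c : dfun GY) : chains GY m c ->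
  chains GX m (shriek_chain oX f c : dfun GX).
Proof.
move=> [cs cf].
have nz t : (shriek_chain oX f c : dfun GX) t <> 0 -> t \in X /\ c (f @` t) <> 0.
  rewrite /shriek_chain; case: ifP => // tX nz; split => // c0; apply: nz.
  rewrite c0 -(hclass0 (loc_cocycles oY (f @` t) n) (loc_coboundaries oY (f @` t) n)).
  rewrite loc_cohomology_pullE//; last exact: sg_set0.
  rewrite (_ : loc_pull _ _ _ _ _ = 0) ?hclass0 ?mul0rz//.
  by apply: functional_extensionality_dep => b; rewrite /loc_pull; case: ifP => // _; rewrite mulr0.
split.
  move=> t /nz[tX /cs]; rewrite unfold_in => /andP[_]; rewrite (card_fimset f_inj tX) => tm.
  by rewrite unfold_in /simplices tX tm.
apply: sub_finite_set (finite_preimage cf _) => [t /nz//|u /cs].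
by rewrite unfold_in => /andP[].
Qed.

Lemma shriek_chainB (c d : dfun GY) :
  shriek_chain oX f (c - d) = (shriek_chain oX f c : dfun GX) - shriek_chain oX f d.
Proof.
apply: functional_extensionality_dep => t; rewrite dfunB /shriek_chain.
case: ifP => tX; last by rewrite subr0.
rewrite -mulrzBl; congr (_ *~ _); apply: induced_zmod.
- by move=> *; exact: loc_pullB.
- by move=> x; exact: loc_pull_cocycle.
- by move=> x _; exact: loc_pull_coboundary.
Qed.

Lemma homology_shriekE k c : cycles oY GY k c ->
  homology_shriek oX oY f (hclass _ (boundaries oY GY k) c) =
  hclass _ (boundaries oX GX k) (shriek_chain oX f c).
Proof.
have s0 : shriek_chain oX f (0 : dfun GY) = (0 : dfun GX).
  by rewrite -(subrr (0 : dfun GY)) shriek_chainB subrr.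
move=> cZ; apply: induced_hclass => //.
- by move=> *; exact: shriek_chainB.
- move=> x [xc x0]; split; first exact: shriek_chain_chains.
  rewrite [LHS]shriek_chain_diff -[RHS]s0; congr shriek_chain; exact: x0.
- move=> x _ [b bc <-]; exists (shriek_chain oX f b : dfun GX); first exact: shriek_chain_chains.
  exact: shriek_chain_diff.
Qed.

Lemma pull_cocycle p (psi : dfun (constant_sheaf Y)) :
  cocycles_c oY (constant_sheaf Y) p psi ->
  cocycles_c oX (constant_sheaf X) p (pull_cochain oX oY f psi).
Proof.
move=> [[ps pf] p0]; split.
  have nz s : pull_cochain oX oY f psi s <> 0 -> s \in X /\ psi (f @` s) <> 0.
    rewrite /pull_cochain; case: ifP => // sX nz; split => // p1; apply: nz.
    by rewrite p1 mulr0.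
  split.
    move=> s /nz[sX /ps]; rewrite unfold_in => /andP[_]; rewrite (card_fimset f_inj sX) => sm.
    by rewrite unfold_in /simplices sX sm.
  apply: sub_finite_set (finite_preimage pf _) => [s /nz//|u /ps].
  by rewrite unfold_in => /andP[].
apply: functional_extensionality_dep => r.
have [rX|rX] := boolP (r \in X); last by rewrite /= /sheaf_diff (negPf rX).
have [r1|r1] := ltnP 1 #|` r|; last first.
  rewrite /= /sheaf_diff rX big1// => i iX; have ci := card_face oX i.
  by move: iX; rewrite (_ : face _ _ _ = fset0) ?(negPf (simplex_neq0 X))//; apply/eqP;
    rewrite -cardfs_eq0; lia.
rewrite [LHS]constant_sheaf_diffE// set_diffE.
transitivity (eps r * set_diff o' (fun s => psi (f @` s)) r).
  rewrite set_diffE mulr_sumr; apply: eq_big_seq => s; rewrite fpowersetE => sr.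
  have [i0|/incid_sub[_ sc]] := eqVneq (incid oX r s) 0.
    have := rsign_incid oX o' s rX; rewrite i0 mul0r mulr0 => E.
    by rewrite mulrCA -E mulr0.
  have sX : s \in X by apply: (simplex_face rX sr); rewrite -cardfs_eq0; lia.
  rewrite /pull_cochain sX (osignE oX oY fS f_inj sX).
  have := rsign_incid oX o' s rX; set e := rsign _ _ s; set e' := rsign _ _ r => E.
  by rewrite (_ : e * _ * _ = psi (f @` s) * (incid oX r s * e)); [rewrite E; ring|ring].
rewrite (_ : set_diff _ _ _ = set_diff oY psi (f @` r)); last first.
  rewrite /set_diff (card_fimset f_inj rX); apply: eq_bigr => i _.
  by rewrite (fimset_face oY fS f_inj i rX).
rewrite -constant_sheaf_diffE ?(card_fimset f_inj rX)//; last exact: fS.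
by rewrite [sheaf_diff oY psi]p0 mulr0.
Qed.

(** The right side is the sorted term R of [cup_class_reorient]. It evaluates the cochain on the
    back face of a in the pulled-back order, which f carries to the back face of f a used on the
    left. *)
Lemma shriek_cap q (psi : dfun (constant_sheaf Y)) t : (q <= n)%N -> t \in X ->
  (shriek_chain oX f (cup_class oY n (fun s g => g s) q psi) : dfun GX) t =
  classX t (top_cochain oX n (fun s g => rsign oX o' (entries s) * g (vseq o' (entries s)))
    (cup_front oX q t (pull_cochain oX oY f psi))).
Proof.
move=> qn tX.
have ZY u : loc_cocycles oY u n (top_cochain oY n (fun s g => g s) (cup_front oY q u psi)).
  by apply: (top_cochain_cocycle oY dimY (local_eval W)); rewrite addn0 ltnS.
rewrite /cup_class shriek_classE//; congr (classX t _).
apply: functional_extensionality_dep => a; rewrite /pull_family tX dfun_MzE /loc_pull /top_cochain.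
have [aX|aX] := boolP (a \in X); last by rewrite mul0rz.
have zE (x k : int) : x *~ k = k * x by rewrite -mulrzr intz mulrC.
rewrite /= zE (osignE oX oY fS f_inj aX) (fS aX) (card_fimset f_inj aX) vseqK /=.
have [an|an] := boolP (#|` a| == n.+1); last by case: ifP; rewrite !mulr0.
(* A cochain with constant coefficients is treated as one that does not depend on a. *)
rewrite (cup_front_change oX o' q t (fun r _ => pull_cochain oX oY f psi r) aX).
have subX w : subseq w (vseq o' a) -> osgn o' w = 1 by move=> wa; rewrite (subseq_vseq aX _ wa).2.
have subY w : subseq w (vseq oY (f @` a)) -> osgn oY w = 1.
  by move=> wa; rewrite (subseq_vseq (fS aX) _ wa).2.
rewrite /cup_front !subX ?take_subseq ?drop_subseq// !subY ?take_subseq ?drop_subseq// !mul1r.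
rewrite -!frontE -!backE -(fimset_back oY fS f_inj q aX) -(fimset_front oY fS f_inj q aX).
have bX : back o' a q \in X.
  rewrite backE; apply: (entries_simplex aX); first by move=> v /mem_drop; rewrite mem_vseq.
  by rewrite size_drop size_vseq (eqP an); lia.
have fa : front o' a q `<=` a by apply/fsubsetP => v; rewrite !inE => /andP[].
rewrite /resign /pull_cochain bX (osignE oX oY fS f_inj bX).
case: ifPn => ta; last first.
  rewrite mulr0; case: eqP => [ft|_]; last by rewrite mul0r mulr0.
  by rewrite -ft fa in ta.
have -> : ((f @` front o' a q) == (f @` t)) = (front o' a q == t).
  by apply/eqP/eqP => [|->//]; exact: (fimset_inj f_inj aX fa ta).
have := rsign_sqr oX o' bX; set e := rsign _ _ (back _ _ _) => ee.
case: eqP => _ /=; last by rewrite !mul0r !mulr0.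
rewrite (_ : _ * (1 * (e * _ * _)) = eps t * (eps a * (e * e * psi (f @` back o' a q))));
  last by ring.
by rewrite ee !mul1r.
Qed.

Lemma cap_const_natural p (h : cohomology_c oY (constant_sheaf Y) p) :
  cap_const (fundamental_class oX n) (cohomology_pull oX oY f h) =
  homology_shriek oX oY f (cap_const (fundamental_class oY n) h).
Proof.
rewrite /cap_const !cap_const_chainE//.
set psi := hrepr h; set phi := hrepr (cohomology_pull _ _ _ _).
have psiZ : cocycles_c oY (constant_sheaf Y) p psi by exact: hreprP.
have phiZ : cocycles_c oX (constant_sheaf X) p phi by exact: hreprP.
have plZ := pull_cocycle psiZ.
have [pn|np] := leqP p n; last first.
  have high (U : choiceType) (Z : lf_complex U) (o : orientation Z) (c : dfun (constant_sheaf Z)) :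
      (forall r, r \in Z -> (#|` r| <= n.+1)%N) -> cochains_c (constant_sheaf Z) p.+1 c ->
      cup_class o n (fun s g => g s) (n - p) c = 0.
    move=> dimZ [cs _]; apply: functional_extensionality_dep => t; apply: contrapT.
    move=> /(cup_class_neq0 (local_eval U))[|_ _ [r [a [/cs + _ _]]]].
      by rewrite addn0 ltnS leq_subr.
    by rewrite unfold_in /simplices => /andP[/dimZ rn /eqP rp]; move: rn; rewrite rp ltnS leqNgt np.
  have [[psiC _] [phiC _]] := (psiZ, phiZ).
  rewrite !high// homology_shriekE; last exact: sg_set0.
  congr (hclass _ _ _); rewrite -(subrr (0 : dfun GY)) shriek_chainB subrr.
  by [].
move: (n - p)%N (subnKC pn) => q pq.
have qn : (q <= n)%N by lia.
have cZ := cup_class_cycle dimY pq psiZ.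
rewrite homology_shriekE//.
have C1 := cup_class_cycle dimX pq phiZ.
have C2 := cup_class_cycle dimX pq plZ.
(* The chosen representative of the pulled-back class is replaced by the explicit one, at the cost
   of a product with a coboundary. *)
transitivity (hclass (cycles oX GX q) (boundaries oX GX q)
   (cup_class oX n (fun s g => g s) q (pull_cochain oX oY f psi))).
  apply/hclass_eq => //.
  rewrite (_ : _ - _ = cup_class oX n (fun s g => g s) q (phi - pull_cochain oX oY f psi : dfun
    (constant_sheaf X))).
    by apply: (cup_class_boundary dimX pq); exact: hclass_repr.
  apply: functional_extensionality_dep => t; rewrite dfunB.
  transitivity (cup_class oX n (fun s g => g s) q (fun r => 1 * phi r + -1 * pull_cochain oX oY f
    psi r) t).
    by rewrite (cup_class_comb oX dimX (local_eval V)) ?mulr1z ?mulrN1z// addn0 ltnS.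
  by congr (cup_class _ _ _ _ _ t); apply: funext => r; rewrite mul1r mulN1r.
have sZ : cycles oX GX q (shriek_chain oX f (cup_class oY n (fun s g => g s) q psi)).
  case: cZ => cC c0; split; first exact: shriek_chain_chains.
  rewrite [LHS]shriek_chain_diff (_ : cosheaf_diff oY _ = 0); last exact: c0.
  by rewrite -(subrr (0 : dfun GY)) shriek_chainB subrr.
apply/hclass_eq => //.
exists (cup_class oX n (htpy (fun s => vseq o' (entries s)) (osgn o')) q.+1 (pull_cochain oX oY f
  psi)).
  apply: (cup_class_chains oX (local_htpy o')); first by rewrite addn1 ltnS; lia.
  by case: plZ => -[].
apply: functional_extensionality_dep => t; rewrite dfunB.
have [tX|tX] := boolP (t \in X).
  rewrite shriek_cap//; exact: (cup_class_reorient dimX o' pq plZ tX).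
rewrite /= /cosheaf_diff /shriek_chain (negPf tX) subr0; apply/esym; apply: contrapT.
move=> /(cup_class_neq0 (local_eval V))[|]; first by rewrite addn0 ltnS.
by rewrite (negPf tX).
Qed.

End ShriekChains.

(** Each vertex of s belongs to the star of s, which is closed under nonempty faces, and there the
    inverse vertex map recovers it from its image. *)
Lemma star_iso_inj (V W : choiceType) (X : lf_complex V) (Y : lf_complex W) (f : V -> W) :
  star_iso X Y f -> forall s, s \in X -> {in s &, injective f}.
Proof.
move=> f_star s sX; have [_ [g [_ gf _]]] := f_star s sX.
have in_star v : v \in s -> star X s [fset v].
  move=> vs L [[_ Lface] starL]; apply: (Lface s).
  - by apply: starL; split => //; exact: fsubset_refl.
  - by rewrite fsub1set.
  - by apply/fset0Pn; exists v; rewrite inE.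
by move=> u v us vs uv; rewrite -(gf u (in_star u us)) uv gf//; exact: in_star.
Qed.

Theorem theorem2 (R : realType) (V W : choiceType)
    (X : lf_complex V) (Y : lf_complex W)
    (oX : orientation X) (oY : orientation Y) (n : nat)
    (cmX : locally_cohen_macaulay oX n) (cmY : locally_cohen_macaulay oY n)
    (f : V -> W) (f_simp : simplicial X Y f)
    (f_loc : local_homeomorphism (realization_map R f_simp))
    (f_star : star_iso X Y f) :
  (forall (p : nat) (phi : cohomology_c oX (loc_homology_sheaf oX n) p),
     homology_push oX oY f (cap_sheaf (fundamental_class oX n) phi) =
     cap_sheaf (fundamental_class oY n) (cohomology_shriek oX oY f phi)) /\
  (finite_fibres X Y f ->
   forall (p : nat) (psi : cohomology_c oY (constant_sheaf Y) p),
     cap_const (fundamental_class oX n) (cohomology_pull oX oY f psi) =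
     homology_shriek oX oY f (cap_const (fundamental_class oY n) psi)).
Proof.
have f_inj := star_iso_inj f_star.
have dimX := cm_card cmX; have dimY := cm_card cmY.
split => [p phi|f_fin p psi]; first exact: cap_sheaf_natural.
exact: cap_const_natural.
Qed.
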